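(* Let $\Gamma$ be a 3-star with ray lengths $k,l,m\ge1$, with central vertex $d$ and with $a_1,b_1,c_1$ the vertices adjacent to $d$ on the three rays. Write its adjacency matrix as $\Delta_\Gamma=\begin{pmatrix} 0 & G \\ G^t & 0 \end{pmatrix}$, with rows of $G$ labeled by the vertices at even distance from $d$ and columns by the vertices at odd distance from $d$. Let $\xi:\Gamma_0\to\mathbb R_+$ be the Perron–Frobenius eigenvector of $\Delta_\Gamma$ on the vertex set $\Gamma_0$, normalized by $\xi(d)=1$, set $$\alpha_1=\xi(a_1),\quad\alpha_2=\xi(b_1),\quad\alpha_3=\xi(c_1),$$ and let $\lambda=\alpha_1+\alpha_2+\alpha_3$ be the Perron–Frobenius eigenvalue. Then $\Gamma$ admits a commuting square of multi-matrix algebras of the form $$\begin{array}{ccc} B&\subset_{G^tG-I}&D\\ \cup_G&&\cup_G\\ A&\subset_{GG^t-I}&C\end{array}$$ if and only if there exist 9 vectors $(e_{ij})_{i,j=1}^3$ in $\mathbb C^2$ for which (a) $\|e_{ii}\|^2=(\lambda-\alpha_i)(\lambda\alpha_i-1)$, $i=1,2,3$; (b) $\|e_{ij}\|^2=\alpha_i+\alpha_j-\lambda\alpha_i\alpha_j$, $i\ne j$; (c) $\sum_je_{ij}\otimes\overline e_{ij}=\alpha_iI_2$, $i=1,2,3$; (d) $\sum_ie_{ij}\otimes\overline e_{ij}=\alpha_jI_2$, $j=1,2,3$, where $I_2$ is the unit $2\times2$ matrix.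
   Context: A 3-star with ray lengths $k,l,m$ is the tree consisting of a central vertex with three rays attached, which are paths containing $k$, $l$ and $m$ vertices respectively (not counting the central vertex). For vectors $x,y$ in a Hilbert space, $x\otimes\overline y$ denotes the operator $z\mapsto(z,y)x$. A multi-matrix algebra is a finite direct sum of full complex matrix algebras; $X\subset_M Y$ means that $X$ is a unital $*$-subalgebra of $Y$ with inclusion matrix $M$ ($M_{pq}$ is the multiplicity of the $p$-th summand of $X$ in the $q$-th summand of $Y$). The diagram means $A\subset_{GG^t-I}C$, $A\subset_GB$, $B\subset_{G^tG-I}D$, $C\subset_GD$. It is a commuting square, with respect to a faithful trace on $D$, if the trace-preserving conditional expectations satisfy $E_A=E_BE_C=E_CE_B$. *)

(* Defs.v *)
From HB Require Import structures.
From mathcomp Require Import all_boot all_order all_algebra.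
From mathcomp Require Import sesquilinear spectral.
From mathcomp Require Import complex.
From mathcomp Require Import reals.

Set Implicit Arguments.
Unset Strict Implicit.
Unset Printing Implicit Defensive.

Import Order.TTheory GRing.Theory Num.Theory.
Local Open Scope ring_scope.
Local Open Scope sesquilinear_scope.
Local Open Scope complex_scope.

(* Vectors of C^n are column vectors; the inner product is linear in its      *)
(* first argument.                                                            *)
Definition dotc (C : numClosedFieldType) (n : nat) (x y : 'cV[C]_n) : C :=
  \sum_(i < n) x i 0 * (y i 0)^*.

(* The operator x (x) \bar y.                                                 *)
Definition tens (C : numClosedFieldType) (n : nat) (x y : 'cV[C]_n) : 'M[C]_n :=
  x *m y ^t*.

Lemma tensE (C : numClosedFieldType) (n : nat) (x y z : 'cV[C]_n) :
  tens x y *m z = dotc z y *: x.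
Proof.
apply/colP => i; rewrite /tens -mulmxA !mxE big_ord1 !mxE mulrC; congr (_ * _).
by apply: eq_bigr => j _; rewrite !mxE mulrC.
Qed.

Section MultiMatrix.
Variable C : numClosedFieldType.

(* The direct sum of the full matrix algebras 'M_(n p), p < r.  Only          *)
(* dimension vectors n with positive entries are used.                        *)
Definition multimx (r : nat) (n : 'I_r -> nat) : Type :=
  {dffun forall p : 'I_r, 'M[C]_(n p)}.

Section Structure.
Variables (r : nat) (n : 'I_r -> nat).
Local Notation mm := (multimx n).

HB.instance Definition _ := Choice.copy mm {dffun forall p : 'I_r, 'M[C]_(n p)}.

Definition mm_of (f : forall p : 'I_r, 'M[C]_(n p)) : mm :=
  [ffun p : 'I_r => (f p : 'M[C]_(n p))].

Lemma mm_ofE f p : mm_of f p = f p. Proof. by rewrite ffunE. Qed.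

Lemma mmP (x y : mm) : (forall p, x p = y p) <-> x = y.
Proof. by split=> [e|->//]; apply/ffunP => p; apply: e. Qed.

Definition mm_add (x y : mm) : mm := mm_of (fun p => x p + y p).
Definition mm_opp (x : mm) : mm := mm_of (fun p => - x p).
Definition mm_mul (x y : mm) : mm := mm_of (fun p => x p *m y p).
Definition mm_scale (a : C) (x : mm) : mm := mm_of (fun p => a *: x p).
Definition mm_adj (x : mm) : mm := mm_of (fun p => (x p) ^t*).

Fact mm_addA : associative mm_add.
Proof. by move=> x y z; apply/mmP => p; rewrite !mm_ofE addrA. Qed.
Fact mm_addC : commutative mm_add.
Proof. by move=> x y; apply/mmP => p; rewrite !mm_ofE addrC. Qed.
Fact mm_add0 : left_id (mm_of (fun=> 0)) mm_add.
Proof. by move=> x; apply/mmP => p; rewrite !mm_ofE add0r. Qed.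
Fact mm_addN : left_inverse (mm_of (fun=> 0)) mm_opp mm_add.
Proof. by move=> x; apply/mmP => p; rewrite !mm_ofE addNr. Qed.

HB.instance Definition _ :=
  GRing.isZmodule.Build mm mm_addA mm_addC mm_add0 mm_addN.

Fact mm_mulA : associative mm_mul.
Proof. by move=> x y z; apply/mmP => p; rewrite !mm_ofE mulmxA. Qed.
Fact mm_mul1 : left_id (mm_of (fun=> 1%:M)) mm_mul.
Proof. by move=> x; apply/mmP => p; rewrite !mm_ofE mul1mx. Qed.
Fact mm_mulr1 : right_id (mm_of (fun=> 1%:M)) mm_mul.
Proof. by move=> x; apply/mmP => p; rewrite !mm_ofE mulmx1. Qed.
Fact mm_mulDl : left_distributive mm_mul +%R.
Proof. by move=> x y z; apply/mmP => p; rewrite !mm_ofE mulmxDl. Qed.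
Fact mm_mulDr : right_distributive mm_mul +%R.
Proof. by move=> x y z; apply/mmP => p; rewrite !mm_ofE mulmxDr. Qed.

HB.instance Definition _ := GRing.Zmodule_isPzRing.Build mm
  mm_mulA mm_mul1 mm_mulr1 mm_mulDl mm_mulDr.

Fact mm_scaleA a b (x : mm) : mm_scale a (mm_scale b x) = mm_scale (a * b) x.
Proof. by apply/mmP => p; rewrite !mm_ofE scalerA. Qed.
Fact mm_scale1 : left_id 1 mm_scale.
Proof. by move=> x; apply/mmP => p; rewrite !mm_ofE scale1r. Qed.
Fact mm_scaleDr : right_distributive mm_scale +%R.
Proof. by move=> a x y; apply/mmP => p; rewrite !mm_ofE scalerDr. Qed.
Fact mm_scaleDl (x : mm) : {morph mm_scale^~ x : a b / a + b}.
Proof. by move=> a b; apply/mmP => p; rewrite !mm_ofE scalerDl. Qed.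

HB.instance Definition _ := GRing.Zmodule_isLmodule.Build C mm
  mm_scaleA mm_scale1 mm_scaleDr mm_scaleDl.

Lemma mm_addE (x y : mm) p : (x + y) p = x p + y p.
Proof. exact: mm_ofE. Qed.
Lemma mm_mulE (x y : mm) p : (x * y) p = x p *m y p.
Proof. exact: mm_ofE. Qed.
Lemma mm_scaleE a (x : mm) p : (a *: x) p = a *: x p.
Proof. exact: mm_ofE. Qed.
Lemma mm_0E p : (0 : mm) p = 0. Proof. exact: mm_ofE. Qed.
Lemma mm_1E p : (1 : mm) p = 1%:M. Proof. exact: mm_ofE. Qed.

Definition mm_pos (x : mm) : Prop :=
  forall (p : 'I_r) (v : 'cV[C]_(n p)), 0 <= dotc (x p *m v) v.

(* No normalization of the trace is imposed.                                  *)
Definition faithful_trace (tau : mm -> C) : Prop :=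
  [/\ scalar tau,
      forall x y, tau (x * y) = tau (y * x),
      forall x, 0 <= tau (mm_adj x * x)
    & forall x, tau (mm_adj x * x) = 0 -> x = 0].

Definition cond_exp (tau : mm -> C) (S : mm -> Prop) (E : mm -> mm) : Prop :=
  [/\ linear E,
      forall x, S (E x),
      forall x, S x -> E x = x,
      forall x y z, S x -> S z -> E (x * y * z) = x * E y * z
    & (forall x, mm_pos x -> mm_pos (E x)) /\ (forall x, tau (E x) = tau x)].

Definition commuting_square (tau : mm -> C) (SA SB SC : mm -> Prop) : Prop :=
  exists EA EB EC : mm -> mm,
    [/\ cond_exp tau SA EA, cond_exp tau SB EB, cond_exp tau SC EC,
        EA =1 EB \o EC & EA =1 EC \o EB].

End Structure.

Definition in_range (T U : Type) (f : T -> U) (y : U) : Prop :=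
  exists x, f x = y.

Definition star_embedding (r s : nat) (n : 'I_r -> nat) (m : 'I_s -> nat)
    (phi : multimx n -> multimx m) : Prop :=
  [/\ linear phi, phi 1 = 1, {morph phi : x y / x * y},
      {morph phi : x / mm_adj x} & injective phi].

(* Multiplicities of phi : the representation x |-> phi x q of the source on  *)
(* C^(m q) is the orthogonal direct sum, over p, of mu p q copies of the      *)
(* irreducible representation x |-> x p on C^(n p).  The isometry V p t       *)
(* embeds the t-th copy.                                                      *)
Definition has_multiplicities (r s : nat) (mu : 'M[nat]_(r, s))
    (n : 'I_r -> nat) (m : 'I_s -> nat) (phi : multimx n -> multimx m) : Prop :=
  forall q : 'I_s, exists V : forall p : 'I_r, 'I_(mu p q) -> 'M[C]_(m q, n p),
    [/\ forall p t t', (V p t) ^t* *m V p t' = (t == t')%:R%:M,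
        forall p p' t t', p != p' -> (V p t) ^t* *m V p' t' = 0,
        \sum_(p < r) \sum_(t < mu p q) V p t *m (V p t) ^t* = 1%:M
      & forall x : multimx n,
          phi x q = \sum_(p < r) \sum_(t < mu p q) V p t *m x p *m (V p t) ^t*].

(* Inclusion matrices are integral so that G *m G^T - 1%:M can be formed      *)
(* without truncation.                                                        *)
Definition inclusion (r s : nat) (M : 'M[int]_(r, s))
    (n : 'I_r -> nat) (m : 'I_s -> nat) (phi : multimx n -> multimx m) : Prop :=
  star_embedding phi /\
  exists2 mu : 'M[nat]_(r, s), M = map_mx Posz mu & has_multiplicities mu phi.

(* Existence of a commuting square                                            *)
(*      B  c  D                                                               *)
(*      u     u                                                               *)
(*      A  c  C                                                               *)
(* with the given inclusion matrices.  Subalgebras are represented by         *)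
(* embeddings, and the ranges in D are the actual subalgebras.                *)
Definition admits_commuting_square (rA rB rC rD : nat)
    (MAB : 'M[int]_(rA, rB)) (MAC : 'M[int]_(rA, rC))
    (MBD : 'M[int]_(rB, rD)) (MCD : 'M[int]_(rC, rD)) : Prop :=
  exists (a : 'I_rA -> nat) (b : 'I_rB -> nat)
         (c : 'I_rC -> nat) (d : 'I_rD -> nat),
  [/\ forall p, (0 < a p)%N, forall p, (0 < b p)%N,
      forall p, (0 < c p)%N & forall p, (0 < d p)%N] /\
  exists (iAB : multimx a -> multimx b) (iAC : multimx a -> multimx c)
         (iBD : multimx b -> multimx d) (iCD : multimx c -> multimx d),
  [/\ inclusion MAB iAB, inclusion MAC iAC, inclusion MBD iBD,
      inclusion MCD iCD & iBD \o iAB =1 iCD \o iAC] /\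
  exists2 tau : multimx d -> C, faithful_trace tau &
    commuting_square tau (in_range (iBD \o iAB)) (in_range iBD) (in_range iCD).

End MultiMatrix.

Section Star.
Variable ray : 'I_3 -> nat.

(* None is the central vertex; Some (Tagged _ (j : 'I_(ray i))) is the vertex *)
(* at distance j + 1 from the centre on the i-th ray.                         *)
Definition star_vertex : finType := option {i : 'I_3 & 'I_(ray i)}.

Definition star_center : star_vertex := None.

Definition star_dist (v : star_vertex) : nat :=
  if v is Some u then (tagged u).+1 else 0.

Definition star_adj : rel star_vertex := fun v w =>
  match v, w with
  | None, None => false
  | Some u, None | None, Some u => (tagged u : nat) == 0
  | Some u, Some u' => (tag u == tag u') &&
      (((tagged u).+1 == tagged u' :> nat) || ((tagged u').+1 == tagged u :> nat))
  end.

Lemma star_adj_sym : symmetric star_adj.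
Proof.
move=> [[i x]|] [[j y]|] //=; rewrite eq_sym.
by case: (j == i) => //=; rewrite orbC.
Qed.

Lemma star_adj_parity v w :
  star_adj v w -> odd (star_dist v) != odd (star_dist w).
Proof.
case: v w => [[i x]|] [[j y]|] //=; last 2 first.
- by move/eqP->.
- by move/eqP->.
by case/andP=> _ /orP[] /eqP <- /=; [case: (odd x)|case: (odd y)].
Qed.

Definition star_even : {set star_vertex} := [set v | ~~ odd (star_dist v)].
Definition star_odd : {set star_vertex} := [set v | odd (star_dist v)].

(* Enumeration of the vertices, even ones first.                              *)
Definition star_enum (p : 'I_(#|star_even| + #|star_odd|)) : star_vertex :=
  match split p with inl q => enum_val q | inr q => enum_val q end.

Lemma star_enum_inj : injective star_enum.
Proof.
move=> p q; rewrite /star_enum.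
case: (split_ordP p) => {}p ->; case: (split_ordP q) => {}q -> //.
- by move/enum_val_inj->.
- by move=> E; have := enum_valP p; have := enum_valP q; rewrite E !inE => ->.
- by move=> E; have := enum_valP p; have := enum_valP q; rewrite E !inE => /negPf->.
- by move/enum_val_inj->.
Qed.

Lemma star_enum_bij : bijective star_enum.
Proof.
apply: (inj_card_bij star_enum_inj); rewrite card_ord.
have -> : star_odd = ~: star_even by apply/setP => v; rewrite !inE negbK.
by rewrite cardsC.
Qed.

Definition star_mx : 'M[int]_(#|star_even| + #|star_odd|) :=
  \matrix_(p, q) (star_adj (star_enum p) (star_enum q))%:R.

Definition star_G : 'M[int]_(#|star_even|, #|star_odd|) := ursubmx star_mx.

Lemma star_mxE : star_mx = block_mx 0 star_G star_G^T 0.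
Proof.
rewrite -[LHS]submxK -/star_G; congr block_mx; apply/matrixP => p q;
  rewrite !mxE /star_enum ?(unsplitK (inl _)) ?(unsplitK (inr _)).
- case: (boolP (star_adj _ _)) => // /star_adj_parity.
  by have := enum_valP p; have := enum_valP q; rewrite !inE => /negPf-> /negPf->.
- by rewrite star_adj_sym.
- case: (boolP (star_adj _ _)) => // /star_adj_parity.
  by have := enum_valP p; have := enum_valP q; rewrite !inE => -> ->.
Qed.

End Star.

(* lambda is the spectral radius of M and x an eigenvector with positive      *)
(* entries for it.                                                            *)
Definition perron_frobenius (R : realType) (n : nat) (M : 'M[R]_n)
    (lambda : R) (x : 'cV[R]_n) : Prop :=
  [/\ forall i, 0 < x i 0, M *m x = lambda *: x
    & forall mu : R[i], eigenvalue (map_mx (real_complex R) M) mu ->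
        `|mu| <= lambda%:C].

Definition ray3 (k l m : nat) (i : 'I_3) : nat := tnth [tuple k; l; m] i.

Lemma ray3_gt0 (k l m : nat) : (0 < k)%N -> (0 < l)%N -> (0 < m)%N ->
  forall i, (0 < ray3 k l m i)%N.
Proof. by move=> k0 l0 m0 [[|[|[|i]]] //= lt_i3]. Qed.

(* The neighbour of the centre on the i-th ray.                               *)
Definition star_first (ray : 'I_3 -> nat) (ray_gt0 : forall i, (0 < ray i)%N)
    (i : 'I_3) : star_vertex ray :=
  Some (Tagged (fun i => 'I_(ray i)) (Ordinal (ray_gt0 i))).

(* Main.v *)
Require Import Defs.
From mathcomp Require Import all_boot all_order all_algebra.
From mathcomp Require Import sesquilinear spectral.
From mathcomp Require Import complex.
From mathcomp Require Import reals.
From mathcomp Require Import boolp zify ring.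

(** The theorem is proved by translating commuting squares into finite systems of
    numbers.

    Consider four inclusions A < B < D and A < C < D with the same composite. For a
    summand p of A and a summand s of D, the paths A - B - D and the paths A - C - D
    from p to s are two orthonormal systems of intertwiners, so they differ by a
    unitary matrix with rows q in B and columns (r, t), r in C, where t numbers the
    copies of p in r. If the entries of these matrices are regrouped for fixed q and r
    and scaled by trace weights, the conditional expectations commute exactly when the
    new matrices have orthogonal rows. Such a system of numbers is a [connection], and
    [connection_of_commuting_square] and [commuting_square_of_connection] go from one
    side to the other.

    For the inclusion matrices of the theorem there are as many paths B - A - C as
    paths B - D - C, so the regrouped matrices are square and have orthogonal columns
    too. Adding squares of moduli in two ways then shows that the trace weights are
    proportional to the Perron-Frobenius vector ([markov_weights]), whatever faithful
    trace was given. The only multiple edge is the double one of G *m G^T - 1 at the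
    centre d. For the first vertices i and j of two rays, the two entries with p = r = d,
    q = i, s = j are the coordinates of e_ij. Unitarity for (p, s) = (d, j) is (d), and
    the dual condition for (q, r) = (i, d) is (c). In its row e_ij is followed by at
    most one more entry, with r at distance two on the ray j; for i <> j the dual block
    of that entry is 1 x 1, so its modulus is known, and this gives (b). Taking traces
    in (c) then gives (a) ([star_vectors_of_square]).

    Conversely, let the vectors be given. Away from the centre all blocks have size at
    most two, their moduli are determined by the eigenvector, and a single sign makes
    them orthogonal; that they fit together is the identity [xray_four], a consequence
    of the three-term recurrence along a ray. At the centre, the two columns formed by
    the coordinates of e_1j, e_2j, e_3j are completed to a 3 x 3 block by a cross
    product ([unitary_completion]), and (a) and (b) say that the new entries have the
    moduli that the neighbouring blocks prescribe. Exchanging (p, q) with (r, s)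
    interchanges unitarity and the dual condition and transposes the array of vectors
    ([star_cell_sym]), so it is enough to verify one of the two conditions
    ([star_cell_col]). *)

Set Implicit Arguments.
Unset Strict Implicit.
Unset Printing Implicit Defensive.

Import Order.TTheory GRing.Theory Num.Theory.
Local Open Scope ring_scope.

(** * Matrices and inclusions of multi-matrix algebras *)

Section Adjoint.
Local Open Scope sesquilinear_scope.
Variable K : numClosedFieldType.

Lemma adjmxM m n p (A : 'M[K]_(m, n)) (B : 'M_(n, p)) :
  (A *m B) ^t* = B ^t* *m A ^t*.
Proof. by rewrite trmx_mul map_mxM. Qed.

Lemma adjmxD m n (A B : 'M[K]_(m, n)) : (A + B) ^t* = A ^t* + B ^t*.
Proof. by rewrite linearD /= map_mxD. Qed.

Lemma adjmx0 m n : (0 : 'M[K]_(m, n)) ^t* = 0.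
Proof. by rewrite trmx0 map_mx0. Qed.

Lemma adjmx_sum I (r : seq I) (P : pred I) m n (F : I -> 'M[K]_(m, n)) :
  (\sum_(i <- r | P i) F i) ^t* = \sum_(i <- r | P i) (F i) ^t*.
Proof. by apply: (big_morph (fun A : 'M[K]_(m, n) => A ^t*) (@adjmxD m n)); rewrite adjmx0. Qed.

Lemma adjmxZ m n (a : K) (A : 'M[K]_(m, n)) : (a *: A) ^t* = a^* *: A ^t*.
Proof. by rewrite linearZ /= map_mxZ. Qed.

Lemma adjmx_scalar n (a : K) : (a%:M : 'M[K]_n) ^t* = (a^*)%:M.
Proof. by rewrite tr_scalar_mx map_scalar_mx. Qed.

Lemma scalar0mx n : (0 : K)%:M = 0 :> 'M_n.
Proof. exact: raddf0. Qed.

Lemma dotcE n (x y : 'cV[K]_n) : dotc x y = (y ^t* *m x) 0 0.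
Proof. by rewrite mxE; apply: eq_bigr => i _; rewrite !mxE mulrC. Qed.

Lemma adjmx_mul_ge0 m n (A : 'M[K]_(m, n)) j : 0 <= (A ^t* *m A) j j.
Proof. by rewrite mxE sumr_ge0 // => k _; rewrite !mxE mulrC mul_conjC_ge0. Qed.

Lemma adjmx_mul_eq0 m n (A : 'M[K]_(m, n)) : A ^t* *m A = 0 -> A = 0.
Proof.
move=> A0; apply/matrixP => i j; have := congr1 (fun B : 'M_n => B j j) A0.
rewrite !mxE => /eqP; rewrite psumr_eq0 => [|k _]; last first.
  by rewrite !mxE mulrC mul_conjC_ge0.
move/allP/(_ i); rewrite mem_index_enum => /(_ isT) /=.
by rewrite !mxE mulf_eq0 conjC_eq0 orbb => /eqP.
Qed.

(** Schur's lemma for the full matrix algebra. *)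
Lemma scalar_of_commuting n (M : 'M[K]_n) :
  (forall x, M *m x = x *m M) -> exists a, M = a%:M.
Proof.
case: n M => [|n] M cM; first by exists 0; apply/matrixP => -[].
exists (M ord0 ord0); apply/matrixP => i j; rewrite mxE.
have := congr1 (fun A : 'M_n.+1 => A i j) (cM (delta_mx ord0 j)).
have -> : (M *m delta_mx ord0 j) i j = M i ord0.
  rewrite mxE (bigD1 ord0) //= big1 ?addr0 => [|k nk].
    by rewrite mxE !eqxx mulr1.
  by rewrite mxE (negPf nk) mulr0.
have E k : (delta_mx k j *m M) i j = (i == k)%:R * M j j.
  rewrite mxE (bigD1 j) //= big1 ?addr0 => [|l nl].
    by rewrite mxE eqxx andbT.
  by rewrite mxE (negPf nl) andbF mul0r.
rewrite E => e0; have := congr1 (fun A : 'M_n.+1 => A i j) (cM (delta_mx i j)).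
rewrite E eqxx mul1r mxE (bigD1 i) //= big1 ?addr0 => [|k nk]; last first.
  by rewrite mxE (negPf nk) mulr0.
rewrite mxE !eqxx mulr1 => e1.
have := congr1 (fun A : 'M_n.+1 => A ord0 j) (cM (delta_mx ord0 j)).
have -> : (M *m delta_mx ord0 j) ord0 j = M ord0 ord0.
  rewrite mxE (bigD1 ord0) //= big1 ?addr0 => [|k nk].
    by rewrite mxE !eqxx mulr1.
  by rewrite mxE (negPf nk) mulr0.
rewrite mxE (bigD1 j) //= big1 ?addr0 => [|l nl]; last first.
  by rewrite mxE (negPf nl) andbF mul0r.
rewrite mxE !eqxx mul1r => e2.
case: (eqVneq i j) => [<-|nij]; first by rewrite e1 e2 mulr1n; congr (M _ _).
have := congr1 (fun A : 'M_n.+1 => A i i) (cM (delta_mx j i)).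
rewrite mxE (bigD1 j) //= big1 ?addr0 => [|k nk]; last first.
  by rewrite mxE (negPf nk) mulr0.
rewrite mxE !eqxx mulr1 => ->; rewrite mxE big1 ?mulr0n // => k _.
by rewrite mxE (negPf nij) mul0r.
Qed.

End Adjoint.

Section Inclusions.
Local Open Scope sesquilinear_scope.
Variable K : numClosedFieldType.

Definition mm_single r (n : 'I_r -> nat) p (x : 'M[K]_(n p)) : multimx K n :=
  mm_of (dfwith (fun p' => 0 : 'M[K]_(n p')) x).

Lemma mm_singleE r (n : 'I_r -> nat) p (x : 'M[K]_(n p)) :
  mm_single x p = x.
Proof. by rewrite mm_ofE dfwith_in. Qed.

Lemma mm_single0 r (n : 'I_r -> nat) p (x : 'M[K]_(n p)) p' :
  p != p' -> mm_single x p' = 0.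
Proof. by move=> ne; rewrite mm_ofE dfwith_out. Qed.

Lemma mm_sumE r (n : 'I_r -> nat) I (s : seq I) (P : pred I)
    (F : I -> multimx K n) p :
  (\sum_(i <- s | P i) F i) p = \sum_(i <- s | P i) F i p.
Proof. by apply: (big_morph (fun x : multimx K n => x p)) => [x y|];
  rewrite ?mm_addE ?mm_0E. Qed.

Lemma mm_adjE r (n : 'I_r -> nat) (x : multimx K n) p : mm_adj x p = (x p) ^t*.
Proof. exact: mm_ofE. Qed.

(** The copies of the p-th summand in the q-th are indexed by one type 'I_N, the
    maps V p q t with mu p q <= t being zero. Sums over copies then have an index
    type independent of p and q, and can be interchanged with other sums. *)
Definition intertwiners r s N (mu : 'M[nat]_(r, s)) (n : 'I_r -> nat)
    (m : 'I_s -> nat) (V : forall p q, 'I_N -> 'M[K]_(m q, n p)) : Prop :=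
  [/\ forall p q t t',
        (V p q t) ^t* *m V p q t' = ((t == t') && (t < mu p q)%N)%:R%:M,
      forall p p' q t t', p != p' -> (V p q t) ^t* *m V p' q t' = 0
    & forall q, \sum_p \sum_t V p q t *m (V p q t) ^t* = 1%:M].

Definition mm_ind r s N (n : 'I_r -> nat) (m : 'I_s -> nat)
    (V : forall p q, 'I_N -> 'M[K]_(m q, n p)) (x : multimx K n) : multimx K m :=
  mm_of (fun q => \sum_p \sum_t V p q t *m x p *m (V p q t) ^t*).

Lemma mm_indE r s N (n : 'I_r -> nat) (m : 'I_s -> nat)
    (V : forall p q, 'I_N -> 'M[K]_(m q, n p)) (x : multimx K n) q :
  mm_ind V x q = \sum_p \sum_t V p q t *m x p *m (V p q t) ^t*.
Proof. exact: mm_ofE. Qed.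

Lemma has_multiplicities_ind r s N (mu : 'M[nat]_(r, s)) (n : 'I_r -> nat)
    (m : 'I_s -> nat) (phi : multimx K n -> multimx K m) :
  (forall p q, (mu p q <= N)%N) -> has_multiplicities mu phi ->
  exists2 V : forall p q, 'I_N -> 'M[K]_(m q, n p),
    intertwiners mu V & phi =1 mm_ind V.
Proof.
move=> muN /fin_all_exists [V HV].
pose W p q (t : 'I_N) : 'M[K]_(m q, n p) :=
  oapp (fun u => V q p u) 0 (insub (t : nat)).
have sumW q p (F : 'M[K]_(m q, n p) -> 'M[K]_(m q)) : F 0 = 0 ->
    \sum_(t < N) F (W p q t) = \sum_(t < mu p q) F (V q p t).
  move=> F0; pose G k := F (oapp (fun u => V q p u) 0 (insub k)).
  transitivity (\sum_(t < N) G t); first by [].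
  rewrite -(big_mkord xpredT G) (big_cat_nat _ (muN p q)) //= [X in _ + X]big_nat_cond.
  rewrite [X in _ + X]big1 ?addr0; last first.
    by move=> k /andP[/andP[le_k _] _]; rewrite /G insubN //= -leqNgt.
  by rewrite big_mkord; apply: eq_bigr => t _; rewrite /G valK.
exists W; first split.
- move=> p q t t'; rewrite /W; have [V1 _ _ _] := HV q.
  case: (insubP _ (t : nat)) => [u /= lt_t eu|/= /negPf->]; last first.
    by rewrite andbF scalar0mx adjmx0 mul0mx.
  case: (insubP _ (t' : nat)) => [u' /= lt_t' eu'|/= nlt]; last first.
    rewrite mulmx0; case: eqP => [ett|_]; last by rewrite scalar0mx.
    by rewrite -ett lt_t in nlt.
  by rewrite V1 lt_t andbT -!val_eqE /= eu eu'.
- move=> p p' q t t' ne; rewrite /W; have [_ V2 _ _] := HV q.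
  case: (insub (t : nat)) => [u|] /=; last by rewrite adjmx0 mul0mx.
  by case: (insub (t' : nat)) => [u'|] /=; rewrite ?mulmx0 ?V2.
- move=> q; have [_ _ V3 _] := HV q; rewrite -[RHS]V3; apply: eq_bigr => p _.
  by rewrite (sumW q p (fun A => A *m A ^t*)) // adjmx0 mulmx0.
move=> x; apply/mmP => q; have [_ _ _ ->] := HV q; rewrite mm_indE.
apply: eq_bigr => p _; rewrite (sumW q p (fun A => A *m x p *m A ^t*)) //.
by rewrite adjmx0 mulmx0.
Qed.

Section Induced.
Variables (r s N : nat) (mu : 'M[nat]_(r, s)) (n : 'I_r -> nat) (m : 'I_s -> nat).
Variable V : forall p q, 'I_N -> 'M[K]_(m q, n p).
Hypothesis HV : intertwiners mu V.
Local Notation phi := (mm_ind V).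

Lemma mm_ind_linear : linear phi.
Proof.
move=> a x y; apply/mmP => q; rewrite mm_addE mm_scaleE !mm_indE scaler_sumr -big_split.
apply: eq_bigr => p _; rewrite scaler_sumr -big_split; apply: eq_bigr => t _ /=.
by rewrite mm_addE mm_scaleE mulmxDr mulmxDl -scalemxAr -scalemxAl.
Qed.

Lemma mm_ind_intertwine x p q t : phi x q *m V p q t = V p q t *m x p.
Proof.
have [V1 V2 _] := HV; rewrite mm_indE mulmx_suml (bigD1 p) //= [X in _ + X]big1.
  rewrite addr0 mulmx_suml (bigD1 t) //= [X in _ + X]big1 ?addr0.
    rewrite -mulmxA V1 eqxx /=; case: (boolP (t < mu p q)%N) => [_|lt_t].
      by rewrite mulmx1.
    by rewrite (adjmx_mul_eq0 (A := V p q t)) ?mul0mx // V1 (negPf lt_t) andbF scalar0mx.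
  by move=> t' ne; rewrite -mulmxA V1 (negPf ne) scalar0mx mulmx0.
move=> p' ne; rewrite mulmx_suml big1 // => t' _.
by rewrite -mulmxA V2 ?mulmx0.
Qed.

Lemma mm_ind1 : phi 1 = 1.
Proof.
have [_ _ V3] := HV; apply/mmP => q; rewrite mm_indE mm_1E -[RHS]V3.
by apply: eq_bigr => p _; apply: eq_bigr => t _; rewrite mm_1E mulmx1.
Qed.

Lemma mm_indM : {morph phi : x y / x * y}.
Proof.
move=> x y; apply/mmP => q; rewrite mm_mulE [in RHS](mm_indE V y) mulmx_sumr mm_indE.
apply: eq_bigr => p _; rewrite mulmx_sumr; apply: eq_bigr => t _.
by rewrite !mulmxA mm_ind_intertwine -!mulmxA mm_mulE !mulmxA.
Qed.

Lemma mm_ind_adj : {morph phi : x / mm_adj x}.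
Proof.
move=> x; apply/mmP => q; rewrite mm_adjE !mm_indE adjmx_sum; apply: eq_bigr => p _.
rewrite adjmx_sum; apply: eq_bigr => t _.
by rewrite !adjmxM trmxCK mulmxA mm_adjE.
Qed.

Lemma mm_ind_intertwine_adj x p q t :
  (V p q t) ^t* *m phi x q = x p *m (V p q t) ^t*.
Proof.
rewrite -[LHS]trmxCK adjmxM trmxCK.
have -> : (phi x q) ^t* = phi (mm_adj x) q by rewrite mm_ind_adj mm_adjE.
by rewrite mm_ind_intertwine adjmxM mm_adjE trmxCK.
Qed.

Lemma mm_ind_inj : (forall p, exists q (t : 'I_N), (t < mu p q)%N) -> injective phi.
Proof.
move=> ex x y exy; apply/mmP => p; have [q [t lt_t]] := ex p; have [V1 _ _] := HV.
have VK z : (V p q t) ^t* *m phi z q *m V p q t = z p.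
  by rewrite -mulmxA mm_ind_intertwine mulmxA V1 eqxx lt_t mul1mx.
by rewrite -VK exy VK.
Qed.

Lemma mm_ind_inclusion : (forall p q, (mu p q <= N)%N) ->
  (forall p, exists q, (0 < mu p q)%N) -> inclusion (map_mx Posz mu) phi.
Proof.
move=> muN ex; split.
  split; [exact: mm_ind_linear|exact: mm_ind1|exact: mm_indM|exact: mm_ind_adj|].
  apply: mm_ind_inj => p; have [q lt_0] := ex p.
  by exists q, (Ordinal (leq_trans lt_0 (muN p q))).
exists mu => // q; have [V1 V2 V3] := HV.
have V0 p (t : 'I_N) : ~~ (t < mu p q)%N -> V p q t = 0.
  move=> lt_t; have := V1 p q t t; rewrite (negPf lt_t) andbF scalar0mx.
  exact: adjmx_mul_eq0.
exists (fun p t => V p q (widen_ord (muN p q) t)).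
have sumV p (F : 'M[K]_(m q, n p) -> 'M[K]_(m q)) : F 0 = 0 ->
    \sum_(t < mu p q) F (V p q (widen_ord (muN p q) t)) = \sum_(t < N) F (V p q t).
  move=> F0; pose G k := F (oapp (V p q) 0 (insub k)).
  transitivity (\sum_(t < mu p q) G t).
    apply: eq_bigr => t _; have lt_t := leq_trans (ltn_ord t) (muN p q).
    by rewrite /G (insubT (fun k => (k < N)%N) lt_t) /=; congr (F (V p q _)); apply: val_inj.
  transitivity (\sum_(t < N) G t); last first.
    by apply: eq_bigr => t _; rewrite /G valK.
  rewrite -(big_mkord xpredT G) -(big_mkord xpredT G) (big_cat_nat _ (muN p q)) //=.
  rewrite [X in _ = _ + X]big_nat_cond [X in _ = _ + X]big1
    ?addr0 // => k /andP[/andP[le_k lt_k] _].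
  by rewrite /G insubT /= V0 //= -leqNgt.
split.
- by move=> p t t'; rewrite V1 -val_eqE /= ltn_ord andbT.
- by move=> p p' t t' ne; rewrite V2.
- rewrite -[RHS](V3 q); apply: eq_bigr => p _.
  by rewrite (sumV p (fun A => A *m A ^t*)) // adjmx0 mulmx0.
- move=> x; rewrite mm_indE; apply: eq_bigr => p _.
  by rewrite (sumV p (fun A => A *m x p *m A ^t*)) // adjmx0 mulmx0.
Qed.

End Induced.
End Inclusions.

(** * Traces and conditional expectations *)

Section Traces.
Local Open Scope sesquilinear_scope.
Variable K : numClosedFieldType.

Definition mm_tr r (n : 'I_r -> nat) (w : 'I_r -> K) (x : multimx K n) : K :=
  \sum_p w p * \tr (x p).

Lemma mm_tr_linear r (n : 'I_r -> nat) w : scalar (@mm_tr r n w).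
Proof.
move=> a x y; rewrite /mm_tr mulr_sumr -big_split; apply: eq_bigr => p _ /=.
by rewrite mm_addE mm_scaleE mxtraceD mxtraceZ mulrDr mulrCA.
Qed.

Lemma mm_tr_faithful r (n : 'I_r -> nat) (w : 'I_r -> K) :
  (forall p, 0 < w p) -> faithful_trace (@mm_tr r n w).
Proof.
move=> w_gt0.
have ge0 x p : 0 <= w p * \tr ((mm_adj x * x : multimx K n) p).
  rewrite mulr_ge0 ?(ltW (w_gt0 p)) // mm_mulE mm_adjE sumr_ge0 // => i _.
  exact: adjmx_mul_ge0.
split=> [|x y|x|x]; first exact: mm_tr_linear.
- by apply: eq_bigr => p _; rewrite !mm_mulE mxtrace_mulC.
- by apply: sumr_ge0 => p _.
move=> /eqP; rewrite psumr_eq0 // => /allP x0; apply/mmP => p; rewrite mm_0E.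
apply: adjmx_mul_eq0; have := x0 p; rewrite mem_index_enum => /(_ isT) /=.
rewrite mulf_eq0 gt_eqF //= mm_mulE mm_adjE => /eqP tr0.
have d0 j : ((x p) ^t* *m x p) j j = 0.
  have : \sum_j ((x p) ^t* *m x p) j j == 0 by apply/eqP.
  rewrite psumr_eq0 => [|i _]; last exact: adjmx_mul_ge0.
  by move/allP/(_ j); rewrite mem_index_enum => /(_ isT) /eqP.
suff -> : x p = 0 by rewrite mulmx0.
apply/matrixP => i j; have := d0 j; rewrite !mxE => /eqP.
rewrite psumr_eq0 => [|k _]; last by rewrite !mxE mulrC mul_conjC_ge0.
move/allP/(_ i); rewrite mem_index_enum => /(_ isT) /=.
by rewrite !mxE mulf_eq0 conjC_eq0 orbb => /eqP.
Qed.

Lemma mm_decomp r (n : 'I_r -> nat) (x : multimx K n) :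
  x = \sum_p \sum_i \sum_j x p i j *: mm_single (delta_mx i j : 'M[K]_(n p)).
Proof.
apply/mmP => q; rewrite mm_sumE (bigD1 q) //= [X in _ + X]big1 ?addr0.
  rewrite mm_sumE; apply/matrixP => a b; rewrite summxE (bigD1 a) //= [X in _ + X]big1.
    rewrite addr0 mm_sumE summxE (bigD1 b) //= [X in _ + X]big1.
      by rewrite addr0 mm_scaleE mm_singleE !mxE !eqxx mulr1.
    by move=> j nj; rewrite mm_scaleE mm_singleE !mxE (eq_sym b) (negPf nj) andbF mulr0.
  move=> i ni; rewrite mm_sumE summxE big1 // => j _.
  by rewrite mm_scaleE mm_singleE !mxE (eq_sym a) (negPf ni) mulr0.
move=> p np; rewrite mm_sumE big1 // => i _; rewrite mm_sumE big1 // => j _.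
by rewrite mm_scaleE mm_single0 ?scaler0.
Qed.

Lemma mm_singleM r (n : 'I_r -> nat) p (x y : 'M[K]_(n p)) :
  mm_single x * mm_single y = mm_single (x *m y).
Proof.
apply/mmP => q; rewrite mm_mulE.
case: (eqVneq p q) => [<-|ne]; first by rewrite !mm_singleE.
by rewrite !(mm_single0 _ ne) mulmx0.
Qed.

(** A trace vanishes on the off-diagonal matrix units and is constant on the
    diagonal ones of each summand, because E_ij = E_ik E_kj; faithfulness makes the
    constant positive. The trace is not normalised, so the weights are arbitrary. *)
Lemma faithful_trace_weights r (n : 'I_r -> nat) (tau : multimx K n -> K) :
  (forall p, 0 < n p)%N -> faithful_trace tau ->
  exists2 w : 'I_r -> K, forall p, 0 < w p & tau =1 mm_tr w.
Proof.
move=> n_gt0 [lin trC ge0 faith]; pose o p := Ordinal (n_gt0 p).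
pose E p i j : multimx K n := mm_single (delta_mx i j : 'M[K]_(n p)).
have tau0 : tau 0 = 0.
  by have := lin (-1) 0 0; rewrite scaler0 addr0 mulN1r addNr.
have tauD x y : tau (x + y) = tau x + tau y.
  by have := lin 1 x y; rewrite scale1r mul1r.
have tauZ a x : tau (a *: x) = a * tau x.
  by have := lin a x 0; rewrite addr0 tau0 addr0.
have tau_sum I (s : seq I) (F : I -> multimx K n) :
    tau (\sum_(i <- s) F i) = \sum_(i <- s) tau (F i).
  by apply: (big_morph tau) => //; apply: tauD.
have EM p i j k : E p i j * E p j k = E p i k.
  by rewrite /E mm_singleM mul_delta_mx.
have tauE p i j : tau (E p i j) = (i == j)%:R * tau (E p (o p) (o p)).
  rewrite -(EM p i (o p) j) trC.
  case: eqP => [<-|/eqP ne]; first by rewrite EM mul1r.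
  rewrite /E mm_singleM mul_delta_mx_0 1?eq_sym // mul0r -[RHS]tau0; congr tau.
  apply/mmP => q; rewrite mm_0E; case: (eqVneq p q) => [<-|npq].
    by rewrite mm_singleE.
  by rewrite mm_single0.
exists (fun p => tau (E p (o p) (o p))) => [p|x].
  have adjE : mm_adj (E p (o p) (o p)) = E p (o p) (o p).
    apply/mmP => q; rewrite mm_adjE /E; case: (eqVneq p q) => [<-|npq].
      rewrite !mm_singleE; apply/matrixP => i j; rewrite !mxE andbC.
      by rewrite conjC_nat.
    by rewrite !mm_single0 ?adjmx0.
  have := ge0 (E p (o p) (o p)); rewrite adjE EM => t_ge0.
  rewrite lt0r t_ge0 andbT; apply/eqP => t0.
  have E0 : E p (o p) (o p) = 0 by apply: faith; rewrite adjE EM.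
  have := E0; move/(congr1 (fun x : multimx K n => x p (o p) (o p))).
  by rewrite /E mm_singleE mm_0E !mxE !eqxx => /eqP; rewrite oner_eq0.
rewrite {1}(mm_decomp x) tau_sum; apply: eq_bigr => p _; rewrite tau_sum.
rewrite /mxtrace mulr_sumr; apply: eq_bigr => i _; rewrite tau_sum (bigD1 i) //=.
rewrite [X in _ + X]big1 ?addr0 => [|j nj]; first by rewrite tauZ -/(E p i i) tauE eqxx mul1r mulrC.
by rewrite tauZ -/(E p i j) tauE (eq_sym i) (negPf nj) mul0r mulr0.
Qed.

(** Weights of the restriction of a trace to a subalgebra with inclusion matrix mu. *)
Definition weight_pull r s (mu : 'M[nat]_(r, s)) (w : 'I_s -> K) (p : 'I_r) : K :=
  \sum_q (mu p q)%:R * w q.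

Lemma sum_ltn_nat N k : (k <= N)%N -> \sum_(t < N) (t < k)%N%:R = k%:R :> K.
Proof.
move=> kN; rewrite (eq_bigr (fun t : 'I_N => if (t < k)%N then 1 else 0)); last first.
  by move=> t _; case: (t < k)%N.
by rewrite -big_mkcond -(big_ord_widen N (fun=> 1)) // sumr_const card_ord.
Qed.

Section Expectation.
Variables (r s N : nat) (mu : 'M[nat]_(r, s)) (n : 'I_r -> nat) (m : 'I_s -> nat).
Variable V : forall p q, 'I_N -> 'M[K]_(m q, n p).
Hypotheses (HV : intertwiners mu V) (muN : forall p q, (mu p q <= N)%N).
Local Notation phi := (mm_ind V).

Lemma mm_tr_ind w x : mm_tr w (phi x) = mm_tr (weight_pull mu w) x.
Proof.
have [V1 _ _] := HV; rewrite /mm_tr.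
transitivity (\sum_q \sum_p \sum_(t < N) w q * ((t < mu p q)%N%:R * \tr (x p))).
  apply: eq_bigr => q _; rewrite mm_indE raddf_sum mulr_sumr; apply: eq_bigr => p _.
  rewrite /= raddf_sum mulr_sumr; apply: eq_bigr => t _.
  by rewrite /= mxtrace_mulC mulmxA V1 eqxx /= mul_scalar_mx mxtraceZ.
rewrite exchange_big; apply: eq_bigr => p _; rewrite /weight_pull mulr_suml.
by apply: eq_bigr => q _; rewrite -mulr_sumr -mulr_suml sum_ltn_nat // mulrA (mulrC (w q)).
Qed.

Variable w : 'I_s -> K.
Hypotheses (w_gt0 : forall q, 0 < w q) (w'_gt0 : forall p, 0 < weight_pull mu w p).
Local Notation w' := (weight_pull mu w).

(** The trace-preserving conditional expectation: compress to every copy of the p-th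
    summand and average with the relative weights of the copies. *)
Definition mm_exp (y : multimx K m) : multimx K n :=
  mm_of (fun p => \sum_q \sum_t (w q / w' p) *: ((V p q t) ^t* *m y q *m V p q t)).

Lemma mm_expE y p :
  mm_exp y p = \sum_q \sum_t (w q / w' p) *: ((V p q t) ^t* *m y q *m V p q t).
Proof. exact: mm_ofE. Qed.

Lemma mm_exp_linear : linear mm_exp.
Proof.
move=> a x y; apply/mmP => p; rewrite mm_addE mm_scaleE !mm_expE scaler_sumr -big_split.
apply: eq_bigr => q _; rewrite scaler_sumr -big_split; apply: eq_bigr => t _ /=.
rewrite mm_addE mm_scaleE mulmxDr mulmxDl -scalemxAr -scalemxAl scalerDr.
by rewrite !scalerA mulrC.
Qed.

Lemma mm_exp_ind x : mm_exp (phi x) = x.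
Proof.
have [V1 _ _] := HV; apply/mmP => p; rewrite mm_expE.
have S : \sum_q \sum_(t < N) (w q / w' p) * (t < mu p q)%N%:R = 1.
  under eq_bigr => q _ do rewrite -mulr_sumr sum_ltn_nat //.
  rewrite -[RHS](mulfV (lt0r_neq0 (w'_gt0 p))) {2}/weight_pull mulr_suml.
  by apply: eq_bigr => q _; ring.
rewrite -[RHS]scale1r -S scaler_suml; apply: eq_bigr => q _.
rewrite scaler_suml; apply: eq_bigr => t _.
by rewrite -mulmxA (mm_ind_intertwine HV) mulmxA V1 eqxx /= mul_scalar_mx scalerA.
Qed.

Lemma mm_exp_bimod x y z : mm_exp (phi x * y * phi z) = x * mm_exp y * z.
Proof.
apply/mmP => p; rewrite !mm_mulE !mm_expE mulmx_sumr mulmx_suml; apply: eq_bigr => q _.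
rewrite mulmx_sumr mulmx_suml; apply: eq_bigr => t _.
rewrite -scalemxAr -scalemxAl; congr (_ *: _).
rewrite !mm_mulE !mulmxA (mm_ind_intertwine_adj HV) -!mulmxA.
by rewrite (mm_ind_intertwine HV).
Qed.

Lemma mm_exp_pos y : mm_pos y -> mm_pos (mm_exp y).
Proof.
move=> ypos p v; rewrite mm_expE dotcE mulmx_suml mulmx_sumr summxE sumr_ge0 // => q _.
rewrite mulmx_suml mulmx_sumr summxE sumr_ge0 // => t _.
rewrite -scalemxAl -scalemxAr mxE mulr_ge0 //; first by rewrite divr_ge0 // ltW.
by have := ypos q (V p q t *m v); rewrite dotcE adjmxM !mulmxA.
Qed.

Lemma mm_ind_pos x : mm_pos x -> mm_pos (phi x).
Proof.
move=> xpos q v; rewrite mm_indE dotcE mulmx_suml mulmx_sumr summxE sumr_ge0 // => p _.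
rewrite mulmx_suml mulmx_sumr summxE sumr_ge0 // => t _.
by have := xpos p ((V p q t) ^t* *m v); rewrite dotcE adjmxM trmxCK !mulmxA.
Qed.

Lemma mm_tr_exp y : mm_tr w' (mm_exp y) = mm_tr w y.
Proof.
have [_ _ V3] := HV.
rewrite /mm_tr.
transitivity (\sum_p \sum_q \sum_t w q * \tr (V p q t *m (V p q t) ^t* *m y q)).
  apply: eq_bigr => p _; rewrite mm_expE raddf_sum mulr_sumr; apply: eq_bigr => q _.
  rewrite /= raddf_sum mulr_sumr; apply: eq_bigr => t _.
  rewrite /= mxtraceZ mulrA mulrCA mulfV ?lt0r_neq0 // mulr1.
  by rewrite mxtrace_mulC !mulmxA.
rewrite exchange_big; apply: eq_bigr => q _.
under eq_bigr => p _ do rewrite -mulr_sumr.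
rewrite -mulr_sumr; congr (_ * _).
under eq_bigr => p _ do rewrite -raddf_sum -mulmx_suml.
by rewrite -raddf_sum -mulmx_suml V3 mul1mx.
Qed.

End Expectation.
End Traces.

Section CondExp.
Variable K : numClosedFieldType.

(** A left inverse of an embedding phi such that phi \o E is a conditional
    expectation. Unlike the composites phi \o E, such maps E compose along a tower
    of inclusions. *)
Record expectation r s (n : 'I_r -> nat) (m : 'I_s -> nat)
    (tX : multimx K n -> K) (tY : multimx K m -> K)
    (phi : multimx K n -> multimx K m) (E : multimx K m -> multimx K n) : Prop :=
  Expectation {
    exp_lin : linear phi /\ linear E;
    exp_mul : {morph phi : x y / x * y};
    exp_can : cancel phi E;
    exp_bimod : forall x y z, E (phi x * y * phi z) = x * E y * z;
    exp_pos : (forall x, mm_pos x -> mm_pos (phi x)) /\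
              (forall y, mm_pos y -> mm_pos (E y));
    exp_tr : forall y, tX (E y) = tY y }.

Lemma linear_compose (U V W : lmodType K) (f : U -> V) (g : V -> W) :
  linear f -> linear g -> linear (g \o f).
Proof. by move=> lf lg a x y; rewrite /= lf lg. Qed.

Lemma expectation_comp r s u (n : 'I_r -> nat) (m : 'I_s -> nat) (l : 'I_u -> nat)
    tX tY tZ (f : multimx K n -> multimx K m) (g : multimx K m -> multimx K l) E F :
  expectation tX tY f E -> expectation tY tZ g F ->
  expectation tX tZ (g \o f) (E \o F).
Proof.
move=> [[lf lE] fM fK fB [fp Ep] ft] [[lg lF] gM gK gB [gp Fp] gt]; split => /=.
- by split; apply: linear_compose.
- by move=> x y /=; rewrite fM gM.
- by move=> x /=; rewrite gK fK.
- by move=> x y z; rewrite gB fB.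
- by split=> x xp; [apply/gp/fp|apply/Ep/Fp].
- by move=> y; rewrite ft gt.
Qed.

Lemma expectation_cond_exp r s (n : 'I_r -> nat) (m : 'I_s -> nat) tX tY
    (f : multimx K n -> multimx K m) E :
  expectation tX tY f E -> cond_exp tY (in_range f) (f \o E).
Proof.
move=> [[lf lE] fM fK fB [fp Ep] ft]; split=> /=.
- exact: linear_compose.
- by move=> x; exists (E x).
- by move=> _ [x <-]; rewrite fK.
- by move=> _ y _ [x <-] [z <-]; rewrite fB !fM.
- by split=> [x xp|x]; [apply/fp/Ep|rewrite -!ft fK].
Qed.

Lemma mm_expectation r s N (mu : 'M[nat]_(r, s)) (n : 'I_r -> nat)
    (m : 'I_s -> nat) (V : forall p q, 'I_N -> 'M[K]_(m q, n p)) (w : 'I_s -> K) :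
  intertwiners mu V -> (forall p q, (mu p q <= N)%N) ->
  (forall q, 0 < w q) -> (forall p, 0 < weight_pull mu w p) ->
  expectation (mm_tr (weight_pull mu w)) (mm_tr w) (mm_ind V) (mm_exp mu V w).
Proof.
move=> HV muN w0 w0'; split.
- by split; [apply: mm_ind_linear|apply: mm_exp_linear].
- exact: mm_indM HV.
- exact: mm_exp_ind.
- exact: mm_exp_bimod.
- by split=> ? ?; [apply: mm_ind_pos|apply: mm_exp_pos].
- exact: mm_tr_exp.
Qed.

Section SelfAdjoint.
Variables (s : nat) (m : 'I_s -> nat) (tau : multimx K m -> K).
Hypothesis Htau : faithful_trace tau.

(** Both sides are the trace of E x * E y. *)
Lemma cond_exp_selfadj S E x y : cond_exp tau S E -> S 1 ->
  tau (E x * y) = tau (x * E y).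
Proof.
move=> [lin ES id bim [_ tr]] S1.
have bl a b : S a -> E (a * b) = a * E b.
  by move=> Sa; have := bim a b 1 Sa S1; rewrite !mulr1.
have br a b : S b -> E (a * b) = E a * b.
  by move=> Sb; have := bim 1 a b S1 Sb; rewrite !mul1r.
by rewrite -tr bl // -[RHS]tr br.
Qed.

Lemma faithful_trace_eq x y : (forall z, tau (x * z) = tau (y * z)) -> x = y.
Proof.
have [lin trC _ faith] := Htau; move=> e; apply/eqP; rewrite -subr_eq0; apply/eqP.
have tauB a b : tau (a - b) = tau a - tau b.
  by rewrite addrC -scaleN1r lin mulN1r addrC.
by apply: faith; rewrite trC mulrBl tauB e subrr.
Qed.

(** One factorisation of E_A suffices: conditional expectations are self-adjoint for
    the trace form, so the factorisation in the other order is the adjoint one. *)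
Lemma commuting_of_comp SA SB SC EA EB EC : 
  cond_exp tau SA EA -> cond_exp tau SB EB -> cond_exp tau SC EC ->
  SA 1 -> SB 1 -> SC 1 -> EA =1 EB \o EC -> commuting_square tau SA SB SC.
Proof.
move=> hA hB hC A1 B1 C1 eBC; exists EA, EB, EC; split=> // x /=.
apply: faithful_trace_eq => z.
by rewrite (cond_exp_selfadj _ _ hA) // eBC /= -(cond_exp_selfadj _ _ hB) //
  -(cond_exp_selfadj _ _ hC).
Qed.

End SelfAdjoint.
End CondExp.

(** * Paths, connections and the square of a connection *)

Section Existence.
Local Open Scope sesquilinear_scope.
Variable K : numClosedFieldType.

(** The q-th summand acts on a space with one basis vector for each triple (p, t, x),
    where t is a copy of the p-th summand in it and x a basis vector of that
    summand. *)
Lemma intertwiners_exist r s N (mu : 'M[nat]_(r, s)) (n : 'I_r -> nat) :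
  exists (m : 'I_s -> nat) (V : forall p q, 'I_N -> 'M[K]_(m q, n p)),
    intertwiners mu V /\
    forall q p (t : 'I_N), (t < mu p q)%N -> (0 < n p)%N -> (0 < m q)%N.
Proof.
pose T := {i : 'I_r * 'I_N & 'I_(n i.1)}.
pose tg p t (x : 'I_(n p)) : T := Tagged (fun i : 'I_r * 'I_N => 'I_(n i.1)) (i := (p, t)) x.
pose P q : {set T} := [set z : T | ((tag z).2 < mu (tag z).1 q)%N].
pose V p q t : 'M[K]_(#|P q|, n p) := \matrix_(y, x) (enum_val y == tg p t x)%:R.
have VV p p' q t t' x x' : ((V p q t) ^t* *m V p' q t') x x' =
    ((tg p t x == tg p' t' x') && (t < mu p q)%N)%:R.
  rewrite mxE; under eq_bigr => y _ do rewrite !mxE conjC_nat -natrM mulnb.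
  rewrite -(big_enum_val (A := mem (P q))
    (fun z => ((z == tg p t x) && (z == tg p' t' x'))%:R : K)) /=.
  case: (boolP (t < mu p q)%N) => lt_t; last first.
    rewrite andbF big1 // => z; rewrite inE; case: (z =P tg p t x) => //= -> /=.
    by rewrite (negPf lt_t).
  rewrite andbT (bigD1 (tg p t x)) /=; last by rewrite inE.
  rewrite eqxx big1 ?addr0 // => z /andP[_ /negPf->] //.
exists (fun q => #|P q|), V; split; first split.
- move=> p q t t'; apply/matrixP => x x'; rewrite VV !mxE -mulrnA.
  congr (_%:R); rewrite mulnb; case: (eqVneq t t') => [<-|ne] /=.
    rewrite andbC; congr (_ && _); apply/eqP/eqP => [|->] // e.
    by have /eqP := e; rewrite -tag_eqE /tag_eq eqxx tagged_asE => /eqP.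
  case: (tg p t x =P tg p t' x') => [e|_] //; have := congr1 tag e => -[] e'.
  by rewrite e' eqxx in ne.
- move=> p p' q t t' ne; apply/matrixP => x x'; rewrite VV mxE.
  case: (tg p t x =P tg p' t' x') => [e|_] //; have := congr1 tag e => -[] e'.
  by rewrite e' eqxx in ne.
- move=> q; apply/matrixP => y y'; rewrite pair_big summxE mxE /=.
  under eq_bigr => i _ do rewrite mxE.
  rewrite (sig_big_dep _ (fun i => xpredT)
    (fun i (x : 'I_(n i.1)) => V i.1 q i.2 y x * ((V i.1 q i.2) ^t*) x y')) /=.
  transitivity (\sum_(z : T) ((enum_val y == z) && (enum_val y' == z))%:R : K).
    apply: eq_bigr => -[[p t] x] _; rewrite !mxE conjC_nat -natrM mulnb //.
  rewrite (bigD1 (enum_val y)) //= eqxx big1 ?addr0 => [|z].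
    by rewrite (inj_eq enum_val_inj) eq_sym.
  by rewrite eq_sym => /negPf->.
move=> q p t lt_t n_gt0; apply/card_gt0P.
by exists (tg p t (Ordinal n_gt0)); rewrite inE.
Qed.

End Existence.

Section Paths.
Local Open Scope sesquilinear_scope.
Variable K : numClosedFieldType.
Variables (ra rb rd N : nat) (mu : 'M[nat]_(ra, rb)) (nu : 'M[nat]_(rb, rd)).
Variables (a : 'I_ra -> nat) (b : 'I_rb -> nat) (d : 'I_rd -> nat).
Variable V : forall p q, 'I_N -> 'M[K]_(b q, a p).
Variable V' : forall q s, 'I_1 -> 'M[K]_(d s, b q).
Hypotheses (HV : intertwiners mu V) (HV' : intertwiners nu V').

(** The copy of the p-th summand reached along the path p - q - s; only the first
    edge carries a multiplicity. *)
Definition mpath p q s t : 'M[K]_(d s, a p) := V' q s 0 *m V p q t.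

Lemma mpath_orth p q q' s t t' :
  (mpath p q s t) ^t* *m mpath p q' s t' =
  [&& q == q', t == t', (t < mu p q)%N & (0 < nu q s)%N]%:R%:M.
Proof.
have [V1 _ _] := HV; have [V1' V2' _] := HV'.
rewrite /mpath adjmxM mulmxA -[_ *m _ *m V' _ _ _]mulmxA.
case: (eqVneq q q') => [<-|ne]; last by rewrite V2' // mulmx0 mul0mx scalar0mx.
rewrite V1' eqxx /=; case: (0 < nu q s)%N; last first.
  by rewrite !andbF !scalar0mx mulmx0 mul0mx.
by rewrite mulmx1 V1 andbT.
Qed.

Lemma mpath_orth0 p p' q q' s t t' : p != p' ->
  (mpath p q s t) ^t* *m mpath p' q' s t' = 0.
Proof.
have [_ V2 _] := HV; have [V1' V2' _] := HV'; move=> np.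
rewrite /mpath adjmxM mulmxA -[_ *m _ *m V' _ _ _]mulmxA.
case: (eqVneq q q') => [<-|ne]; last by rewrite V2' // mulmx0 mul0mx.
by rewrite V1' mul_mx_scalar -scalemxAl V2 ?scaler0.
Qed.

Lemma mpath_full s : \sum_p \sum_q \sum_t mpath p q s t *m (mpath p q s t) ^t* = 1%:M.
Proof.
have [_ _ V3] := HV; have [_ _ V3'] := HV'.
rewrite exchange_big /= -[RHS]V3'; apply: eq_bigr => q _.
rewrite big_ord1 -[X in _ = X *m _]mulmx1 -(V3 q) mulmx_sumr mulmx_suml.
apply: eq_bigr => p _; rewrite mulmx_sumr mulmx_suml; apply: eq_bigr => t _.
by rewrite /mpath adjmxM !mulmxA.
Qed.

Lemma mpath_intertwine x p q s t :
  mm_ind V' (mm_ind V x) s *m mpath p q s t = mpath p q s t *m x p.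
Proof.
by rewrite /mpath mulmxA (mm_ind_intertwine HV') -!mulmxA (mm_ind_intertwine HV).
Qed.

Lemma mpath_intertwine_adj x p q s t :
  (mpath p q s t) ^t* *m mm_ind V' (mm_ind V x) s = x p *m (mpath p q s t) ^t*.
Proof.
rewrite /mpath adjmxM -!mulmxA (mm_ind_intertwine_adj HV') !mulmxA.
by rewrite (mm_ind_intertwine_adj HV).
Qed.

Lemma mpath_ind x s : mm_ind V' (mm_ind V x) s =
  \sum_p \sum_q \sum_t mpath p q s t *m x p *m (mpath p q s t) ^t*.
Proof.
rewrite -[LHS]mulmx1 -mpath_full mulmx_sumr; apply: eq_bigr => p _.
rewrite mulmx_sumr; apply: eq_bigr => q _; rewrite mulmx_sumr; apply: eq_bigr => t _.
by rewrite mulmxA mpath_intertwine.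
Qed.

End Paths.

(** A bi-unitary connection on the cells p - q - s - r - p formed by the edges of the
    four inclusion graphs; t numbers the edges joining p to r. For fixed p and s the
    entries form a multiple of a unitary matrix with rows q and columns (r, t)
    ([conn_col], [conn_row]). Regrouped for fixed q and r, the same entries form a
    matrix with orthogonal rows (p, t) ([conn_dual]). It is usual to take the first
    matrices unitary, with entries u, and to put quotients of trace weights into the
    second condition; the scaling z = sqrt (wa p * wd s) * u used here makes the two
    conditions symmetric. *)
Record connection (K : numClosedFieldType) ra rb rc rd N
    (g : 'M[nat]_(ra, rb)) (k : 'M[nat]_(ra, rc))
    (h : 'M[nat]_(rb, rd)) (g' : 'M[nat]_(rc, rd))
    (wa : 'I_ra -> K) (wb : 'I_rb -> K) (wc : 'I_rc -> K) (wd : 'I_rd -> K)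
    (z : 'I_ra -> 'I_rb -> 'I_rc -> 'I_rd -> 'I_N -> K) : Prop := Connection {
  conn_supp : forall p q r s (t : 'I_N),
    ~~ [&& 0 < g p q, t < k p r, 0 < h q s & 0 < g' r s]%N -> z p q r s t = 0;
  conn_col : forall p s r (t : 'I_N) r' t',
    \sum_q z p q r s t * (z p q r' s t')^* =
    [&& r == r', t == t', (t < k p r)%N & (0 < g' r s)%N]%:R * (wa p * wd s);
  conn_row : forall p s q q',
    \sum_r \sum_t z p q r s t * (z p q' r s t)^* =
    [&& q == q', (0 < g p q)%N & (0 < h q s)%N]%:R * (wa p * wd s);
  conn_dual : forall q r p (t : 'I_N) p' t',
    \sum_s z p q r s t * (z p' q r s t')^* =
    [&& p == p', t == t', (0 < g p q)%N & (t < k p r)%N]%:R * (wb q * wc r) }.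

Section ToSquare.
Local Open Scope sesquilinear_scope.
Variable K : numClosedFieldType.
Variables (ra rb rc rd N : nat).
Variables (g : 'M[nat]_(ra, rb)) (k : 'M[nat]_(ra, rc)).
Variables (h : 'M[nat]_(rb, rd)) (g' : 'M[nat]_(rc, rd)).
Variable wd : 'I_rd -> K.
Hypothesis wd_gt0 : forall s, 0 < wd s.
Let wb := weight_pull h wd.
Let wc := weight_pull g' wd.
Let wa := weight_pull g wb.
Hypothesis wac : forall p, weight_pull k wc p = wa p.
Variable z : 'I_ra -> 'I_rb -> 'I_rc -> 'I_rd -> 'I_N -> K.
Hypothesis Hz : connection g k h g' wa wb wc wd z.
Hypothesis gA : forall p, exists q, (0 < g p q)%N.
Hypothesis hB : forall q, exists s, (0 < h q s)%N.

Lemma weight_pull_gt0 r s (mu : 'M[nat]_(r, s)) (w : 'I_s -> K) p :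
  (forall q, 0 < w q) -> (exists q, (0 < mu p q)%N) -> 0 < weight_pull mu w p.
Proof.
move=> w0 [q mu0]; rewrite /weight_pull (bigD1 q) //= ltr_wpDr //.
  by rewrite sumr_ge0 // => j _; rewrite mulr_ge0 // ltW.
by rewrite mulr_gt0 // ltr0n.
Qed.

Let wb_gt0 q : 0 < wb q. Proof. exact: weight_pull_gt0. Qed.
Let wa_gt0 p : 0 < wa p. Proof. exact: weight_pull_gt0. Qed.

Let u p q r s t : K := z p q r s t / (sqrtC (wa p) * sqrtC (wd s)).

Lemma conj_sqrtC (x : K) : 0 <= x -> (sqrtC x)^* = sqrtC x.
Proof. by move=> x0; apply: geC0_conj; rewrite sqrtC_ge0. Qed.

Lemma sqrtC_neq0 (x : K) : 0 < x -> sqrtC x != 0.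
Proof. by move=> x0; rewrite sqrtC_eq0 gt_eqF. Qed.

Let uu p q r s t p' q' r' t' : u p q r s t * (u p' q' r' s t')^* =
  z p q r s t * (z p' q' r' s t')^* / (sqrtC (wa p) * sqrtC (wa p') * wd s).
Proof.
rewrite /u rmorphM fmorphV rmorphM /= !conj_sqrtC ?ltW //.
rewrite -{3}(sqrtCK (wd s)).
by field; rewrite !sqrtC_neq0.
Qed.

Let u_supp p q r s (t : 'I_N) :
  ~~ [&& 0 < g p q, t < k p r, 0 < h q s & 0 < g' r s]%N -> u p q r s t = 0.
Proof. by move=> /(conn_supp Hz) e; rewrite /u e mul0r. Qed.

Let u_col p s r (t : 'I_N) r' t' : \sum_q u p q r s t * (u p q r' s t')^* =
  [&& r == r', t == t', (t < k p r)%N & (0 < g' r s)%N]%:R.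
Proof.
under eq_bigr => q _ do rewrite uu; rewrite -mulr_suml (conn_col Hz) -expr2 sqrtCK.
by rewrite mulfK // mulf_neq0 ?gt_eqF.
Qed.

Let u_row p s q q' : \sum_r \sum_t u p q r s t * (u p q' r s t)^* =
  [&& q == q', (0 < g p q)%N & (0 < h q s)%N]%:R.
Proof.
under eq_bigr => r _ do [under eq_bigr => t _ do rewrite uu; rewrite -mulr_suml].
by rewrite -mulr_suml (conn_row Hz) -expr2 sqrtCK mulfK // mulf_neq0 ?gt_eqF.
Qed.

Let u_dual q r p (t : 'I_N) p' t' : \sum_s (wd s / wb q) * (u p q r s t * (u p' q r s t')^*) =
  [&& p == p', t == t', (0 < g p q)%N & (t < k p r)%N]%:R * (wc r / wa p).
Proof.
have E s : (wd s / wb q) * (u p q r s t * (u p' q r s t')^*) =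
    z p q r s t * (z p' q r s t')^* / (wb q * sqrtC (wa p) * sqrtC (wa p')).
  by rewrite uu; field; rewrite !sqrtC_neq0 // !gt_eqF.
under eq_bigr => s _ do rewrite E; rewrite -mulr_suml (conn_dual Hz).
case: eqP => [<-|] /=; last by rewrite !mul0r.
rewrite -mulrA -[in RHS](sqrtCK (wa p)).
case: (_ && _); rewrite ?mul0r // !mul1r.
by field; rewrite !sqrtC_neq0 // !gt_eqF.
Qed.

Variables (a : 'I_ra -> nat) (b : 'I_rb -> nat) (c : 'I_rc -> nat) (d : 'I_rd -> nat).
Variable VAB : forall p q, 'I_1 -> 'M[K]_(b q, a p).
Variable VAC : forall p r, 'I_N -> 'M[K]_(c r, a p).
Variable VBD : forall q s, 'I_1 -> 'M[K]_(d s, b q).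
Hypotheses (HAB : intertwiners g VAB) (HAC : intertwiners k VAC).
Hypothesis HBD : intertwiners h VBD.

Let W p q s := mpath VAB VBD p q s 0.
Let W' p r s t : 'M[K]_(d s, a p) := \sum_q u p q r s t *: W p q s.

(** Multiplying the system of paths A - B - D by the unitary u gives the system of
    paths A - C - D, and these determine how C sits in D. *)
Definition VCD r s (_ : 'I_1) : 'M[K]_(d s, c r) :=
  \sum_p \sum_t W' p r s t *m (VAC p r t) ^t*.

Let W_orth p q q' s :
  (W p q s) ^t* *m W p q' s = [&& q == q', (0 < g p q)%N & (0 < h q s)%N]%:R%:M.
Proof. by rewrite (mpath_orth HAB HBD). Qed.

Let W'_orth p r r' s t t' : (W' p r s t) ^t* *m W' p r' s t' =
  [&& r == r', t == t', (t < k p r)%N & (0 < g' r s)%N]%:R%:M.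
Proof.
rewrite /W' adjmx_sum mulmx_suml.
transitivity (\sum_q ((u p q r s t)^* * u p q r' s t')%:M : 'M[K]_(a p)).
  apply: eq_bigr => q _; rewrite mulmx_sumr (bigD1 q) //= [X in _ + X]big1 ?addr0.
    rewrite adjmxZ -scalemxAl -scalemxAr W_orth eqxx /= scalerA.
    rewrite scale_scalar_mx; congr (_%:M).
    case: (boolP ((0 < g p q)%N && _)) => [_|nv]; first by rewrite mulr1.
    rewrite mulr0 (@u_supp p q r' s t') ?mulr0 //.
    by apply: contra nv => /and4P[-> _ -> _].
  by move=> q' ne; rewrite adjmxZ -scalemxAl -scalemxAr W_orth eq_sym (negPf ne)
    scalar0mx !scaler0.
rewrite -(raddf_sum (@scalar_mx K (a p))); congr (_%:M).
rewrite -[RHS]conjC_nat -(u_col p s r t r' t') rmorph_sum; apply: eq_bigr => q _.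
by rewrite [RHS]rmorphM /= conjCK.
Qed.

Let W'_orth0 p p' r r' s t t' : p != p' -> (W' p r s t) ^t* *m W' p' r' s t' = 0.
Proof.
move=> ne; rewrite /W' adjmx_sum mulmx_suml big1 // => q _; rewrite mulmx_sumr big1 // => q' _.
by rewrite adjmxZ -scalemxAl -scalemxAr /W (mpath_orth0 HAB HBD) ?scaler0.
Qed.

Let W'_sum p s (x : 'M[K]_(a p)) :
  \sum_r \sum_t W' p r s t *m x *m (W' p r s t) ^t* =
  \sum_q W p q s *m x *m (W p q s) ^t*.
Proof.
have E r t : W' p r s t *m x *m (W' p r s t) ^t* = \sum_q \sum_q'
    (u p q r s t * (u p q' r s t)^*) *: (W p q s *m x *m (W p q' s) ^t*).
  rewrite /W' adjmx_sum !mulmx_suml; apply: eq_bigr => q _; rewrite mulmx_sumr.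
  by apply: eq_bigr => q' _; rewrite adjmxZ -!scalemxAl -scalemxAr scalerA.
under eq_bigr => r _ do under eq_bigr => t _ do rewrite E.
transitivity (\sum_q \sum_q' (\sum_r \sum_t u p q r s t * (u p q' r s t)^*) *:
    (W p q s *m x *m (W p q' s) ^t*)).
  under eq_bigr => r _.
    rewrite exchange_big /=.
    under eq_bigr => q _ do rewrite exchange_big /=.
    over.
  rewrite exchange_big; apply: eq_bigr => q _; rewrite exchange_big /=.
  apply: eq_bigr => q' _; rewrite scaler_suml; apply: eq_bigr => r _.
  by rewrite scaler_suml.
apply: eq_bigr => q _; rewrite (bigD1 q) //= [X in _ + X]big1 ?addr0.
  rewrite u_row eqxx /=; case: (boolP (_ && _)) => val; first by rewrite scale1r.
  suff -> : W p q s = 0 by rewrite !mul0mx scaler0.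
  by apply: adjmx_mul_eq0; rewrite W_orth eqxx /= (negPf val) scalar0mx.
by move=> q' ne; rewrite u_row eq_sym (negPf ne) scale0r.
Qed.

Lemma VCD_path p r s t t0 : VCD r s t0 *m VAC p r t = W' p r s t.
Proof.
have [V1 V2 _] := HAC.
rewrite /VCD mulmx_suml (bigD1 p) //= [X in _ + X]big1 ?addr0; last first.
  move=> p' ne; rewrite mulmx_suml big1 // => t' _.
  by rewrite -mulmxA V2 ?mulmx0.
rewrite mulmx_suml (bigD1 t) //= [X in _ + X]big1 ?addr0; last first.
  by move=> t' ne; rewrite -mulmxA V1 (negPf ne) scalar0mx mulmx0.
rewrite -mulmxA V1 eqxx /=; case: (boolP (t < k p r)%N) => lt_t; first by rewrite mulmx1.
rewrite scalar0mx mulmx0; apply/esym/adjmx_mul_eq0.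
by rewrite W'_orth (negPf lt_t) /= !andbF scalar0mx.
Qed.

(** The columns of u are orthonormal, so the new paths are isometries with
    orthogonal ranges; its rows are orthonormal, so these ranges span. *)
Lemma VCD_intertwiners : intertwiners g' VCD.
Proof.
have [_ _ VAC3] := HAC.
split.
- move=> r s t0 t0'; rewrite !ord1 /VCD adjmx_sum mulmx_suml /=.
  transitivity (\sum_p \sum_t (0 < g' r s)%N%:R *: (VAC p r t *m (VAC p r t) ^t*)).
    apply: eq_bigr => p _; rewrite adjmx_sum mulmx_suml; apply: eq_bigr => t _.
    rewrite adjmxM trmxCK mulmx_sumr (bigD1 p) //= [X in _ + X]big1 ?addr0.
      rewrite mulmx_sumr (bigD1 t) //= [X in _ + X]big1 ?addr0.
        rewrite mulmxA -(mulmxA (VAC p r t)) W'_orth !eqxx /= mul_mx_scalar -scalemxAl.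
        case: (boolP (t < k p r)%N) => //= lt_t; rewrite scale0r.
        suff -> : VAC p r t = 0 by rewrite mul0mx scaler0.
        have [VAC1 _ _] := HAC; apply: adjmx_mul_eq0.
        by rewrite VAC1 (negPf lt_t) andbF scalar0mx.
      move=> t' ne; rewrite mulmxA -(mulmxA (VAC p r t)) W'_orth eqxx eq_sym.
      by rewrite (negPf ne) scalar0mx mulmx0 mul0mx.
    move=> p' ne; rewrite mulmx_sumr big1 // => t' _.
    by rewrite mulmxA -(mulmxA (VAC p r t)) W'_orth0 1?eq_sym // mulmx0 mul0mx.
  under eq_bigr => p _ do rewrite -scaler_sumr.
  by rewrite -scaler_sumr VAC3 scalemx1.
- move=> r r' s t0 t0' ne; rewrite /VCD adjmx_sum mulmx_suml big1 // => p _.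
  rewrite adjmx_sum mulmx_suml big1 // => t _; rewrite mulmx_sumr big1 // => p' _.
  rewrite mulmx_sumr big1 // => t' _; rewrite adjmxM trmxCK mulmxA -(mulmxA (VAC p r t)).
  have -> : (W' p r s t) ^t* *m W' p' r' s t' = 0.
    case: (eqVneq p p') => [ep|np]; last exact: W'_orth0.
    by move: t'; rewrite -ep => t'; rewrite W'_orth (negPf ne) scalar0mx.
  by rewrite mulmx0 mul0mx.
- move=> s; rewrite -[RHS](mpath_full HAB HBD s).
  transitivity (\sum_p \sum_r \sum_t W' p r s t *m (W' p r s t) ^t*); last first.
    apply: eq_bigr => p _.
    transitivity (\sum_r \sum_t W' p r s t *m 1%:M *m (W' p r s t) ^t*).
      by apply: eq_bigr => r _; apply: eq_bigr => t _; rewrite mulmx1.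
    by rewrite W'_sum; apply: eq_bigr => q _; rewrite big_ord1 mulmx1.
  rewrite [RHS]exchange_big /=; apply: eq_bigr => r _; rewrite big_ord1.
  rewrite -[X in X *m _]mulmx1 -(VAC3 r) mulmx_sumr mulmx_suml.
  apply: eq_bigr => p _; rewrite mulmx_sumr mulmx_suml; apply: eq_bigr => t _.
  by rewrite -(VCD_path p r s t ord0) adjmxM !mulmxA.
Qed.

Lemma VCD_square x : mm_ind VBD (mm_ind VAB x) = mm_ind VCD (mm_ind VAC x).
Proof.
apply/mmP => s; rewrite (mpath_ind HAB HBD) (mpath_ind HAC VCD_intertwiners).
apply: eq_bigr => p _.
transitivity (\sum_q W p q s *m x p *m (W p q s) ^t*).
  by apply: eq_bigr => q _; rewrite big_ord1.
by rewrite -W'_sum; apply: eq_bigr => r _; apply: eq_bigr => t _;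
  rewrite /mpath VCD_path.
Qed.

Lemma VCD_overlap q r s : (VBD q s 0) ^t* *m VCD r s 0 =
  \sum_p \sum_t u p q r s t *: (VAB p q 0 *m (VAC p r t) ^t*).
Proof.
have [V1 V2 _] := HBD.
rewrite /VCD mulmx_sumr; apply: eq_bigr => p _; rewrite mulmx_sumr; apply: eq_bigr => t _.
rewrite /W' mulmx_suml mulmx_sumr (bigD1 q) //= [X in _ + X]big1 ?addr0.
  rewrite -scalemxAl -scalemxAr /W /mpath !mulmxA V1 eqxx /= mul_scalar_mx.
  rewrite -scalemxAl scalerA.
  case: (boolP (0 < h q s)%N) => hqs; first by rewrite mulr1.
  by rewrite mulr0 u_supp // (negPf hqs) /= !andbF.
move=> q' ne; rewrite -scalemxAl -scalemxAr /W /mpath !mulmxA V2 1?eq_sym //.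
by rewrite !mul0mx scaler0.
Qed.

(** Compressing an element of C to the copies of B brings in sums over s of products
    of two entries with the same q and r. By [conn_dual] only the diagonal terms
    survive, and they add up to the expectation of C onto A. *)
Lemma VCD_commute x :
  mm_exp h VBD wd (mm_ind VCD x) = mm_ind VAB (mm_exp k VAC wc x).
Proof.
apply/mmP => q; rewrite mm_expE mm_indE.
pose M p p' r t t' := VAB p q 0 *m (VAC p r t) ^t* *m x r *m
  (VAC p' r t' *m (VAB p' q 0) ^t*).
transitivity (\sum_s \sum_r \sum_p \sum_t \sum_p' \sum_t'
   ((wd s / wb q) * (u p q r s t * (u p' q r s t')^*)) *: M p p' r t t').
  apply: eq_bigr => s _; rewrite big_ord1 mm_indE mulmx_sumr mulmx_suml scaler_sumr.
  apply: eq_bigr => r _; rewrite big_ord1 !mulmxA VCD_overlap.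
  rewrite -mulmxA -[VBD q s ord0]trmxCK -adjmxM VCD_overlap adjmx_sum.
  rewrite -/(wb q) !mulmx_suml scaler_sumr; apply: eq_bigr => p _.
  rewrite !mulmx_suml scaler_sumr; apply: eq_bigr => t _.
  rewrite mulmx_sumr scaler_sumr; apply: eq_bigr => p' _.
  rewrite adjmx_sum mulmx_sumr scaler_sumr; apply: eq_bigr => t' _.
  by rewrite adjmxZ adjmxM trmxCK -!scalemxAl -scalemxAr !scalerA /M !mulmxA mulrA.
transitivity (\sum_r \sum_p \sum_t \sum_p' \sum_t'
   (\sum_s (wd s / wb q) * (u p q r s t * (u p' q r s t')^*)) *: M p p' r t t').
  rewrite exchange_big; apply: eq_bigr => r _; rewrite exchange_big.
  apply: eq_bigr => p _; rewrite exchange_big; apply: eq_bigr => t _.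
  rewrite exchange_big; apply: eq_bigr => p' _; rewrite exchange_big.
  by apply: eq_bigr => t' _; rewrite scaler_suml.
rewrite exchange_big; apply: eq_bigr => p _; rewrite big_ord1 mm_expE.
rewrite mulmx_sumr mulmx_suml; apply: eq_bigr => r _.
rewrite mulmx_sumr mulmx_suml; apply: eq_bigr => t _.
rewrite (bigD1 p) //= [X in _ + X]big1 ?addr0; last first.
  move=> p' ne; rewrite big1 // => t' _; rewrite u_dual eq_sym (negPf ne) mul0r.
  by rewrite scale0r.
rewrite (bigD1 t) //= [X in _ + X]big1 ?addr0; last first.
  move=> t' ne; rewrite u_dual eqxx eq_sym (negPf ne) mul0r.
  by rewrite scale0r.
rewrite u_dual !eqxx /= wac -scalemxAr -scalemxAl /M !mulmxA.
case: (boolP (_ && _)) => val; first by rewrite mul1r.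
rewrite mul0r scale0r; move: val; rewrite negb_and => /orP[] val.
  suff -> : VAB p q 0 = 0 by rewrite !mul0mx scaler0.
  have [V1 _ _] := HAB; apply: adjmx_mul_eq0.
  by rewrite V1 eqxx (negPf val) scalar0mx.
suff -> : VAC p r t = 0 by rewrite !(mulmx0, mul0mx) scaler0.
have [V1 _ _] := HAC; apply: adjmx_mul_eq0.
by rewrite V1 eqxx (negPf val) scalar0mx.
Qed.

End ToSquare.

(** The summands of A are taken one-dimensional; the dimensions of the others are then
    numbers of paths starting in A. *)
Lemma commuting_square_of_connection (K : numClosedFieldType) (ra rb rc rd N : nat)
    (g : 'M[nat]_(ra, rb)) (k : 'M[nat]_(ra, rc))
    (h : 'M[nat]_(rb, rd)) (g' : 'M[nat]_(rc, rd))
    (wd : 'I_rd -> K) (z : 'I_ra -> 'I_rb -> 'I_rc -> 'I_rd -> 'I_N -> K) :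
  (forall p q, (g p q <= 1)%N) -> (forall p r, (k p r <= N)%N) ->
  (forall q s, (h q s <= 1)%N) -> (forall r s, (g' r s <= 1)%N) ->
  (forall p, exists q, (0 < g p q)%N) -> (forall q, exists p, (0 < g p q)%N) ->
  (forall q, exists s, (0 < h q s)%N) -> (forall s, exists q, (0 < h q s)%N) ->
  (forall p, exists r, (0 < k p r)%N) -> (forall r, exists p, (0 < k p r)%N) ->
  (forall r, exists s, (0 < g' r s)%N) ->
  (forall s, 0 < wd s) ->
  let wb := weight_pull h wd in let wc := weight_pull g' wd in
  let wa := weight_pull g wb in
  (forall p, weight_pull k wc p = wa p) ->
  connection g k h g' wa wb wc wd z ->
  admits_commuting_square K (map_mx Posz g) (map_mx Posz k) (map_mx Posz h) (map_mx Posz g').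
Proof.
move=> g1 kN h1 g'1 gA gB hB hD kA kC gC wd_gt0 wb wc wa wac Hz.
pose a : 'I_ra -> nat := fun=> 1%N.
have [b [VAB [HAB b0]]] := intertwiners_exist K 1 g a.
have [c [VAC [HAC c0]]] := intertwiners_exist K N k a.
have [d [VBD [HBD d0]]] := intertwiners_exist K 1 h b.
have HCD := VCD_intertwiners wd_gt0 Hz gA hB HAB HAC HBD.
set VCD := (VCD g h wd z VAB VAC VBD) in HCD.
have b_gt0 q : (0 < b q)%N by have [p gpq] := gB q; apply: (b0 q p ord0).
have wb_gt0 q : 0 < wb q by apply: weight_pull_gt0.
have wc_gt0 q : 0 < wc q by apply: weight_pull_gt0.
have wa_gt0 q : 0 < wa q by apply: weight_pull_gt0.
exists a, b, c, d; split; first split=> //.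
- by move=> r; have [p kpr] := kC r;
    apply: (c0 r p (Ordinal (leq_trans kpr (kN p r)))).
- by move=> s; have [q hqs] := hD s; apply: (d0 s q ord0).
exists (mm_ind VAB), (mm_ind VAC), (mm_ind VBD), (mm_ind VCD).
have sq : mm_ind VBD \o mm_ind VAB =1 mm_ind VCD \o mm_ind VAC.
  by move=> x /=; rewrite (VCD_square wd_gt0 Hz gA hB HAB HAC HBD).
split; first by split=> //; apply: mm_ind_inclusion.
have wac_gt0 p : 0 < weight_pull k wc p by rewrite wac.
have eAB := mm_expectation HAB g1 wb_gt0 wa_gt0.
have eAC := mm_expectation HAC kN wc_gt0 wac_gt0.
have eBD := mm_expectation HBD h1 wd_gt0 wb_gt0.
have eCD := mm_expectation HCD g'1 wd_gt0 wc_gt0.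
have faith := @mm_tr_faithful K rd d wd wd_gt0.
exists (mm_tr wd) => //.
have [lE ES Eid Ebim Epos] := expectation_cond_exp (expectation_comp eAC eCD).
have hA : cond_exp (mm_tr wd) (in_range (mm_ind VBD \o mm_ind VAB))
    ((mm_ind VCD \o mm_ind VAC) \o (mm_exp k VAC wc \o mm_exp g' VCD wd)).
  have iff x : in_range (mm_ind VBD \o mm_ind VAB) x <-> in_range (mm_ind VCD \o mm_ind VAC) x.
    by split=> -[y <-]; exists y; rewrite -sq.
  split=> //.
  - by move=> x; apply/iff.
  - by move=> x /iff; apply: Eid.
  - by move=> x y t /iff Sx /iff St; apply: Ebim.
have one1 r n (phi : multimx K n -> multimx K d) : phi 1 = 1 -> @in_range (@multimx K r n) _ phi 1.
  by move=> e; exists 1.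
apply: (commuting_of_comp faith hA (expectation_cond_exp eBD) (expectation_cond_exp eCD)).
- by apply: one1; rewrite /= (mm_ind1 HAB) (mm_ind1 HBD).
- exact/one1/(mm_ind1 HBD).
- exact/one1/(mm_ind1 HCD).
move=> x /=; rewrite [mm_exp h VBD wd _](VCD_commute wd_gt0 wac Hz gA hB HAB HAC HBD).
by rewrite -[RHS]/((mm_ind VBD \o mm_ind VAB) _) sq.
Qed.

(** * The connection of a commuting square *)

Section FromSquare.
Local Open Scope sesquilinear_scope.
Variable K : numClosedFieldType.
Variables (ra rb rc rd N : nat).
Variables (g : 'M[nat]_(ra, rb)) (k : 'M[nat]_(ra, rc)).
Variables (h : 'M[nat]_(rb, rd)) (g' : 'M[nat]_(rc, rd)).
Hypothesis g1 : forall p q, (g p q <= 1)%N.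
Hypotheses (h1 : forall q s, (h q s <= 1)%N) (g'1 : forall r s, (g' r s <= 1)%N).
Variable wd : 'I_rd -> K.
Hypothesis wd_gt0 : forall s, 0 < wd s.
Let wb := weight_pull h wd.
Let wc := weight_pull g' wd.
Let wa := weight_pull g wb.
Hypothesis wa_gt0 : forall p, 0 < wa p.
Variables (a : 'I_ra -> nat) (b : 'I_rb -> nat) (c : 'I_rc -> nat) (d : 'I_rd -> nat).
Hypothesis a_gt0 : forall p, (0 < a p)%N.
Variable VAB : forall p q, 'I_1 -> 'M[K]_(b q, a p).
Variable VAC : forall p r, 'I_N -> 'M[K]_(c r, a p).
Variable VBD : forall q s, 'I_1 -> 'M[K]_(d s, b q).
Variable VCD : forall r s, 'I_1 -> 'M[K]_(d s, c r).
Hypotheses (HAB : intertwiners g VAB) (HAC : intertwiners k VAC).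
Hypotheses (HBD : intertwiners h VBD) (HCD : intertwiners g' VCD).
Hypothesis square : mm_ind VBD \o mm_ind VAB =1 mm_ind VCD \o mm_ind VAC.
Hypothesis commuting : commuting_square (mm_tr wd)
  (in_range (mm_ind VBD \o mm_ind VAB)) (in_range (mm_ind VBD)) (in_range (mm_ind VCD)).

Let squareE x : mm_ind VBD (mm_ind VAB x) = mm_ind VCD (mm_ind VAC x).
Proof. exact: square. Qed.

Let W p q s := mpath VAB VBD p q s 0.
Let W' p r s t := mpath VAC VCD p r s t.

Let i0 p := Ordinal (a_gt0 p).
(** A path A - B - D and a path A - C - D both intertwine the action of A, so that by
    Schur's lemma their overlap is a scalar matrix. *)
Definition overlap p q r s t : K := ((W p q s) ^t* *m W' p r s t) (i0 p) (i0 p).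

Let overlapE p q r s t :
  (W p q s) ^t* *m W' p r s t = (overlap p q r s t)%:M.
Proof.
have [y|e E] := @scalar_of_commuting K _ ((W p q s) ^t* *m W' p r s t).
  have Wx := mpath_intertwine_adj HAB HBD (mm_single y) p q s 0.
  have W'x := mpath_intertwine HAC HCD (mm_single y) p r s t.
  rewrite -[y](mm_singleE y) mulmxA -Wx -mulmxA -/(W' _ _ _ _) -W'x.
  by rewrite squareE !mulmxA.
by rewrite /overlap E mxE eqxx mulr1n.
Qed.

Let overlap0 p p' q r s t : p != p' -> (W p q s) ^t* *m W' p' r s t = 0.
Proof.
move=> ne; have Wx := mpath_intertwine_adj HAB HBD (mm_single (1%:M : 'M[K]_(a p'))) p q s 0.
have W'x := mpath_intertwine HAC HCD (mm_single (1%:M : 'M[K]_(a p'))) p' r s t.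
rewrite mm_singleE mulmx1 in W'x.
rewrite /W' -W'x mulmxA -squareE.
by rewrite Wx mm_single0 1?eq_sym // !mul0mx.
Qed.

Let scalar_mx_eq p (x y : K) : x%:M = y%:M :> 'M_(a p) -> x = y.
Proof. by move/(congr1 (fun A : 'M_(a p) => A (i0 p) (i0 p))); rewrite !mxE eqxx !mulr1n. Qed.

Let overlapEC p q r s t :
  (W' p r s t) ^t* *m W p q s = ((overlap p q r s t)^*)%:M.
Proof. by rewrite -[LHS]trmxCK adjmxM trmxCK overlapE adjmx_scalar. Qed.

Let overlap0C p p' q r s t : p != p' -> (W' p r s t) ^t* *m W p' q s = 0.
Proof.
by move=> ne; rewrite -[LHS]trmxCK adjmxM trmxCK overlap0 1?eq_sym ?adjmx0.
Qed.

Let W_orth p q q' s :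
  (W p q s) ^t* *m W p q' s = [&& q == q', (0 < g p q)%N & (0 < h q s)%N]%:R%:M.
Proof. by rewrite (mpath_orth HAB HBD). Qed.

Let W'_orth p r r' s t t' : (W' p r s t) ^t* *m W' p r' s t' =
  [&& r == r', t == t', (t < k p r)%N & (0 < g' r s)%N]%:R%:M.
Proof. exact: mpath_orth. Qed.

Let overlap_supp p q r s (t : 'I_N) :
  ~~ [&& 0 < g p q, t < k p r, 0 < h q s & 0 < g' r s]%N -> overlap p q r s t = 0.
Proof.
move=> nv; apply: (@scalar_mx_eq p); rewrite -overlapE scalar0mx.
case: (boolP ((0 < g p q)%N && (0 < h q s)%N)) => [/andP[gpq hqs]|nv1]; last first.
  rewrite (_ : W p q s = 0) ?adjmx0 ?mul0mx //; apply: adjmx_mul_eq0.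
  by rewrite W_orth eqxx /= (negPf nv1) scalar0mx.
rewrite (_ : W' p r s t = 0) ?mulmx0 //; apply: adjmx_mul_eq0.
rewrite W'_orth !eqxx /=; case: (boolP (_ && _)) => [/andP[kpr grs]|_].
  by rewrite gpq hqs kpr grs in nv.
by rewrite scalar0mx.
Qed.

Let overlap_col p s r (t : 'I_N) r' t' :
  \sum_q overlap p q r s t * (overlap p q r' s t')^* =
  [&& r == r', t == t', (t < k p r)%N & (0 < g' r s)%N]%:R.
Proof.
apply: (@scalar_mx_eq p); rewrite -conjC_nat -adjmx_scalar -W'_orth adjmxM trmxCK.
rewrite -[X in _ = X *m _]mulmx1 -(mpath_full HAB HBD s) mulmx_sumr mulmx_suml.
rewrite (bigD1 p) //= [X in _ + X]big1 ?addr0 => [|p' ne]; last first.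
  rewrite mulmx_sumr mulmx_suml big1 // => q _; rewrite big_ord1.
  by rewrite mulmxA -/(W _ _ _) overlap0C 1?eq_sym // !mul0mx.
rewrite mulmx_sumr mulmx_suml raddf_sum; apply: eq_bigr => q _ /=.
by rewrite big_ord1 mulmxA -mulmxA -/(W _ _ _) overlapE overlapEC -scalar_mxM mulrC.
Qed.

Let overlap_row p s q q' :
  \sum_r \sum_t overlap p q r s t * (overlap p q' r s t)^* =
  [&& q == q', (0 < g p q)%N & (0 < h q s)%N]%:R.
Proof.
apply: (@scalar_mx_eq p); rewrite -W_orth.
rewrite -[X in _ = X *m _]mulmx1 -(mpath_full HAC HCD s) mulmx_sumr mulmx_suml.
rewrite (bigD1 p) //= [X in _ + X]big1 ?addr0 => [|p' ne]; last first.
  rewrite mulmx_sumr mulmx_suml big1 // => r _.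
  rewrite mulmx_sumr mulmx_suml big1 // => t _.
  by rewrite mulmxA -/(W' _ _ _ _) overlap0 1?eq_sym // !mul0mx.
rewrite mulmx_sumr mulmx_suml raddf_sum; apply: eq_bigr => r _ /=.
rewrite mulmx_sumr mulmx_suml raddf_sum; apply: eq_bigr => t _ /=.
by rewrite mulmxA -mulmxA -/(W' _ _ _ _) overlapE overlapEC -scalar_mxM.
Qed.

(** On C the expectation onto B agrees with the one onto A, because E_B E_C = E_A; the
    element x is the image of y. *)
Lemma commuting_trace y : exists x, forall v,
  mm_tr wd (mm_ind VBD v * mm_ind VCD y) = mm_tr wb (v * mm_ind VAB x).
Proof.
have [EA [EB [EC [cA cB cC eBC eCB]]]] := commuting.
have rng x : in_range (mm_ind VBD) (mm_ind VBD x) by exists x.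
have [_ /(_ (mm_ind VCD y)) [x Ex] _ _ _] := cA.
exists x => v; have [_ _ EBid _ _] := cB; have [_ _ ECid _ _] := cC.
rewrite -{1}(EBid (mm_ind VBD v)) // (cond_exp_selfadj _ _ cB); last first.
  by rewrite -(mm_ind1 HBD).
rewrite -[mm_ind VCD y in LHS]ECid; last by exists y.
rewrite -[EB _]/((EB \o EC) _) -eBC -Ex /= -(mm_indM HBD).
exact: mm_tr_ind.
Qed.

(** The identity of [commuting_trace] for elements v of B and y of C that join two
    copies of a minimal projection of A. Its left side is a sum over s of products of
    overlaps, and its right side vanishes unless the two copies coincide. *)
Let overlap_dual q r p (t : 'I_N) p' t' :
  \sum_s wd s * (overlap p q r s t * (overlap p' q r s t')^*) =
  [&& p == p', t == t', (0 < g p q)%N & (t < k p r)%N]%:R * (wb q * wc r / wa p).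
Proof.
(* x *m x^T is a minimal projection, hence the trace 1 below. *)
pose x : 'M[K]_(a p', a p) := delta_mx (i0 p') (i0 p).
pose v : multimx K b := mm_single (VAB p' q 0 *m x *m (VAB p q 0) ^t*).
pose y : multimx K c := mm_single (VAC p r t *m x ^T *m (VAC p' r t') ^t*).
have trx : \tr (x *m x ^T) = 1.
  rewrite /x trmx_delta mul_delta_mx /mxtrace (bigD1 (i0 p')) //= big1 ?addr0.
    by rewrite mxE !eqxx.
  by move=> j nj; rewrite mxE (negPf nj).
have -> : \sum_s wd s * (overlap p q r s t * (overlap p' q r s t')^*) =
    mm_tr wd (mm_ind VBD v * mm_ind VCD y).
  apply: eq_bigr => s _; congr (_ * _); rewrite mm_mulE !mm_indE.
  rewrite (bigD1 q) //= [X in _ + X]big1 ?addr0; last first.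
    by move=> q' ne; rewrite big_ord1 mm_single0 1?eq_sym // mulmx0 mul0mx.
  rewrite [in RHS](bigD1 r) //= [X in _ *m (_ + X)]big1 ?addr0; last first.
    by move=> r' ne; rewrite big_ord1 mm_single0 1?eq_sym // mulmx0 mul0mx.
  rewrite !big_ord1 !mm_singleE.
  transitivity (\tr (W p' q s *m x *m ((W p q s) ^t* *m W' p r s t) *m x ^T
      *m (W' p' r s t') ^t*)); last first.
    by congr (\tr _); rewrite /W /W' /mpath !adjmxM !mulmxA.
  rewrite overlapE mul_mx_scalar -!scalemxAl mxtraceZ; congr (_ * _).
  rewrite mxtrace_mulC -(mulmxA (W p' q s)) (mulmxA ((W' p' r s t') ^t*) (W p' q s)).
  rewrite overlapEC mul_scalar_mx mxtraceZ trx mulr1.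
  by [].
have [x0 Hx0] := commuting_trace y; rewrite Hx0.
have [VAB1 VAB2 _] := HAB; have [VAC1 _ _] := HAC.
have -> : mm_tr wb (v * mm_ind VAB x0) =
    wb q * \tr (x *m x0 p *m ((VAB p q 0) ^t* *m VAB p' q 0)).
  rewrite /mm_tr (bigD1 q) //= [X in _ + X]big1 ?addr0; last first.
    by move=> q' ne; rewrite mm_mulE mm_single0 1?eq_sym // mul0mx mxtrace0 mulr0.
  congr (_ * _); rewrite mm_mulE mm_singleE -mulmxA (mm_ind_intertwine_adj HAB).
  by rewrite -!mulmxA mxtrace_mulC !mulmxA.
case: (eqVneq p p') => [ep|ne]; last by rewrite VAB2 // mulmx0 mxtrace0 mulr0 mul0r.
subst p'; rewrite VAB1 eqxx /= mul_mx_scalar mxtraceZ.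
have E : wa p * \tr (x *m x0 p) = wc r * ((t == t') && (t < k p r)%N)%:R.
  have -> : wa p * \tr (x *m x0 p) = mm_tr wa (mm_single x * x0).
    rewrite /mm_tr (bigD1 p) //= [X in _ + X]big1 ?addr0; last first.
      by move=> q' ne; rewrite mm_mulE mm_single0 1?eq_sym // mul0mx mxtrace0 mulr0.
    by rewrite mm_mulE mm_singleE.
  rewrite -(mm_tr_ind HAB g1) (mm_indM HAB) -Hx0.
  rewrite squareE -(mm_indM HCD) (mm_tr_ind HCD g'1).
  rewrite /mm_tr (bigD1 r) //= [X in _ + X]big1 ?addr0; last first.
    by move=> q' ne; rewrite mm_mulE mm_single0 1?eq_sym // mulmx0 mxtrace0 mulr0.
  congr (_ * _); rewrite mm_mulE !mm_singleE !mulmxA (mm_ind_intertwine HAC) mm_singleE.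
  rewrite mxtrace_mulC !mulmxA VAC1 eq_sym.
  case: (eqVneq t t') => [<-|_]; last by rewrite scalar0mx !mul0mx mxtrace0.
  by rewrite !mul_scalar_mx -scalemxAl mxtraceZ trx mulr1.
have -> : \tr (x *m x0 p) = wc r * ((t == t') && (t < k p r)%N)%:R / wa p.
  by rewrite -E mulrAC mulfV ?gt_eqF // mul1r.
by case: (t == t'); case: (t < k p r)%N; case: (0 < g p q)%N => /=; ring.
Qed.

Lemma connection_of_overlap :
  connection g k h g' wa wb wc wd
    (fun p q r s t => sqrtC (wa p) * sqrtC (wd s) * overlap p q r s t).
Proof.
have cs (x : K) : 0 < x -> (sqrtC x)^* = sqrtC x.
  by move=> x0; apply: geC0_conj; rewrite sqrtC_ge0 ltW.
have zz p q r s t p' q' r' t' :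
    (sqrtC (wa p) * sqrtC (wd s) * overlap p q r s t) *
    (sqrtC (wa p') * sqrtC (wd s) * overlap p' q' r' s t')^* =
    sqrtC (wa p) * sqrtC (wa p') * (wd s * (overlap p q r s t * (overlap p' q' r' s t')^*)).
  rewrite !rmorphM /= !cs // -[in RHS](sqrtCK (wd s)); ring.
split.
- by move=> p q r s t /overlap_supp ->; rewrite mulr0.
- move=> p s r t r' t'; under eq_bigr => q _ do rewrite zz.
  rewrite -!mulr_sumr overlap_col -expr2 sqrtCK; ring.
- move=> p s q q'; under eq_bigr => r _ do
    [under eq_bigr => t _ do rewrite zz; rewrite -!mulr_sumr].
  rewrite -!mulr_sumr overlap_row -expr2 sqrtCK; ring.
- move=> q r p t p' t'; under eq_bigr => s _ do rewrite zz.
  rewrite -!mulr_sumr overlap_dual; case: (eqVneq p p') => [<-|_] /=; last by rewrite !mul0r mulr0.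
  rewrite -expr2 sqrtCK; field; exact: lt0r_neq0.
Qed.

End FromSquare.

(** The system of overlaps, rescaled, is a connection. The weights are those of an
    arbitrary faithful trace. *)
Lemma connection_of_commuting_square (K : numClosedFieldType) (ra rb rc rd N : nat)
    (g : 'M[nat]_(ra, rb)) (k : 'M[nat]_(ra, rc))
    (h : 'M[nat]_(rb, rd)) (g' : 'M[nat]_(rc, rd)) :
  (forall p q, (g p q <= 1)%N) -> (forall p r, (k p r <= N)%N) ->
  (forall q s, (h q s <= 1)%N) -> (forall r s, (g' r s <= 1)%N) ->
  (forall p, exists q, (0 < g p q)%N) -> (forall q, exists s, (0 < h q s)%N) ->
  admits_commuting_square K (map_mx Posz g) (map_mx Posz k) (map_mx Posz h) (map_mx Posz g') ->
  exists (wd : 'I_rd -> K) (z : 'I_ra -> 'I_rb -> 'I_rc -> 'I_rd -> 'I_N -> K),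
    (forall s, 0 < wd s) /\
    connection g k h g' (weight_pull g (weight_pull h wd)) (weight_pull h wd)
      (weight_pull g' wd) wd z.
Proof.
move=> g1 kN h1 g'1 gA hB [a [b [c [d [[a0 b0 c0 d0]]]]]].
move=> [iAB [iAC [iBD [iCD [[hAB hAC hBD hCD sq] [tau ft cs]]]]]].
have Posz_inj m n (x y : 'M[nat]_(m, n)) : map_mx Posz x = map_mx Posz y -> x = y.
  move=> e; apply/matrixP => i j; have := congr1 (fun A : 'M_(m, n) => A i j) e.
  by rewrite !mxE => -[].
have [_ [? /Posz_inj <- /(has_multiplicities_ind g1) [VAB HAB eAB]]] := hAB.
have [_ [? /Posz_inj <- /(has_multiplicities_ind kN) [VAC HAC eAC]]] := hAC.
have [_ [? /Posz_inj <- /(has_multiplicities_ind h1) [VBD HBD eBD]]] := hBD.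
have [_ [? /Posz_inj <- /(has_multiplicities_ind g'1) [VCD HCD eCD]]] := hCD.
have [wd wd0 etau] := faithful_trace_weights d0 ft.
have wa0 p : 0 < weight_pull g (weight_pull h wd) p.
  by apply: weight_pull_gt0 => // q; apply: weight_pull_gt0.
exists wd, (fun p q r s t => sqrtC (weight_pull g (weight_pull h wd) p) * sqrtC (wd s) *
  overlap a0 VAB VAC VBD VCD p q r s t); split=> //.
apply: connection_of_overlap => //.
  by move=> x /=; rewrite -eAB -eBD -eAC -eCD; apply: sq.
move: cs; rewrite (funext etau) (funext eBD) (funext eCD).
by rewrite (_ : mm_ind VBD \o iAB = mm_ind VBD \o mm_ind VAB) // (funext eAB).
Qed.

(** * Coordinates on a 3-star *)

Section StarCoordinates.
Variable ray : 'I_3 -> nat.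
Hypothesis ray_gt0 : forall i, (0 < ray i)%N.
Local Notation V := (star_vertex ray).
Local Notation adj := (@star_adj ray).

(** The vertex at distance n from the centre on the i-th ray; position 0 is the centre
    on every ray. *)
Definition pt (i : 'I_3) (n : nat) : V :=
  if n is m.+1 then omap (fun j => Tagged (fun i => 'I_(ray i)) j) (insub m : option 'I_(ray i))
  else None.

Lemma pt0 i : pt i 0 = None. Proof. by []. Qed.

Lemma ptS i n (lt_n : (n < ray i)%N) :
  pt i n.+1 = Some (Tagged (fun i => 'I_(ray i)) (Ordinal lt_n)).
Proof. by rewrite /pt insubT. Qed.

Lemma pt_first i : pt i 1 = star_first ray_gt0 i.
Proof. by rewrite (ptS (ray_gt0 i)). Qed.

Lemma ptP (v : V) : exists i n, (n <= ray i)%N /\ v = pt i n.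
Proof.
case: v => [[i [n lt_n]]|]; last by exists ord0, 0%N.
by exists i, n.+1; split; rewrite ?ptS.
Qed.

Lemma pt_dist i n : (n <= ray i)%N -> star_dist (pt i n) = n.
Proof. by case: n => [//|n] lt_n; rewrite ptS. Qed.

Lemma pt_adj i n j m : (n <= ray i)%N -> (m <= ray j)%N ->
  adj (pt i n) (pt j m) = [|| (i == j) && ((n.+1 == m) || (m.+1 == n)),
    (n == 0) && (m == 1) | (n == 1) && (m == 0)]%N.
Proof.
case: n m => [|n] [|m] ln lm; rewrite ?ptS /=; first by case: (i == j).
- by case: (i == j); case: m {lm} => [|[|m]].
- by case: (i == j); case: n {ln} => [|[|n]].
- by case: (i == j) => //=; lia.
Qed.

Lemma pt_eq i n j m : (n <= ray i)%N -> (m <= ray j)%N ->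
  (pt i n == pt j m) = ((i == j) && (n == m) || (n == 0) && (m == 0))%N.
Proof.
case: n m => [|n] [|m] ln lm; rewrite ?ptS /=; [by rewrite orbT| | |].
- by case: (i == j).
- by case: (i == j).
rewrite orbF; apply/eqP/andP => [[ei en]|[/eqP ei /eqP [en]]].
  by subst j; rewrite eqxx; split=> //; apply/eqP; case: en => ->.
by subst j m; congr (Some (Tagged _ _)); apply: val_inj.
Qed.

Arguments pt : simpl never.

Lemma sum_adj_center (R : nmodType) (F : V -> R) :
  \sum_(u | adj None u) F u = \sum_i F (pt i 1).
Proof.
rewrite (reindex_onto (fun i => pt i 1) (fun u : V => if u is Some t then tag t else ord0)).
  by apply: eq_bigl => i; rewrite (ptS (ray_gt0 i)) /= eqxx.
move=> u; have [i [n [ln ->]]] := ptP u; rewrite -(pt0 i) pt_adj // eqxx => adjn.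
have en : n = 1%N by lia.
subst n; suff -> : (if pt i 1 is Some t then tag t else ord0) = i by [].
by rewrite (ptS ln).
Qed.

Lemma sum_adj_ray (R : nmodType) (F : V -> R) i n : (0 < n <= ray i)%N ->
  \sum_(u | adj (pt i n) u) F u =
  F (pt i n.-1) + (if (n < ray i)%N then F (pt i n.+1) else 0).
Proof.
move=> /andP[n0 ln]; have ln1 : (n.-1 <= ray i)%N by lia.
rewrite (bigD1 (pt i n.-1)) /=; last by rewrite pt_adj // eqxx; lia.
congr (_ + _); case: ifP => [lnS|nlt].
  rewrite (big_pred1 (pt i n.+1)) // => u; have [j [m [lm ->]]] := ptP u.
  rewrite /= pt_adj // !pt_eq //; have := ray_gt0 j; have := ray_gt0 i.
  by case: (eqVneq i j) => [eij|ne]; [subst j|] => /=; lia.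
apply: big_pred0 => u; have [j [m [lm ->]]] := ptP u.
rewrite pt_adj // !pt_eq //; have := ray_gt0 j; have := ray_gt0 i.
by case: (eqVneq i j) => [eij|ne]; [subst j|] => /=; lia.
Qed.

(** These numbers are the entries of G *m G^T - 1 between even vertices and of
    G^T *m G - 1 between odd ones. *)
Definition star_two (v w : V) : nat := (\sum_(u | adj v u) adj u w - (v == w))%N.

Lemma star_two_sym v w : star_two v w = star_two w v.
Proof.
rewrite /star_two eq_sym; congr (_ - _)%N.
rewrite big_mkcond [RHS]big_mkcond /=; apply: eq_bigr => u _.
by rewrite (star_adj_sym v u) (star_adj_sym w u); case: (adj u v); case: (adj u w).
Qed.

Lemma star_two_pt i n j m : (n <= ray i)%N -> (m <= ray j)%N ->
  star_two (pt i n) (pt j m) =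
  (if (i == j) && (n == m) || (n == 0) && (m == 0) then
     if n == 0 then 2 else (n < ray i)
   else [|| (i == j) && ((n.+2 == m) || (m.+2 == n)), (n == 0) && (m == 2),
            (n == 2) && (m == 0) | [&& i != j, n == 1 & m == 1]])%N.
Proof.
move=> ln lm; rewrite /star_two pt_eq //.
case: (posnP n) => [n0|n0].
  subst n; rewrite sum_adj_center; under eq_bigr => l _ do rewrite pt_adj //.
  rewrite (bigD1 j) //= eqxx /= (eq_bigr (fun=> (m == 0)%N : nat)) => [|l nl]; last first.
    by rewrite (negPf nl) /=; lia.
  rewrite sum_nat_const (_ : #|[pred l : 'I_3 | l != j]| = 2); last first.
    by have := cardC1 j; rewrite card_ord.
  by case: (eqVneq i j) => _ /=; move: lm; case: m => [|[|[|m]]] lm //=; lia.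
have ln1 : (n.-1 <= ray i)%N by lia.
have -> : (\sum_(u | adj (pt i n) u) adj u (pt j m) = adj (pt i n.-1) (pt j m) +
    (if n < ray i then adj (pt i n.+1) (pt j m) : nat else 0))%N.
  by apply: (@sum_adj_ray nat (fun u => adj u (pt j m) : nat)); rewrite n0.
rewrite pt_adj //; case: ifP => lnS; rewrite ?pt_adj //; have := ray_gt0 i; have := ray_gt0 j.
  by case: (eqVneq i j) => [eij|ne] /=; [case: (eqVneq n m) => [enm|nm] /=|]; lia.
case: (eqVneq i j) => [eij|ne] /=; last by lia.
by subst j; case: (eqVneq n m) => [enm|nm] /=; lia.
Qed.

End StarCoordinates.
Arguments pt : simpl never.

(** * The eigenvector and the cells along the rays *)

Section Eigenvector.
Variables (K : numClosedFieldType) (ray : 'I_3 -> nat).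
Hypothesis ray_gt0 : forall i, (0 < ray i)%N.
Local Notation V := (star_vertex ray).
Local Notation adj := (@star_adj ray).
Local Notation pt := (@pt ray).
Variables (xi : V -> K) (lam : K).
Hypothesis xi_gt0 : forall v, 0 < xi v.
Hypothesis xi_eigen : forall v, \sum_(u | adj v u) xi u = lam * xi v.
Hypothesis xi_center : xi None = 1.

(** The value zero beyond the end of a ray makes the three-term recurrence hold at the
    last vertex as well. *)
Definition xray i n : K := if (n <= ray i)%N then xi (pt i n) else 0.
Local Notation al i := (xray i 1).

Lemma xrayE i n : (n <= ray i)%N -> xray i n = xi (pt i n).
Proof. by rewrite /xray => ->. Qed.

Lemma xray_ge0 i n : 0 <= xray i n.
Proof. by rewrite /xray; case: ifP => // _; rewrite ltW. Qed.

Lemma xray0 i : xray i 0 = 1. Proof. exact: xi_center. Qed.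

Lemma xray_rec i n : (0 < n <= ray i)%N ->
  xray i n.-1 + xray i n.+1 = lam * xray i n.
Proof.
move=> /andP[n0 ln]; rewrite (xrayE ln) -xi_eigen (sum_adj_ray ray_gt0) ?n0 //.
by rewrite xrayE; last lia.
Qed.

Lemma xray_sum : \sum_i al i = lam.
Proof.
rewrite -[RHS]mulr1 -xi_center -xi_eigen (sum_adj_center ray_gt0).
by apply: eq_bigr => i _; rewrite xrayE.
Qed.

Lemma xray2 i : xray i 2 = lam * al i - 1.
Proof. by rewrite -xray_rec ?ray_gt0 //= xray0; ring. Qed.

(** A Casorati determinant of the recurrence, whose coefficients are constant:
    it does not depend on the position n. *)
Lemma xray_casorati i n : (0 < n <= ray i)%N ->
  xray i n ^+ 2 - xray i n.-1 * xray i n.+1 = al i ^+ 2 - xray i 2.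
Proof.
case: n => [|n] // /andP[_]; elim: n => [_|n IH ln]; first by rewrite /= xray0 mul1r.
rewrite -IH ?(ltnW ln) //=.
have := @xray_rec i n.+2; rewrite ln => /(_ isT) /= E2.
have := @xray_rec i n.+1; rewrite (ltnW ln) => /(_ isT) /= E1.
have -> : xray i n.+3 = lam * xray i n.+2 - xray i n.+1 by rewrite -E2; ring.
have -> : xray i n = lam * xray i n.+1 - xray i n.+2 by rewrite -E1; ring.
ring.
Qed.

(** The cells along a ray form 2 x 2 blocks with entries of squared moduli
    x_(n-1) x_(n+2) and this constant; the identity gives their rows the required
    norm x_n x_(n+1). *)
Lemma xray_four i n : (0 < n)%N -> (n < ray i)%N ->
  xray i n * xray i n.+1 - xray i n.-1 * xray i n.+2 = lam * (al i ^+ 2 - xray i 2).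
Proof.
move=> n0 ln; rewrite -(@xray_casorati i n) ?n0 ?(ltnW ln) //.
have := @xray_rec i n.+1; rewrite ln => /(_ isT) /= E2.
have := @xray_rec i n; rewrite n0 (ltnW ln) => /(_ isT) /= E1.
have -> : xray i n.+2 = lam * xray i n.+1 - xray i n by rewrite -E2; ring.
have -> : xray i n.-1 = lam * xray i n - xray i n.+1 by rewrite -E1; ring.
ring.
Qed.

Section Cells.
Variable ga : 'I_3 -> K.
Hypothesis ga_real : forall i, (ga i)^* = ga i.
Hypothesis ga2 : forall i, ga i ^+ 2 = lam * (al i ^+ 2 - xray i 2).

Definition ray_of (v : V) : 'I_3 := if v is Some t then tag t else ord0.

Lemma ray_of_pt i n : (0 < n <= ray i)%N -> ray_of (pt i n) = i.
Proof. by case: n => [|n] // ln; rewrite (ptS ln). Qed.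

Definition cell (p q r s : V) (t : 'I_2) : bool :=
  [&& adj p q, adj r s, (0 < star_two q s)%N & (t < star_two p r)%N].

(** The values of the connection; p and r are at even, q and s at odd distance from
    the centre. If p = r is the centre, the two edges joining the centre to itself
    give the two coordinates of a vector e i j. The other cells with p = r or q = s
    lie on one ray; they carry a constant of the ray and, if both equalities hold, the
    entry that completes a 2 x 2 block. The remaining cells are given by paths
    q - p - s - r or p - q - r - s of length three: their moduli are forced, and
    their phases are chosen to be 1 except for paths turning at the centre, where the
    arrays C and C' prescribe them. *)
Definition star_cell (e : 'I_3 -> 'I_3 -> 'I_2 -> K) (C C' : 'I_3 -> 'I_3 -> K)
    (p q r s : V) (t : 'I_2) : K :=
  if ~~ cell p q r s t then 0 else
  if p == r then
    if p == None then e (ray_of q) (ray_of s) t else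
    if q == s then - sqrtC (xi p * xi q - ga (ray_of p) ^+ 2) else ga (ray_of p)
  else if q == s then ga (ray_of q) else
  (if adj p s then
     if p == None then C (ray_of q) (ray_of s) else sqrtC (xi q * xi r) else 0) +
  (if adj r q then
     if r == None then C' (ray_of q) (ray_of s) else sqrtC (xi p * xi s) else 0).

(** Exchanging (p, q) with (r, s) interchanges the two orthogonality conditions of a
    connection, so only one of them has to be verified, for e and its transpose. *)
Lemma star_cell_sym e C C' p q r s t : star_cell e C C' p q r s t =
  star_cell (fun i j => e j i) (fun i j => C' j i) (fun i j => C j i) r s p q t.
Proof.
rewrite /star_cell.
have -> : cell r s p q t = cell p q r s t.
  by rewrite /cell (star_two_sym q s) (star_two_sym p r) andbCA.
case: ifP => // _; rewrite (eq_sym r p) (eq_sym s q). 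
case: (p =P r) => [->|_] //; first by case: ifP => // _; case: (q =P s) => [->|].
case: (q =P s) => [->|_] //.
by rewrite [RHS]addrC (mulrC (xi r)) (mulrC (xi s)).
Qed.

Section Columns.
Variables (e : 'I_3 -> 'I_3 -> 'I_2 -> K) (C C' : 'I_3 -> 'I_3 -> K).
Hypothesis e_col : forall j t t',
  \sum_i e i j t * (e i j t')^* = (t == t')%:R * al j.
Hypothesis e_leaf : forall i t, ray i = 1%N -> e i i t = 0.
Hypothesis eC_col : forall j t, \sum_i e i j t * (C i j)^* = 0.
Hypothesis C_col : forall j, \sum_i C i j * (C i j)^* = al j.
Hypothesis C_diag : forall j, C j j = ga j.
Hypothesis C'_norm : forall i j, i != j -> C' i j * (C' i j)^* = xray i 2 * al j.
Local Notation Z := (star_cell e C C').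

Let sqrt_real (y : K) : 0 <= y -> sqrtC y * (sqrtC y)^* = y.
Proof. by move=> y0; rewrite geC0_conj ?sqrtC_ge0 // -expr2 sqrtCK. Qed.

Lemma Z_center i j t : Z None (pt i 1) None (pt j 1) t = e i j t.
Proof.
rewrite /star_cell /cell !ray_of_pt ?ray_gt0 //
  -(pt0 ray ord0) !star_two_pt // !pt_adj // !pt_eq //=.
rewrite !orbT /= ltn_ord andbT !orbF !andbT.
case: (eqVneq i j) => [<-|ne] //=.
case: (ltnP 1 (ray i)) => //= ri.
by rewrite e_leaf //; have := ray_gt0 i; lia.
Qed.

Lemma Z_centerC i j : (1 < ray j)%N -> Z None (pt i 1) (pt j 2) (pt j 1) 0 = C i j.
Proof.
move=> lj; rewrite /star_cell /cell !ray_of_pt ?ray_gt0 //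
  -(pt0 ray ord0) !star_two_pt // !pt_adj // !pt_eq //=.
rewrite !(orbT, orbF, andbT, andbF, eqxx) /=.
case: (eqVneq i j) => [eij|ne] /=; first by subst j; rewrite lj C_diag.
by rewrite addr0.
Qed.

Lemma Z_center3 i j : (2 < ray j)%N -> Z None (pt i 1) (pt j 2) (pt j 3) 0 =
  if i == j then sqrtC (xi (pt j 3)) else 0.
Proof.
move=> lj; have lj2 := ltnW lj; rewrite /star_cell /cell !ray_of_pt ?ray_gt0 //
  -(pt0 ray ord0) !star_two_pt // !pt_adj // !pt_eq //=.
rewrite !(orbT, orbF, andbT, andbF, eqxx) /=.
case: (eqVneq i j) => [<-|ne] //=.
by rewrite pt0 xi_center mul1r add0r.
Qed.


Local Notation two := (@star_two ray).

Lemma adj_ptP r j m : (0 < m <= ray j)%N -> adj r (pt j m) ->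
  r = pt j m.-1 \/ (m < ray j)%N /\ r = pt j m.+1.
Proof.
case: (ptP r) => i [n [ln ->]] /andP[m0 lm]; have lm1 : (m.-1 <= ray j)%N by lia.
rewrite pt_adj // => adj_nm; case: (ltnP m (ray j)) => lmS.
  have : (pt i n == pt j m.-1) || (pt i n == pt j m.+1).
    by rewrite !pt_eq //; move: adj_nm; case: (eqVneq i j) => [eij|ne] /=; lia.
  by case/orP=> /eqP ->; [left|right].
left; apply/eqP; rewrite pt_eq //.
by move: adj_nm; case: (eqVneq i j) => [eij|ne]; [subst j|] => /=; lia.
Qed.

Lemma cell_flat p q s t : cell p q p s t -> p != None -> q == s = false ->
  Z p q p s t = ga (ray_of p).
Proof. by move=> c pN qs; rewrite /star_cell c eqxx (negPf pN) qs. Qed.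

Lemma cell_bend p q r t : cell p q r q t -> p == r = false ->
  Z p q r q t = ga (ray_of q).
Proof. by move=> c pr; rewrite /star_cell c pr eqxx. Qed.

Lemma cell_flip p q t : cell p q p q t -> p != None ->
  Z p q p q t = - sqrtC (xi p * xi q - ga (ray_of p) ^+ 2).
Proof. by move=> c pN; rewrite /star_cell c !eqxx (negPf pN). Qed.

Lemma cell_out p q r s t : cell p q r s t -> p == r = false -> q == s = false ->
  adj p s -> adj r q = false -> p != None -> Z p q r s t = sqrtC (xi q * xi r).
Proof. by move=> c pr qs ps rq pN; rewrite /star_cell c pr qs ps rq (negPf pN) addr0. Qed.

Lemma cell_in p q r s t : cell p q r s t -> p == r = false -> q == s = false ->
  adj p s = false -> adj r q -> Z p q r s t =
  if r == None then C' (ray_of q) (ray_of s) else sqrtC (xi p * xi s).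
Proof. by move=> c pr qs ps rq; rewrite /star_cell c pr qs ps rq add0r. Qed.

Lemma cell_off p q r s t : cell p q r s t = false -> Z p q r s t = 0.
Proof. by move=> c; rewrite /star_cell c. Qed.

Lemma pt_neqN i n : (0 < n <= ray i)%N -> pt i n != None.
Proof. by case: n => // n ln; rewrite ptS. Qed.

Ltac pt_solve := rewrite /cell;
  repeat (rewrite (star_two_pt ray_gt0); [|lia|lia]); repeat (rewrite pt_adj; [|lia|lia]);
  repeat (rewrite pt_eq; [|lia|lia]); rewrite ?eqxx ?andbF ?andbT /=;
  repeat (case: ifP => //=); lia.

Section Noncentral.
Variables (i : 'I_3) (n : nat).

(** The block of the edge joining p to the vertex s below it, with rows s and the
    vertex above p, and columns the vertex below s and p itself. If p is the end of
    the ray a single entry remains, of the right modulus because xray then vanishes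
    above p. *)
Lemma col_below r r' : (0 < n)%N -> (n.+1 <= ray i)%N ->
  let p := pt i n.+1 in let s := pt i n in
  adj r s -> adj r' s -> (0 < two p r)%N -> (0 < two p r')%N ->
  \sum_(q | adj p q) Z p q r s 0 * (Z p q r' s 0)^* = (r == r')%:R * (xi p * xi s).
Proof.
move=> n0 ln p s ars ars'; rewrite /p /s in ars ars' *.
have four := xray_four n0 ln; rewrite -ga2 in four.
have rE r0 : adj r0 (pt i n) -> (0 < two (pt i n.+1) r0)%N ->
    r0 = pt i n.-1 \/ (n.+1 < ray i)%N /\ r0 = pt i n.+1.
  case/adj_ptP=> [|->|[_ ->]]; [by lia|by left|].
  by rewrite star_two_pt // !eqxx /=; case: (n.+1 < ray i)%N => //; right.
have xin m : (m <= ray i)%N -> xi (pt i m) = xray i m by move=> lm; rewrite xrayE.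
have X0 : 0 <= xray i n.-1 * xray i n.+2 by rewrite mulr_ge0 ?xray_ge0.
have low_L : Z (pt i n.+1) (pt i n) (pt i n.-1) (pt i n) 0 = ga i.
  rewrite cell_bend ?ray_of_pt //; [lia|pt_solve|pt_solve].
have up_L : (n.+1 < ray i)%N ->
    Z (pt i n.+1) (pt i n.+2) (pt i n.-1) (pt i n) 0 = sqrtC (xray i n.-1 * xray i n.+2).
  move=> lnS; rewrite cell_out ?pt_neqN ?xin //; try by [lia|pt_solve].
  by rewrite mulrC.
have low_U : (n.+1 < ray i)%N ->
    Z (pt i n.+1) (pt i n) (pt i n.+1) (pt i n) 0 = - sqrtC (xray i n.-1 * xray i n.+2).
  move=> lnS; rewrite cell_flip ?pt_neqN //; try by [lia|pt_solve].
  rewrite ray_of_pt // !xin //; last by lia.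
  by congr (- sqrtC _); rewrite -four; ring.
have up_U : (n.+1 < ray i)%N ->
    Z (pt i n.+1) (pt i n.+2) (pt i n.+1) (pt i n) 0 = ga i.
  by move=> lnS; rewrite cell_flat ?pt_neqN ?ray_of_pt //; try by [lia|pt_solve].
move=> /(rE _ ars) hr /(rE _ ars') hr'.
rewrite sum_adj_ray // !xin //; last by lia.
have SQ := sqrt_real X0; have SC := geC0_conj (_ : 0 <= sqrtC (xray i n.-1 * xray i n.+2)).
rewrite sqrtC_ge0 in SC; have {}SC := SC X0.
case: hr hr' => [->|[lnS ->]] [->|[lnS' ->]] /=; rewrite ?eqxx ?mul1r.
- rewrite low_L ga_real; case: ifP => lnS.
    rewrite up_L // SQ -expr2 mulrC.
    have : ga i ^+ 2 = xray i n * xray i n.+1 - xray i n.-1 * xray i n.+2 by rewrite four.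
    by move=> ->; ring.
  rewrite addr0 -expr2 -four mulrC /xray.
  by rewrite [X in _ * _ - _ * X]ifN ?mulr0 ?subr0 //; lia.
- rewrite lnS' low_L low_U // up_L // up_U // !rmorphN /= SC ga_real.
  rewrite (_ : pt i n.-1 == pt i n.+1 = false); [by rewrite /=; ring|pt_solve].
- rewrite lnS low_L low_U // up_L // up_U //= SC ga_real.
  rewrite (_ : pt i n.+1 == pt i n.-1 = false); [by rewrite /=; ring|pt_solve].
- rewrite lnS low_U // up_U // ga_real rmorphN /= mulrNN SQ -expr2 -four.
  ring.
Qed.

(** The same block for an edge joining p to the vertex s above it. *)
Lemma col_above r r' : (1 < n)%N -> (n.+1 <= ray i)%N ->
  let p := pt i n in let s := pt i n.+1 in
  adj r s -> adj r' s -> (0 < two p r)%N -> (0 < two p r')%N ->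
  \sum_(q | adj p q) Z p q r s 0 * (Z p q r' s 0)^* = (r == r')%:R * (xi p * xi s).
Proof.
move=> n1 ln p s ars ars' _ _; rewrite /p /s in ars ars' *.
have n0 : (0 < n)%N by lia.
have four := xray_four n0 ln; rewrite -ga2 in four.
have rE r0 : adj r0 (pt i n.+1) -> r0 = pt i n \/ (n.+1 < ray i)%N /\ r0 = pt i n.+2.
  by move/adj_ptP; rewrite ln; apply.
have xin m : (m <= ray i)%N -> xi (pt i m) = xray i m by move=> lm; rewrite xrayE.
have X0 : 0 <= xray i n.-1 * xray i n.+2 by rewrite mulr_ge0 ?xray_ge0.
have low_L : Z (pt i n) (pt i n.-1) (pt i n) (pt i n.+1) 0 = ga i.
  by rewrite cell_flat ?ray_of_pt ?pt_neqN //; try by [lia|pt_solve].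
have up_L : Z (pt i n) (pt i n.+1) (pt i n) (pt i n.+1) 0 = - sqrtC (xray i n.-1 * xray i n.+2).
  (* At the end of the ray the cell is absent, and the formula gives zero. *)
  case: (ltnP n.+1 (ray i)) => lnS.
    rewrite cell_flip ?pt_neqN //; try by [lia|pt_solve].
    rewrite ray_of_pt ?xin //; try by lia.
    by congr (- sqrtC _); rewrite -four; ring.
  rewrite cell_off; last by pt_solve.
  by rewrite {2}/xray ifN ?mulr0 ?sqrtC0 ?oppr0 //; lia.
have low_U : (n.+1 < ray i)%N ->
    Z (pt i n) (pt i n.-1) (pt i n.+2) (pt i n.+1) 0 = sqrtC (xray i n.-1 * xray i n.+2).
  by move=> lnS; rewrite cell_out ?pt_neqN ?xin //; try by [lia|pt_solve].
have up_U : (n.+1 < ray i)%N ->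
    Z (pt i n) (pt i n.+1) (pt i n.+2) (pt i n.+1) 0 = ga i.
  by move=> lnS; rewrite cell_bend ?ray_of_pt //; try by [lia|pt_solve].
rewrite sum_adj_ray // ?xin //; try by lia.
have SQ := sqrt_real X0; have SC := geC0_conj (_ : 0 <= sqrtC (xray i n.-1 * xray i n.+2)).
rewrite sqrtC_ge0 in SC; have {}SC := SC X0.
rewrite ln.
case: (rE _ ars) (rE _ ars') => [->|[lnS ->]] [->|[lnS' ->]] /=; rewrite ?eqxx ?mul1r.
- rewrite low_L up_L ga_real rmorphN /= mulrNN SQ -expr2 -four; ring.
- rewrite low_L up_L low_U // up_U // SC ga_real.
  rewrite (_ : pt i n == pt i n.+2 = false); [by rewrite /=; ring|pt_solve].
- rewrite low_L up_L low_U // up_U // rmorphN /= SC ga_real.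
  rewrite (_ : pt i n.+2 == pt i n = false); [by rewrite /=; ring|pt_solve].
- rewrite low_U // up_U // SQ ga_real -expr2 -four; ring.
Qed.

(** At distance three the block has a single entry, on the geodesic from p to s. The
    next two lemmas treat the other positions of p and s at this distance. *)
Lemma col_far_below r : (0 < n)%N -> (n.+3 <= ray i)%N ->
  let p := pt i n.+3 in let s := pt i n in
  adj r s -> (0 < two p r)%N -> r = pt i n.+1 /\
  \sum_(q | adj p q) Z p q r s 0 * (Z p q r s 0)^* = xi p * xi s.
Proof.
move=> n0 ln p s ars two_r; rewrite /p /s in ars two_r *.
have er : r = pt i n.+1.
  move: two_r; case: (adj_ptP _ ars) => [|->|[_ ->] //]; first by lia.
  by rewrite (star_two_pt ray_gt0) ?eqxx /=; try lia; case: ifP; lia.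
split=> //; rewrite er sum_adj_ray //= cell_in; try by [pt_solve].
rewrite (negPf (pt_neqN _)); last by lia.
rewrite sqrt_real ?mulr_ge0 ?ltW //.
by case: ifP => lnS; rewrite ?addr0 // cell_off ?mul0r ?addr0 //; pt_solve.
Qed.

Lemma col_far_above r : (1 < n)%N -> (n.+3 <= ray i)%N ->
  let p := pt i n in let s := pt i n.+3 in
  adj r s -> (0 < two p r)%N -> r = pt i n.+2 /\
  \sum_(q | adj p q) Z p q r s 0 * (Z p q r s 0)^* = xi p * xi s.
Proof.
move=> n0 ln p s ars two_r; rewrite /p /s in ars two_r *.
have er : r = pt i n.+2.
  move: two_r; case: (adj_ptP _ ars) => [//|-> //|[lnS ->]].
  by rewrite (star_two_pt ray_gt0) ?eqxx /=; try lia; case: ifP; lia.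
split=> //; rewrite er sum_adj_ray //; try by lia.
rewrite ifT; last by lia.
rewrite cell_off ?mul0r ?add0r; last by pt_solve.
rewrite cell_in; try by [pt_solve].
by rewrite (negPf (pt_neqN _)) ?sqrt_real ?mulr_ge0 ?ltW //; lia.
Qed.

Lemma col_across j r : i != j -> (1 < ray i)%N ->
  let p := pt i 2 in let s := pt j 1 in
  adj r s -> (0 < two p r)%N -> r = None /\
  \sum_(q | adj p q) Z p q r s 0 * (Z p q r s 0)^* = xi p * xi s.
Proof.
move=> ne ln p s ars two_r; rewrite /p /s in ars two_r *.
have er : r = None.
  move: two_r; case: (adj_ptP _ ars) => [|->|[lnS ->]] //.
    by rewrite ray_gt0.
  by rewrite (star_two_pt ray_gt0) ?(negPf ne) /=; try lia; case: ifP; lia.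
have c : cell (pt i 2) (pt i 1) (pt i 0) (pt j 1) 0.
  by rewrite /cell !(star_two_pt ray_gt0) // !pt_adj // (negPf ne) eqxx.
have qs : (pt i 1 == pt j 1) = false by rewrite pt_eq // (negPf ne).
have ps : adj (pt i 2) (pt j 1) = false by rewrite pt_adj // (negPf ne).
split=> //; rewrite er sum_adj_ray //= -(pt0 ray i) cell_in ?eqxx //; try by [pt_solve].
rewrite /= !ray_of_pt ?ray_gt0 // C'_norm // !xrayE //.
case: ifP => lnS; rewrite ?addr0 // cell_off ?mul0r ?addr0 //.
rewrite /cell (star_two_pt ray_gt0) // (negPf ne) /= !andbF //.
Qed.

End Noncentral.

(** The two columns given by the vectors e i j are completed by C to a 3 x 3 block; for
    a ray of length one only the first two columns are present. *)
Lemma col_center j m r r' (t t' : 'I_2) : odd m -> (m <= ray j)%N ->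
  adj r (pt j m) -> adj r' (pt j m) -> (t < two None r)%N -> (t' < two None r')%N ->
  \sum_(q | adj None q) Z None q r (pt j m) t * (Z None q r' (pt j m) t')^* =
  ((r == r') && (t == t'))%:R * (xi None * xi (pt j m)).
Proof.
move=> om lm ars ars' tr tr'; rewrite (sum_adj_center ray_gt0) xi_center mul1r.
have m0 : (0 < m)%N by case: m om {lm ars ars'}.
have rE r0 (u : 'I_2) : adj r0 (pt j m) -> (u < two None r0)%N ->
    [\/ m = 1%N /\ r0 = None, [/\ m = 1%N, (1 < ray j)%N, r0 = pt j 2 & u = 0]
      | [/\ m = 3%N, r0 = pt j 2 & u = 0]].
  have u0 : (u < 1)%N -> u = 0 by move=> lu; apply: val_inj => /=; lia.
  case/adj_ptP=> [|->|[lmS ->]]; first by lia.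
    rewrite -(pt0 ray j) (star_two_pt ray_gt0) //; last by lia.
    rewrite eqxx /=; case: m om lm m0 {ars ars'} => [|[|[|[|m]]]] //= _ _ _; first by constructor 1.
    by move/u0 => ->; constructor 3.
  rewrite -(pt0 ray j) (star_two_pt ray_gt0) // eqxx /=.
  by case: m om lm m0 lmS {ars ars'} => [|[|m]] //= _ _ _ lm; move/u0 => ->; constructor 2.
case: (rE _ _ ars tr) => [[em er]|[em lj er et]|[em er et]];
  case: (rE _ _ ars' tr') => [[em' er']|[em' lj' er' et']|[em' er' et']];
  rewrite ?em // in em' *; subst r r'.
- by under eq_bigr => i _ do rewrite !Z_center; rewrite eqxx e_col xrayE.
- rewrite et'; under eq_bigr => i _ do rewrite Z_center Z_centerC //.
  by rewrite eC_col eq_sym (negPf (pt_neqN _)) ?mul0r.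
- rewrite et; under eq_bigr => i _ do rewrite Z_center Z_centerC //
    -[X in X * _]conjCK -rmorphM mulrC.
  rewrite -rmorph_sum eC_col rmorph0 (negPf (pt_neqN _)) ?mul0r //.
- rewrite et et' !eqxx /= mul1r -(xrayE (ray_gt0 j)) -C_col.
  by apply: eq_bigr => i _; rewrite Z_centerC.
- rewrite et et' !eqxx /= mul1r (bigD1 j) //= big1 ?addr0 => [|i ne]; rewrite Z_center3 -?em //.
    by rewrite eqxx sqrt_real ?ltW.
  by rewrite (negPf ne) mul0r.
Qed.

Lemma star_cell_col p s r r' (t t' : 'I_2) : ~~ odd (star_dist p) -> odd (star_dist s) ->
  adj r s -> adj r' s -> (t < two p r)%N -> (t' < two p r')%N ->
  \sum_(q | adj p q) Z p q r s t * (Z p q r' s t')^* =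
  ((r == r') && (t == t'))%:R * (xi p * xi s).
Proof.
have [i [n [ln ->]]] := ptP p; have [j [m [lm ->]]] := ptP s.
rewrite !pt_dist // => on om ars ars' tr tr'.
have m0 : (0 < m)%N by case: m om {lm ars ars'}.
case: (posnP n) => [n0|n0]; first by subst n; apply: col_center.
have n1 : (1 < n)%N by case: n on n0 {ln tr tr'} => [|[|n]].
have small v : (two (pt i n) v <= 1)%N.
  have [l [u [lu ->]]] := ptP v; rewrite (star_two_pt ray_gt0) // (gtn_eqF n0) /=.
  by case: ifP => _; case: (X in nat_of_bool X).
have t0 (u : 'I_2) v : (u < two (pt i n) v)%N -> u = 0.
  by move=> lu; apply: val_inj => /=; have := small v; lia.
have et := t0 _ _ tr; have et' := t0 _ _ tr'; subst t t'; rewrite eqxx andbT.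
case: (eqVneq i j) => [eij|ne].
  subst j; have [en|ne] := eqVneq n m.+1.
    by subst n; apply: col_below.
  have [em|ne'] := eqVneq m n.+1.
    by subst m; apply: col_above.
  have far v : adj v (pt i m) -> (0 < two (pt i n) v)%N -> n = m.+3 \/ m = n.+3.
    case/adj_ptP=> [|->|[lmS ->]]; first by lia.
      rewrite (star_two_pt ray_gt0) //; last by lia.
      by rewrite eqxx /=; case: ifP; lia.
    by rewrite (star_two_pt ray_gt0) // eqxx /=; case: ifP; lia.
  case: (far _ ars tr) => [en|em].
    subst n; have [-> E] := col_far_below m0 ln ars tr.
    by have [-> _] := col_far_below m0 ln ars' tr'; rewrite eqxx mul1r.
  subst m; have [-> E] := col_far_above n1 lm ars tr.
  by have [-> _] := col_far_above n1 lm ars' tr'; rewrite eqxx mul1r.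
have apart v : adj v (pt j m) -> (0 < two (pt i n) v)%N -> m = 1%N /\ n = 2%N.
  case/adj_ptP=> [|->|[lmS ->]]; first by lia.
    rewrite (star_two_pt ray_gt0) //; last by lia.
    by rewrite (negPf ne) /=; case: ifP; lia.
  by rewrite (star_two_pt ray_gt0) // (negPf ne) /=; case: ifP; lia.
case: (apart _ ars tr) => em en; subst m n.
have [-> E] := col_across ne ln ars tr.
by have [-> _] := col_across ne ln ars' tr'; rewrite eqxx mul1r.
Qed.

End Columns.
End Cells.
End Eigenvector.

(** * Square systems with orthogonal columns *)

Section Square.
Variable K : numClosedFieldType.

Lemma mulmx_scalarC m n (A : 'M[K]_(m, n)) (B : 'M_(n, m)) (w : K) :
  m = n -> w != 0 -> A *m B = w%:M -> B *m A = w%:M.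
Proof.
move=> e; subst n => w0 AB.
have /mulmx1C BA : (w^-1 *: A) *m B = 1%:M.
  by rewrite -scalemxAl AB scale_scalar_mx mulVf.
by rewrite -[A](scalerKV w0) -scalemxAr BA scalemx1.
Qed.

(** A square matrix with orthogonal columns of equal norm has orthogonal rows. The rows
    and columns that count are cut out of the index types by P and Q. *)
Lemma square_unitary (I J : finType) (P : pred I) (Q : pred J) (f : I -> J -> K) (w : K) :
  w != 0 -> #|P| = #|Q| -> (forall i j, ~~ (P i && Q j) -> f i j = 0) ->
  (forall j j', \sum_i f i j * (f i j')^* = ((j == j') && Q j)%:R * w) ->
  forall i i', \sum_j f i j * (f i' j)^* = ((i == i') && P i)%:R * w.
Proof.
move=> w0 PQ f0 col i i'.
case: (boolP (P i)) => [Pi|nPi]; last first.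
  by rewrite andbF mul0r big1 // => j _; rewrite f0 ?mul0r // (negPf nPi).
case: (boolP (P i')) => [Pi'|nPi']; last first.
  have /negPf-> : i != i' by apply: contraNneq nPi' => <-.
  by rewrite mul0r big1 // => j _; rewrite [f i' j]f0 ?conjC0 ?mulr0 // (negPf nPi').
pose A := \matrix_(k < #|P|, l < #|Q|) f (enum_val k) (enum_val l).
have sumP (F : I -> K) : (forall i, ~~ P i -> F i = 0) ->
    \sum_i F i = \sum_(k < #|P|) F (enum_val k).
  move=> F0; rewrite -(big_enum_val (A := P) F) [RHS]big_mkcond; apply: eq_bigr => k _.
  by rewrite unfold_in; case: ifP => // /negbT /F0.
have sumQ (F : J -> K) : (forall j, ~~ Q j -> F j = 0) ->
    \sum_j F j = \sum_(k < #|Q|) F (enum_val k).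
  move=> F0; rewrite -(big_enum_val (A := Q) F) [RHS]big_mkcond; apply: eq_bigr => k _.
  by rewrite unfold_in; case: ifP => // /negbT /F0.
have colA : A ^T *m map_mx Num.conj A = w%:M.
  apply/matrixP => l l'; rewrite !mxE.
  transitivity (\sum_i f i (enum_val l) * (f i (enum_val l'))^*).
    rewrite sumP => [|k nPk]; first by apply: eq_bigr => k _; rewrite !mxE.
    by rewrite f0 ?mul0r // (negPf nPk).
  rewrite col (inj_eq enum_val_inj) (_ : Q (enum_val l)); last exact: (enum_valP l).
  by rewrite andbT mulr_natl.
have /(congr1 trmx) := mulmx_scalarC (esym PQ) w0 colA.
rewrite trmx_mul trmxK tr_scalar_mx => rowA.
have Pi0 : i \in P by []. have Pi0' : i' \in P by [].
have := congr1 (fun B : 'M_#|P| => B (enum_rank_in Pi0 i) (enum_rank_in Pi0 i')) rowA.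
rewrite !mxE; under eq_bigr => l _ do rewrite !mxE !enum_rankK_in //.
rewrite -(sumQ (fun j => f i j * (f i' j)^*)) => [->|j nQj]; last first.
  by rewrite f0 ?mul0r // (negPf nQj) andbF.
by rewrite (can_in_eq (enum_rankK_in Pi0)) // andbT mulr_natl.
Qed.

Section ConnectionSquare.
Variables (ra rb rc rd N : nat).
Variables (g : 'M[nat]_(ra, rb)) (k : 'M[nat]_(ra, rc)).
Variables (h : 'M[nat]_(rb, rd)) (g' : 'M[nat]_(rc, rd)).
Hypotheses (g1 : forall p q, (g p q <= 1)%N) (kN : forall p r, (k p r <= N)%N).
Hypotheses (h1 : forall q s, (h q s <= 1)%N) (g'1 : forall r s, (g' r s <= 1)%N).
Variable z : 'I_ra -> 'I_rb -> 'I_rc -> 'I_rd -> 'I_N -> K.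
Hypothesis z_supp : forall p q r s (t : 'I_N),
  ~~ [&& 0 < g p q, t < k p r, 0 < h q s & 0 < g' r s]%N -> z p q r s t = 0.

Lemma card_paths1 r1 r2 r3 (m1 : 'M[nat]_(r1, r2)) (m2 : 'M[nat]_(r2, r3)) x y :
  (forall i j, (m1 i j <= 1)%N) -> (forall i j, (m2 i j <= 1)%N) ->
  #|[pred u : 'I_r2 | (0 < m1 x u)%N && (0 < m2 u y)%N]| = (\sum_u m1 x u * m2 u y)%N.
Proof.
move=> m11 m21; rewrite -sum1_card big_mkcond /=; apply: eq_bigr => u _; rewrite inE.
by have := m11 x u; have := m21 u y; case: (m1 x u) (m2 u y) => [|[|?]] [|[|?]].
Qed.

Lemma card_pathsN r1 (m1 : 'I_r1 -> nat) (m2 : 'I_r1 -> nat) :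
  (forall i, (m1 i <= N)%N) -> (forall i, (m2 i <= 1)%N) ->
  #|[pred u : 'I_r1 * 'I_N | (u.2 < m1 u.1)%N && (0 < m2 u.1)%N]| = (\sum_u m1 u * m2 u)%N.
Proof.
move=> m1N m21; rewrite -sum1_card
  (eq_bigl (fun u : 'I_r1 * 'I_N => (u.2 < m1 u.1)%N && (0 < m2 u.1)%N)) //.
rewrite -(pair_big_dep xpredT (fun i (t : 'I_N) => (t < m1 i)%N && (0 < m2 i)%N)
  (fun _ _ => 1%N)) /=.
apply: eq_bigr => u _; have := m21 u; case: (m2 u) => [|[|//]] _.
  by rewrite muln0 big1 // => t; rewrite andbF.
rewrite muln1 (eq_bigl (fun t : 'I_N => (t < m1 u)%N)) => [|t]; last by rewrite andbT.
by rewrite -(big_ord_widen _ (fun=> 1%N) (m1N u)) sum1_card card_ord.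
Qed.

(** There are as many paths A - B - D as paths A - C - D between given ends. *)
Lemma conn_row_of_col (wa : 'I_ra -> K) (wd : 'I_rd -> K) :
  (forall p, wa p != 0) -> (forall s, wd s != 0) ->
  (forall p s, \sum_q g p q * h q s = \sum_r k p r * g' r s)%N ->
  (forall p s r (t : 'I_N) r' t',
    \sum_q z p q r s t * (z p q r' s t')^* =
    [&& r == r', t == t', (t < k p r)%N & (0 < g' r s)%N]%:R * (wa p * wd s)) ->
  forall p s q q',
    \sum_r \sum_t z p q r s t * (z p q' r s t)^* =
    [&& q == q', (0 < g p q)%N & (0 < h q s)%N]%:R * (wa p * wd s).
Proof.
move=> wa0 wd0 gh col p s q q'; rewrite pair_big /=.
pose f (q : 'I_rb) (u : 'I_rc * 'I_N) := z p q u.1 s u.2.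
apply: (@square_unitary _ _ [pred q | (0 < g p q)%N && (0 < h q s)%N]
  [pred u : 'I_rc * 'I_N | (u.2 < k p u.1)%N && (0 < g' u.1 s)%N] f).
- by rewrite mulf_neq0.
- by rewrite card_paths1 // (card_pathsN (m1 := k p) (m2 := g'^~ s)).
- move=> i [r t] /= nv; apply: z_supp; apply: contra nv.
  by case/and4P=> -> -> -> ->.
by move=> [r t] [r' t']; rewrite /f /= col xpair_eqE andbA.
Qed.

(** There are as many paths B - A - C as paths B - D - C between given ends. That the
    dual blocks are square is what ties the trace weights to the inclusion graphs. *)
Lemma conn_dual_row (wb : 'I_rb -> K) (wc : 'I_rc -> K) :
  (forall q, wb q != 0) -> (forall r, wc r != 0) ->
  (forall q r, \sum_p g p q * k p r = \sum_s h q s * g' r s)%N ->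
  (forall q r p (t : 'I_N) p' t',
    \sum_s z p q r s t * (z p' q r s t')^* =
    [&& p == p', t == t', (0 < g p q)%N & (t < k p r)%N]%:R * (wb q * wc r)) ->
  forall q r s s',
    \sum_p \sum_t z p q r s t * (z p q r s' t)^* =
    [&& s == s', (0 < h q s)%N & (0 < g' r s)%N]%:R * (wb q * wc r).
Proof.
move=> wb0 wc0 gk dual q r s s'; rewrite pair_big /=.
pose f (s : 'I_rd) (u : 'I_ra * 'I_N) := z u.1 q r s u.2.
apply: (@square_unitary _ _ [pred s | (0 < h q s)%N && (0 < g' r s)%N]
  [pred u : 'I_ra * 'I_N | (u.2 < k u.1 r)%N && (0 < g u.1 q)%N] f).
- by rewrite mulf_neq0.
- rewrite (card_pathsN (m1 := k^~ r) (m2 := g^~ q)) //.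
  transitivity (\sum_s h q s * g'^T s r)%N.
    rewrite -card_paths1 //; last by move=> i j; rewrite mxE.
    by apply: eq_card => u; rewrite !inE mxE.
  transitivity (\sum_s h q s * g' r s)%N; first by apply: eq_bigr => u _; rewrite mxE.
  by rewrite -gk; apply: eq_bigr => u _; rewrite mulnC.
- move=> i [p t] /= nv; apply: z_supp; apply: contra nv.
  by case/and4P=> -> -> -> ->.
move=> [p t] [p' t']; rewrite /f /= dual xpair_eqE -andbA.
by congr ([&& _, _ & _]%:R * _); rewrite andbC.
Qed.

End ConnectionSquare.

Lemma phase_norm (x : K) : x != 0 -> (x^* / `|x|) * (x^* / `|x|)^* = 1.
Proof.
move=> x0; rewrite rmorphM fmorphV /= conjCK (geC0_conj (normr_ge0 _)) mulrACA.
by rewrite -normCKC expr2 -invfM mulfV // mulf_neq0 ?normr_eq0.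
Qed.

(** The missing column is the conjugate of the cross product of the two given ones,
    rescaled and multiplied by a phase that makes its j-th entry nonnegative. The
    norms of its entries follow from the orthogonality of the rows. *)
Lemma unitary_completion (F : 'I_3 -> 'I_2 -> K) (a : K) (j : 'I_3) : 0 < a ->
  (forall t t', \sum_i F i t * (F i t')^* = (t == t')%:R * a) ->
  exists c : 'I_3 -> K,
  [/\ forall t, \sum_i F i t * (c i)^* = 0, \sum_i c i * (c i)^* = a,
      forall i, c i * (c i)^* = a - \sum_t F i t * (F i t)^* & 0 <= c j].
Proof.
move=> a0 FF.
pose u i := F i 0; pose v i := F i 1.
have FF' t t' : F 0 t * (F 0 t')^* + F 1 t * (F 1 t')^* + F (inord 2) t * (F (inord 2) t')^*
    = (t == t')%:R * a.
  rewrite -FF !big_ord_recl big_ord0 addr0 addrA.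
  by do ?congr (_ + _); congr (F _ _ * (F _ _)^*); apply: val_inj; rewrite /= ?inordK.
have sum3 (G : 'I_3 -> K) : \sum_i G i = G 0 + G 1 + G (inord 2).
  rewrite !big_ord_recl big_ord0 addr0 addrA.
  by do ?congr (_ + _); congr (G _); apply: val_inj; rewrite /= ?inordK.
(* The conjugate of the cross product of u and v. *)
pose c0 (i : 'I_3) : K := (if i == 0 then u 1 * v (inord 2) - u (inord 2) * v 1
  else if i == 1 then u (inord 2) * v 0 - u 0 * v (inord 2) else u 0 * v 1 - u 1 * v 0)^*.
have c00 : c0 0 = (u 1 * v (inord 2) - u (inord 2) * v 1)^* by [].
have c01 : c0 1 = (u (inord 2) * v 0 - u 0 * v (inord 2))^* by [].
have c02 : c0 (inord 2) = (u 0 * v 1 - u 1 * v 0)^*.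
  by rewrite /c0 -!val_eqE /= inordK.
have orth t : \sum_i F i t * (c0 i)^* = 0.
  rewrite sum3 c00 c01 c02 !conjCK; case: t => [[|[|//]]] lt.
    by rewrite (_ : Ordinal lt = 0); [rewrite -!/(u _); ring|apply: val_inj].
  by rewrite (_ : Ordinal lt = 1); [rewrite -!/(v _); ring|apply: val_inj].
have norm0 : \sum_i c0 i * (c0 i)^* = a ^+ 2.
  have := FF' 0 0; have := FF' 1 1; have := FF' 0 1; have := FF' 1 0.
  rewrite sum3 c00 c01 c02 !conjCK !rmorphB !rmorphM /= -!/(u _) -!/(v _) !mul1r mul0r.
  move=> e10 e01 e11 e00.
  (* Lagrange's identity. *)
  transitivity ((u 0 * (u 0)^* + u 1 * (u 1)^* + u (inord 2) * (u (inord 2))^*) *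
    (v 0 * (v 0)^* + v 1 * (v 1)^* + v (inord 2) * (v (inord 2))^*) -
    (u 0 * (v 0)^* + u 1 * (v 1)^* + u (inord 2) * (v (inord 2))^*) *
    (v 0 * (u 0)^* + v 1 * (u 1)^* + v (inord 2) * (u (inord 2))^*)); first by ring.
  by rewrite e00 e11 e01 e10; ring.
pose ph := if c0 j == 0 then 1 else (c0 j)^* / `|c0 j|.
have ph1 : ph * ph^* = 1.
  rewrite /ph; case: eqP => [_|/eqP nz]; first by rewrite conjC1 mulr1.
  exact: phase_norm.
have sa : (sqrtC a)^* = sqrtC a by apply: geC0_conj; rewrite sqrtC_ge0 ltW.
have sa0 : sqrtC a != 0 by rewrite sqrtC_eq0 gt_eqF.
pose c i := ph * c0 i / sqrtC a.
have cc i : c i * (c i)^* = c0 i * (c0 i)^* / a.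
  rewrite /c !rmorphM fmorphV /= sa -[in RHS](sqrtCK a).
  transitivity ((ph * ph^*) * (c0 i * (c0 i)^*) / (sqrtC a ^+ 2)); last by rewrite ph1 mul1r.
  by rewrite expr2 invfM; ring.
have orthc t : \sum_i F i t * (c i)^* = 0.
  under eq_bigr => i _ do rewrite /c !rmorphM /= -mulrA mulrCA mulrA.
  rewrite (_ : \sum_i _ = (\sum_i F i t * (c0 i)^*) * (ph^* * ((sqrtC a)^-1)^*)); last first.
    by rewrite mulr_suml; apply: eq_bigr => i _; ring.
  by rewrite orth mul0r.
have normc : \sum_i c i * (c i)^* = a.
  by under eq_bigr => i _ do rewrite cc; rewrite -mulr_suml norm0 expr2 mulfK ?gt_eqF.
exists c; split=> //.
  move=> i; pose f i (o : option 'I_2) := if o is Some t then F i t else c i.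
  have := @square_unitary _ _ predT predT f a.
  rewrite card_option !card_ord => sq.
  have := sq _ erefl _ _ i i; rewrite eqxx /= mul1r => <- //; last 2 first.
  - by rewrite gt_eqF.
  - case=> [t|] [t'|] /=; rewrite ?andbT ?FF //.
    + by rewrite orthc mul0r.
    + have := congr1 Num.conj (orthc t'); rewrite rmorph_sum rmorph0 mul0r => E; rewrite -[RHS]E.
      by apply: eq_bigr => l _; rewrite /= rmorphM /= conjCK mulrC.
    + by rewrite normc mul1r.
  rewrite (bigD1 None) //= (@reindex_omap _ _ _ _ _ Some id) /=; last by case.
  by rewrite (eq_bigl xpredT) => [|t]; rewrite ?eqxx // addrK.
rewrite /c divr_ge0 ?sqrtC_ge0 ?(ltW a0) // /ph; case: eqP => [->|_]; first by rewrite mulr0.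
by rewrite mulrAC divr_ge0 // mulrC mul_conjC_ge0.
Qed.

End Square.

(** * The inclusion matrices of a 3-star *)

Section StarMatrices.
Variable ray : 'I_3 -> nat.
Hypothesis ray_gt0 : forall i, (0 < ray i)%N.
Local Notation V := (star_vertex ray).
Local Notation adj := (@star_adj ray).
Local Notation pt := (@pt ray).
Local Notation two := (@star_two ray).
Local Notation G := (star_G ray).

Definition ev (p : 'I_#|star_even ray|) : V := enum_val p.
Definition od (q : 'I_#|star_odd ray|) : V := enum_val q.

Lemma ev_even p : ~~ odd (star_dist (ev p)).
Proof. by have := enum_valP p; rewrite inE. Qed.

Lemma od_odd q : odd (star_dist (od q)).
Proof. by have := enum_valP q; rewrite inE. Qed.

Lemma ev_inj : injective ev. Proof. exact: enum_val_inj. Qed.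
Lemma od_inj : injective od. Proof. exact: enum_val_inj. Qed.

Lemma ev_surj v : ~~ odd (star_dist v) -> exists p, ev p = v.
Proof.
move=> ov; have v_in : v \in star_even ray by rewrite inE.
by exists (enum_rank_in v_in v); rewrite /ev enum_rankK_in.
Qed.

Lemma od_surj v : odd (star_dist v) -> exists p, od p = v.
Proof.
move=> ov; have v_in : v \in star_odd ray by rewrite inE.
by exists (enum_rank_in v_in v); rewrite /od enum_rankK_in.
Qed.

Lemma sum_ev (R : nmodType) (F : V -> R) :
  (forall v, odd (star_dist v) -> F v = 0) -> \sum_p F (ev p) = \sum_v F v.
Proof.
move=> F0; rewrite -(big_enum_val (A := mem (star_even ray)) F) big_mkcond.
by apply: eq_bigr => v _; rewrite inE; case: ifP => // /negbFE /F0.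
Qed.

Lemma sum_od (R : nmodType) (F : V -> R) :
  (forall v, ~~ odd (star_dist v) -> F v = 0) -> \sum_q F (od q) = \sum_v F v.
Proof.
move=> F0; rewrite -(big_enum_val (A := mem (star_odd ray)) F) big_mkcond.
by apply: eq_bigr => v _; rewrite inE; case: ifP => // /negbT /F0.
Qed.

Lemma adj_parity v w : adj v w -> odd (star_dist w) = ~~ odd (star_dist v).
Proof. by move/star_adj_parity; case: (odd _) (odd _) => [] []. Qed.

Lemma adj_exists v : exists u, adj v u.
Proof.
have [i [n [ln ->]]] := ptP v; case: n ln => [|n] ln.
  by exists (pt ord0 1); rewrite pt_adj ?ray_gt0 // orbT.
by exists (pt i n); rewrite pt_adj ?eqxx ?orbT // ltnW.
Qed.

Lemma two_gt0_exists v w : (0 < two v w)%N -> exists2 u, adj v u & adj u w.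
Proof.
rewrite /star_two => lt0.
have : (\sum_(u | adj v u) adj u w != 0)%N by case: (\sum_(u | _) _)%N lt0.
rewrite sum_nat_eq0 negb_forall => /existsP[u]; rewrite negb_imply => /andP[vu].
by rewrite eqb0 negbK => uw; exists u.
Qed.

Lemma two_parity v w : (0 < two v w)%N -> odd (star_dist w) = odd (star_dist v).
Proof. by case/two_gt0_exists => u /adj_parity vu /adj_parity ->; rewrite vu negbK. Qed.

Lemma two_diag_le v w : ((v == w) <= \sum_(u | adj v u) adj u w)%N.
Proof.
case: eqP => // <-; have [u vu] := adj_exists v.
by rewrite (bigD1 u) //= star_adj_sym vu.
Qed.

Lemma two_natr (K : pzRingType) v w :
  (two v w)%:R = \sum_(u | adj v u) (adj u w)%:R - (v == w)%:R :> K.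
Proof. by rewrite /star_two natrB ?two_diag_le // natr_sum. Qed.

Definition star_g : 'M[nat]_(#|star_even ray|, #|star_odd ray|) :=
  \matrix_(p, q) (adj (ev p) (od q) : nat).
Definition star_k : 'M[nat]_#|star_even ray| := \matrix_(p, r) two (ev p) (ev r).
Definition star_h : 'M[nat]_#|star_odd ray| := \matrix_(q, s) two (od q) (od s).

Lemma star_GE : G = map_mx Posz star_g.
Proof.
apply/matrixP => p q; rewrite !mxE /star_enum (unsplitK (inl _)) (unsplitK (inr _)).
by rewrite -/(ev p) -/(od q); case: (adj _ _).
Qed.

Lemma star_kE : G *m G^T - 1%:M = map_mx Posz star_k.
Proof.
apply/matrixP => p r; rewrite !mxE -[Posz _]natz two_natr -(inj_eq ev_inj).
congr (_ - _).
transitivity (\sum_q (adj (ev p) (od q))%:R * (adj (ev r) (od q))%:R : int).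
  by apply: eq_bigr => q _; rewrite star_GE !mxE -!natz.
rewrite (sum_od (F := fun v => (adj (ev p) v)%:R * (adj (ev r) v)%:R)).
  rewrite [RHS]big_mkcond; apply: eq_bigr => v _.
  by rewrite star_adj_sym (star_adj_sym (ev r)) star_adj_sym; case: ifP => _;
    rewrite ?mul1r ?mul0r // star_adj_sym.
move=> v ov; case: (boolP (adj (ev p) v)) => [/adj_parity|_]; last by rewrite mul0r.
by rewrite (negPf ov) (ev_even p).
Qed.

Lemma star_hE : G^T *m G - 1%:M = map_mx Posz star_h.
Proof.
apply/matrixP => p r; rewrite !mxE -[Posz _]natz two_natr -(inj_eq od_inj).
congr (_ - _).
transitivity (\sum_q (adj (ev q) (od p))%:R * (adj (ev q) (od r))%:R : int).
  by apply: eq_bigr => q _; rewrite star_GE !mxE -!natz.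
rewrite (sum_ev (F := fun v => (adj v (od p))%:R * (adj v (od r))%:R)).
  rewrite [RHS]big_mkcond; apply: eq_bigr => v _.
  by rewrite star_adj_sym; case: ifP => _; rewrite ?mul1r ?mul0r.
move=> v ov; case: (boolP (adj v (od p))) => [/adj_parity|_]; last by rewrite mul0r.
by rewrite ov (od_odd p).
Qed.

Let Posz_sum I (s : seq I) (F : I -> nat) :
  (\sum_(i <- s) F i)%N%:Z = \sum_(i <- s) (F i)%:Z.
Proof. exact: (big_morph Posz PoszD). Qed.

Let mulmx_Posz m n l (A : 'M[nat]_(m, n)) (B : 'M[nat]_(n, l)) i j :
  (map_mx Posz A *m map_mx Posz B) i j = (\sum_u A i u * B u j)%N%:Z.
Proof. by rewrite mxE Posz_sum; apply: eq_bigr => u _; rewrite !mxE PoszM. Qed.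

Lemma star_paths p s : (\sum_q star_g p q * star_h q s = \sum_r star_k p r * star_g r s)%N.
Proof.
have : G *m (G^T *m G - 1%:M) = (G *m G^T - 1%:M) *m G.
  by rewrite mulmxBr mulmxBl mulmxA mulmx1 mul1mx.
rewrite star_kE star_hE star_GE => /(congr1 (fun A : 'M_(_, _) => A p s)).
by rewrite !mulmx_Posz => -[].
Qed.

Lemma star_paths_dual q r : (\sum_p star_g p q * star_k p r = \sum_s star_h q s * star_g r s)%N.
Proof.
have : G^T *m (G *m G^T - 1%:M) = (G^T *m G - 1%:M) *m G^T.
  by rewrite mulmxBr mulmxBl mulmxA mulmx1 mul1mx.
rewrite star_kE star_hE star_GE map_trmx => /(congr1 (fun A : 'M_(_, _) => A q r)).
rewrite !mulmx_Posz => -[]; under eq_bigr => p _ do rewrite (mxE _ (fun i j => star_g j i)).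
by under [RHS]eq_bigr => s _ do rewrite [star_g^T _ _]mxE.
Qed.

Lemma star_g_le1 p q : (star_g p q <= 1)%N.
Proof. by rewrite mxE; case: (adj _ _). Qed.

Lemma star_k_le2 p r : (star_k p r <= 2)%N.
Proof.
rewrite mxE; have [i [n [ln ->]]] := ptP (ev p); have [j [m [lm ->]]] := ptP (ev r).
rewrite (star_two_pt ray_gt0) //; case: ifP => _; last by case: (X in nat_of_bool X).
by case: ifP => // _; case: (n < ray i)%N.
Qed.

Lemma star_h_le1 q s : (star_h q s <= 1)%N.
Proof.
rewrite mxE; have := od_odd q.
have [i [n [ln ->]]] := ptP (od q); have [j [m [lm ->]]] := ptP (od s).
rewrite pt_dist // (star_two_pt ray_gt0) //; case: ifP => _ on; last by case: (X in nat_of_bool X).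
by case: n on {ln} => // n _ /=; case: (_ < ray i)%N.
Qed.

Lemma star_g_row p : exists q, (0 < star_g p q)%N.
Proof.
have [u pu] := adj_exists (ev p); have [|q eq] := @od_surj u.
  by rewrite (adj_parity pu) ev_even.
by exists q; rewrite mxE eq pu.
Qed.

Lemma star_g_col q : exists p, (0 < star_g p q)%N.
Proof.
have [u qu] := adj_exists (od q); have [|p eq] := @ev_surj u.
  by rewrite (adj_parity qu) od_odd.
by exists p; rewrite mxE eq star_adj_sym qu.
Qed.

Lemma two_exists v : exists w, (0 < two v w)%N.
Proof.
have [i [n [ln ->]]] := ptP v; case: n ln => [|[|n]] ln.
- by exists None; rewrite -(pt0 ray ord0) (star_two_pt ray_gt0) //= orbT.
- have [j nij] : exists j : 'I_3, i != j.
    by case: (eqVneq i ord0) => [->|ne]; [exists 1|exists ord0].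
  by exists (pt j 1); rewrite (star_two_pt ray_gt0) // (negPf nij).
exists (pt i n); rewrite (star_two_pt ray_gt0) ?eqxx //; last by lia.
by rewrite (_ : n.+2 == n = false) /=; [rewrite !orbT|lia].
Qed.

Lemma star_k_row p : exists r, (0 < star_k p r)%N.
Proof.
have [v pv] := two_exists (ev p); have [|r er] := @ev_surj v.
  by rewrite (two_parity pv) ev_even.
by exists r; rewrite mxE er.
Qed.

Lemma star_h_row q : exists s, (0 < star_h q s)%N.
Proof.
have [v pv] := two_exists (od q); have [|r er] := @od_surj v.
  by rewrite (two_parity pv) od_odd.
by exists r; rewrite mxE er.
Qed.

Lemma star_k_col r : exists p, (0 < star_k p r)%N.
Proof. by have [p] := star_k_row r; rewrite mxE star_two_sym => pr; exists p; rewrite mxE. Qed.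

Lemma star_h_col s : exists q, (0 < star_h q s)%N.
Proof. by have [q] := star_h_row s; rewrite mxE star_two_sym => pr; exists q; rewrite mxE. Qed.

Section Weights.
Variables (K : numClosedFieldType) (xi : V -> K) (lam : K).
Hypothesis xi_eigen : forall v, \sum_(u | adj v u) xi u = lam * xi v.

(** The matrix of [star_two] is the square of the adjacency matrix minus the
    identity. *)
Lemma two_eigen v : \sum_w (two v w)%:R * xi w = (lam ^+ 2 - 1) * xi v.
Proof.
under eq_bigr => w _ do rewrite two_natr mulrBl mulr_suml.
rewrite big_split /= exchange_big /=.
have -> : \sum_w - ((v == w)%:R * xi w) = - xi v.
  rewrite (bigD1 v) //= big1 ?addr0 => [|w nw]; first by rewrite eqxx mul1r.
  by rewrite eq_sym (negPf nw) mul0r oppr0.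
rewrite mulrBl mul1r; congr (_ - _).
transitivity (\sum_(u | adj v u) lam * xi u).
  apply: eq_bigr => u _; rewrite -xi_eigen [RHS]big_mkcond; apply: eq_bigr => w _.
  by case: (adj u w); rewrite ?mul1r ?mul0r.
by rewrite -mulr_sumr xi_eigen expr2 mulrA.
Qed.

Lemma pull_g p c : weight_pull star_g (fun q => c * xi (od q)) p = c * (lam * xi (ev p)).
Proof.
rewrite /weight_pull -xi_eigen mulr_sumr.
transitivity (\sum_q (fun v => (adj (ev p) v)%:R * (c * xi v)) (od q)).
  by apply: eq_bigr => q _; rewrite mxE.
rewrite (sum_od (F := fun v => (adj (ev p) v)%:R * (c * xi v))) => [|v ov]; last first.
  case: (boolP (adj _ _)) => [/adj_parity|_]; last by rewrite mul0r.
  by rewrite (negPf ov) ev_even.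
rewrite [RHS]big_mkcond; apply: eq_bigr => v _.
by case: (adj (ev p) v); rewrite ?mul1r ?mul0r.
Qed.

Lemma pull_h q c : weight_pull star_h (fun s => c * xi (od s)) q = c * ((lam ^+ 2 - 1) * xi (od q)).
Proof.
rewrite /weight_pull -two_eigen mulr_sumr.
transitivity (\sum_s (fun v => (two (od q) v)%:R * (c * xi v)) (od s)).
  by apply: eq_bigr => s _; rewrite mxE.
rewrite (sum_od (F := fun v => (two (od q) v)%:R * (c * xi v))) => [|v ov];
  first by apply: eq_bigr => v _; rewrite mulrCA.
case: (posnP (two (od q) v)) => [->|/two_parity]; first by rewrite mul0r.
by rewrite (negPf ov) od_odd.
Qed.

Lemma pull_k p c : weight_pull star_k (fun r => c * xi (ev r)) p = c * ((lam ^+ 2 - 1) * xi (ev p)).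
Proof.
rewrite /weight_pull -two_eigen mulr_sumr.
transitivity (\sum_s (fun v => (two (ev p) v)%:R * (c * xi v)) (ev s)).
  by apply: eq_bigr => s _; rewrite mxE.
rewrite (sum_ev (F := fun v => (two (ev p) v)%:R * (c * xi v))) => [|v ov];
  first by apply: eq_bigr => v _; rewrite mulrCA.
case: (posnP (two (ev p) v)) => [->|/two_parity]; first by rewrite mul0r.
by rewrite ov (negPf (ev_even p)).
Qed.

End Weights.
End StarMatrices.

(** * From the vectors to a commuting square *)

Section StarSquare.
Variables (K : numClosedFieldType) (ray : 'I_3 -> nat).
Hypothesis ray_gt0 : forall i, (0 < ray i)%N.
Local Notation V := (star_vertex ray).
Local Notation adj := (@star_adj ray).
Local Notation pt := (@pt ray).
Local Notation two := (@star_two ray).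
Local Notation G := (star_G ray).
Variables (xi : V -> K) (lam : K).
Hypothesis xi_gt0 : forall v, 0 < xi v.
Hypothesis xi_eigen : forall v, \sum_(u | adj v u) xi u = lam * xi v.
Hypothesis xi_center : xi None = 1.
Local Notation x := (xray xi).
Local Notation al i := (xray xi i 1).

Lemma al_gt0 i : 0 < al i.
Proof. by rewrite xrayE ?ray_gt0. Qed.

Lemma al_lt_lam i : al i < lam.
Proof.
rewrite -(xray_sum ray_gt0 xi_eigen xi_center) (bigD1 i) //= ltrDl.
have [j nji] : exists j : 'I_3, j != i.
  by case: (eqVneq i ord0) => [->|ne]; [exists 1|exists ord0; rewrite eq_sym].
by rewrite (bigD1 j) //= ltr_wpDr ?al_gt0 // sumr_ge0 // => l _; rewrite ltW ?al_gt0.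
Qed.

Lemma lam_gt0 : 0 < lam.
Proof. exact: lt_trans (al_gt0 ord0) (al_lt_lam ord0). Qed.

Lemma lam2_gt1 : 0 < lam ^+ 2 - 1.
Proof.
have x2 : 0 <= lam * al ord0 - 1.
  by rewrite -(xray2 ray_gt0 xi_eigen xi_center) xray_ge0.
(* The last summand is the value of xi at distance two, or zero. *)
have -> : lam ^+ 2 - 1 = lam * (lam - al ord0) + (lam * al ord0 - 1) by ring.
by rewrite ltr_wpDr // mulr_gt0 ?lam_gt0 // subr_gt0 al_lt_lam.
Qed.

Variable e : 'I_3 -> 'I_3 -> 'I_2 -> K.
Hypothesis e_diag : forall i, \sum_t e i i t * (e i i t)^* = (lam - al i) * (lam * al i - 1).
Hypothesis e_off : forall i j, i != j ->
  \sum_t e i j t * (e i j t)^* = al i + al j - lam * al i * al j.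
Hypothesis e_row : forall i t t',
  \sum_j e i j t * (e i j t')^* = (t == t')%:R * al i.
Hypothesis e_col : forall j t t',
  \sum_i e i j t * (e i j t')^* = (t == t')%:R * al j.

Let ga i := sqrtC (lam * (al i ^+ 2 - x i 2)).

Let x2E i : x i 2 = lam * al i - 1. Proof. exact: xray2. Qed.

Let e_leaf i t : ray i = 1%N -> e i i t = 0.
Proof.
move=> ri; have x0 : lam * al i - 1 = 0 by rewrite -x2E /xray ri.
have /eqP := e_diag i; rewrite x0 mulr0 psumr_eq0 => [|u _]; last exact: mul_conjC_ge0.
by move/allP/(_ t); rewrite mem_index_enum mul_conjC_eq0 => /(_ isT) /eqP.
Qed.

(** The diagonal entry of the completion depends on the norm of e i i only, so that it
    is the same for e and for its transpose; the other moduli are those that the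
    cells q - p - s - r turning at the centre must have. *)
Lemma star_completion (f : 'I_3 -> 'I_3 -> 'I_2 -> K) :
  (forall i t, f i i t = e i i t) ->
  (forall i j, i != j -> \sum_t f i j t * (f i j t)^* = al i + al j - lam * al i * al j) ->
  (forall j t t', \sum_i f i j t * (f i j t')^* = (t == t')%:R * al j) ->
  exists C : 'I_3 -> 'I_3 -> K,
  [/\ forall j t, \sum_i f i j t * (C i j)^* = 0,
      forall j, \sum_i C i j * (C i j)^* = al j,
      forall j, C j j = ga j
    & forall i j, i != j -> C i j * (C i j)^* = al i * x j 2].
Proof.
move=> f_diag f_off f_col.
have /fin_all_exists [C HC] := fun j => unitary_completion j (al_gt0 j) (f_col j).
exists (fun i j => C j i); split=> [j|j|j|i j ne]; have [C1 C2 C3 C4] := HC j => //.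
  have -> : ga j = sqrtC (C j j ^+ 2).
    rewrite /ga [C j j ^+ 2]expr2 -[X in _ = sqrtC (_ * X)](geC0_conj C4) C3; congr sqrtC.
    under eq_bigr => t _ do rewrite f_diag.
    by rewrite e_diag x2E; ring.
  by rewrite sqrCK.
by rewrite C3 f_off // x2E; ring.
Qed.

Section Columns.
Variables (f : 'I_3 -> 'I_3 -> 'I_2 -> K) (C C' : 'I_3 -> 'I_3 -> K).
Let Z p q r s t := star_cell xi ga f C C' (ev p) (od q) (ev r) (od s) t.
Hypothesis Zcol : forall p s r r' (t t' : 'I_2),
  ~~ odd (star_dist p) -> odd (star_dist s) ->
  adj r s -> adj r' s -> (t < two p r)%N -> (t' < two p r')%N ->
  \sum_(q | adj p q) star_cell xi ga f C C' p q r s t *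
    (star_cell xi ga f C C' p q r' s t')^* =
  ((r == r') && (t == t'))%:R * (xi p * xi s).

Lemma cell0 p q r s t : ~~ cell p q r s t -> star_cell xi ga f C C' p q r s t = 0.
Proof. by move=> nc; rewrite /star_cell nc. Qed.

Lemma star_col p s r t r' t' : \sum_q Z p q r s t * (Z p q r' s t')^* =
  [&& r == r', t == t', (t < star_k ray p r)%N & (0 < star_g ray r s)%N]%:R
    * (xi (ev p) * xi (od s)).
Proof.
rewrite !mxE lt0b -(inj_eq (@ev_inj ray)).
case: (boolP ((t < two (ev p) (ev r))%N && adj (ev r) (od s))) => [/andP[kt ars]|nv]; last first.
  rewrite !andbF mul0r big1 // => q _; rewrite {1}/Z cell0 ?mul0r //.
  by apply: contra nv => /and4P[_ -> _ ->].
case: (boolP ((t' < two (ev p) (ev r'))%N && adj (ev r') (od s)))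
  => [/andP[kt' ars']|nv]; last first.
  rewrite big1 => [|q _]; last first.
    rewrite {2}/Z cell0 ?conjC0 ?mulr0 //.
    by apply: contra nv => /and4P[_ -> _ ->].
  case: eqP => [er|] /=; last by rewrite mul0r.
  case: eqP => [et|] /=; last by rewrite mul0r.
  by rewrite -er -et kt ars in nv.
rewrite !andbT -(Zcol (ev_even p) (od_odd s) ars ars' kt kt').
rewrite (sum_od (F := fun v => star_cell xi ga f C C' (ev p) v (ev r) (od s) t *
    (star_cell xi ga f C C' (ev p) v (ev r') (od s) t')^*)).
  rewrite [RHS]big_mkcond; apply: eq_bigr => v _; case: ifP => // nadj.
  by rewrite cell0 ?mul0r // /cell nadj.
move=> v ov; rewrite cell0 ?mul0r //; apply: contra ov => /and4P[+ _ _ _].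
by move/adj_parity ->; rewrite ev_even.
Qed.

End Columns.

Let ga_ge0 i : 0 <= lam * (al i ^+ 2 - x i 2).
Proof.
have -> : lam * (al i ^+ 2 - x i 2) = al i - \sum_t e i i t * (e i i t)^*.
  by rewrite e_diag x2E; ring.
have [c [_ _ /(_ i) <- _]] := unitary_completion i (al_gt0 i) (e_col i).
exact: mul_conjC_ge0.
Qed.

Let ga_real i : (ga i)^* = ga i.
Proof. by apply: geC0_conj; rewrite sqrtC_ge0. Qed.

Let ga2 i : ga i ^+ 2 = lam * (al i ^+ 2 - x i 2).
Proof. exact: sqrtCK. Qed.

(** The columns are orthogonal by [star_cell_col]. The rows follow because the blocks
    are square, and the dual condition is the one on columns for the transposed
    vectors. *)
Lemma star_connection : exists z : _ -> _ -> _ -> _ -> 'I_2 -> K,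
  connection (star_g ray) (star_k ray) (star_h ray) (star_g ray)
    (fun p => lam * (lam ^+ 2 - 1) * xi (ev p)) (fun q => (lam ^+ 2 - 1) * xi (od q))
    (fun r => lam * xi (ev r)) (fun s => xi (od s)) z.
Proof.
have [C [eC CC Cd Cn]] := star_completion (fun i t => erefl) e_off e_col.
pose f i j := e j i.
have f_off i j : i != j -> \sum_t f i j t * (f i j t)^* = al i + al j - lam * al i * al j.
  by move=> ne; rewrite e_off 1?eq_sym //; ring.
have f_col j t t' : \sum_i f i j t * (f i j t')^* = (t == t')%:R * al j.
  exact: e_row.
have [D [fD DD Dd Dn]] := star_completion (f := f) (fun i t => erefl) f_off f_col.
pose C' i j := D j i.
have C'n i j : i != j -> C' i j * (C' i j)^* = x i 2 * al j.
  by move=> ne; rewrite /C' Dn 1?eq_sym // mulrC.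
have Cn' i j : i != j -> C j i * (C j i)^* = x i 2 * al j.
  by move=> ne; rewrite Cn 1?eq_sym // mulrC.
have f_leaf i t : ray i = 1%N -> f i i t = 0 by apply: e_leaf.
have Zcol := star_cell_col ray_gt0 xi_gt0 xi_eigen xi_center ga_real ga2 e_col e_leaf
  eC CC Cd C'n.
have Zcol' := star_cell_col ray_gt0 xi_gt0 xi_eigen xi_center ga_real ga2 f_col f_leaf
  fD DD Dd Cn'.
pose c := lam * (lam ^+ 2 - 1); have c_gt0 : 0 < c by rewrite mulr_gt0 ?lam_gt0 ?lam2_gt1.
have sc : (sqrtC c)^* = sqrtC c by rewrite geC0_conj // sqrtC_ge0 ltW.
pose Z p q r s t := star_cell xi ga e C C' (ev p) (od q) (ev r) (od s) t.
have zz a b : (sqrtC c * a) * (sqrtC c * b)^* = c * (a * b^*).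
  by rewrite rmorphM /= sc -[in RHS](sqrtCK c); ring.
have supp p q r s (t : 'I_2) : ~~ [&& 0 < star_g ray p q, t < star_k ray p r,
    0 < star_h ray q s & 0 < star_g ray r s]%N -> sqrtC c * Z p q r s t = 0.
  rewrite !mxE !lt0b => nv; rewrite /Z cell0 ?mulr0 //; apply: contra nv.
  by case/and4P=> -> -> -> ->.
have col p s r (t : 'I_2) r' t' : \sum_q (sqrtC c * Z p q r s t) * (sqrtC c * Z p q r' s t')^* =
    [&& r == r', t == t', (t < star_k ray p r)%N & (0 < star_g ray r s)%N]%:R *
    (c * xi (ev p) * xi (od s)).
  by under eq_bigr => q _ do rewrite zz; rewrite -mulr_sumr (star_col Zcol); ring.
exists (fun p q r s t => sqrtC c * Z p q r s t); split => //.
  apply: (conn_row_of_col (star_g_le1 (ray := ray)) (star_k_le2 ray_gt0)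
    (star_h_le1 ray_gt0) (star_g_le1 (ray := ray)) supp) => //.
  - by move=> p; rewrite mulf_neq0 // gt_eqF.
  - by move=> s; rewrite gt_eqF.
  - exact: star_paths.
have symZ p q r s t : Z p q r s t =
    star_cell xi ga f D (fun i j => C j i) (ev r) (od s) (ev p) (od q) t.
  exact: star_cell_sym.
move=> q r p t p' t'; under eq_bigr => s _ do rewrite zz !symZ.
rewrite -mulr_sumr (star_col Zcol' r q p t p' t') !mxE star_two_sym (andbC (t < _)%N) /c.
by ring.
Qed.

Theorem star_square_of_vectors :
  admits_commuting_square K G (G *m G^T - 1%:M) (G^T *m G - 1%:M) G.
Proof.
have [z Hz] := star_connection.
rewrite (star_kE ray_gt0) (star_hE ray_gt0) star_GE.
pose wd q := 1 * xi (od q).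
have eb : weight_pull (star_h ray) wd = fun q => (lam ^+ 2 - 1) * xi (od q).
  by apply/funext => q; rewrite (pull_h ray_gt0 xi_eigen) mul1r.
have ec : weight_pull (star_g ray) wd = fun r => lam * xi (ev r).
  by apply/funext => q; rewrite (pull_g xi_eigen) mul1r.
have ea : weight_pull (star_g ray) (weight_pull (star_h ray) wd) =
    fun p => lam * (lam ^+ 2 - 1) * xi (ev p).
  by apply/funext => p; rewrite eb (pull_g xi_eigen); ring.
apply: (@commuting_square_of_connection _ _ _ _ _ 2 _ _ _ _ wd z).
- exact: star_g_le1.
- exact: star_k_le2.
- exact: star_h_le1.
- exact: star_g_le1.
- exact: star_g_row.
- exact: star_g_col.
- exact: star_h_row.
- exact: star_h_col.
- exact: star_k_row.
- exact: star_k_col.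
- exact: star_g_row.
- by move=> s; rewrite /wd mul1r.
- by move=> p; rewrite ea ec (pull_k ray_gt0 xi_eigen); ring.
rewrite ea eb ec (_ : wd = fun s => xi (od s)) //.
by apply/funext => s; rewrite /wd mul1r.
Qed.

End StarSquare.

(** * From a commuting square to the vectors *)

Section StarVectors.
Variables (K : numClosedFieldType) (ray : 'I_3 -> nat).
Hypothesis ray_gt0 : forall i, (0 < ray i)%N.
Local Notation V := (star_vertex ray).
Local Notation adj := (@star_adj ray).
Local Notation pt := (@pt ray).
Local Notation two := (@star_two ray).
Local Notation G := (star_G ray).

Let ie_in : (None : V) \in star_even ray. Proof. by rewrite inE. Qed.
Let io_in : pt ord0 1 \in star_odd ray.
Proof. by rewrite inE pt_dist ?ray_gt0. Qed.
Definition ie (v : V) : 'I_#|star_even ray| := enum_rank_in ie_in v.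
Definition io (v : V) : 'I_#|star_odd ray| := enum_rank_in io_in v.

Lemma ieK v : ~~ odd (star_dist v) -> ev (ie v) = v.
Proof. by move=> ov; rewrite /ev enum_rankK_in ?inE. Qed.
Lemma ioK v : odd (star_dist v) -> od (io v) = v.
Proof. by move=> ov; rewrite /od enum_rankK_in ?inE. Qed.
Lemma evK p : ie (ev p) = p. Proof. exact: enum_valK_in. Qed.
Lemma odK q : io (od q) = q. Proof. exact: enum_valK_in. Qed.

Lemma sum_od_adj (R : nmodType) w (F : 'I_#|star_odd ray| -> R) :
  ~~ odd (star_dist w) -> (forall q, ~~ adj w (od q) -> F q = 0) ->
  \sum_q F q = \sum_(v | adj w v) F (io v).
Proof.
move=> ow F0; rewrite [RHS]big_mkcond -(sum_od (F := fun v => if adj w v then F (io v) else 0)).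
  by apply: eq_bigr => q _; rewrite odK; case: ifP => // /negbT /F0.
by move=> v; case: ifP => // /adj_parity ->; rewrite ow.
Qed.

Lemma sum_ev_adj (R : nmodType) w (F : 'I_#|star_even ray| -> R) :
  odd (star_dist w) -> (forall p, ~~ adj w (ev p) -> F p = 0) ->
  \sum_p F p = \sum_(v | adj w v) F (ie v).
Proof.
move=> ow F0; rewrite [RHS]big_mkcond -(sum_ev (F := fun v => if adj w v then F (ie v) else 0)).
  by apply: eq_bigr => q _; rewrite evK; case: ifP => // /negbT /F0.
by move=> v; case: ifP => // /adj_parity ->; rewrite ow.
Qed.

(** Read from the end of a ray inwards, the recurrence determines an eigenvector on
    that ray up to a factor; since the rays meet at the centre, the factors agree. *)
Lemma eigen_proportional (lam : K) (xi w : V -> K) :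
  (forall v, 0 < xi v) ->
  (forall v, \sum_(u | adj v u) xi u = lam * xi v) ->
  (forall v, \sum_(u | adj v u) w u = lam * w v) -> xi None = 1 ->
  forall v, w v = w None * xi v.
Proof.
move=> xi0 xiE wE xiN.
have key i : forall n, (n <= ray i)%N -> xray w i n =
    w (pt i (ray i)) / xi (pt i (ray i)) * xray xi i n.
  set c := _ / _.
  have ind k : (k <= ray i)%N ->
      xray w i (ray i - k) = c * xray xi i (ray i - k) /\
      xray w i (ray i - k).+1 = c * xray xi i (ray i - k).+1.
    elim: k => [_|k IH lk].
      rewrite subn0 !(xrayE _ (leqnn _)) /c divfK ?gt_eqF //; split=> //.
      by rewrite /xray ltnn mulr0.
    have [E1 E2] := IH (ltnW lk).
    have lr : (0 < ray i - k <= ray i)%N by lia.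
    have := xray_rec ray_gt0 xiE lr; have := xray_rec ray_gt0 wE lr.
    have -> : ((ray i - k).-1 = ray i - k.+1)%N by lia.
    have -> : ((ray i - k.+1).+1 = ray i - k)%N by lia.
    move=> F1 F2; split=> //.
    have -> : xray w i (ray i - k.+1) = lam * xray w i (ray i - k) - xray w i (ray i - k).+1.
      by rewrite -F1 addrK.
    have -> : xray xi i (ray i - k.+1) = lam * xray xi i (ray i - k) - xray xi i (ray i - k).+1.
      by rewrite -F2 addrK.
    by rewrite E1 E2; ring.
  move=> n ln; have [] := ind (ray i - n)%N; first by lia.
  by rewrite subKn.
move=> v; have [i [n [ln ->]]] := ptP v.
have := key i n ln; have := key i 0%N isT.
by rewrite !xrayE // pt0 xiN mulr1 => <-.
Qed.

Variables (xi : V -> K) (lam : K).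
Hypothesis xi_gt0 : forall v, 0 < xi v.
Hypothesis xi_eigen : forall v, \sum_(u | adj v u) xi u = lam * xi v.
Hypothesis xi_center : xi None = 1.
Local Notation x := (xray xi).
Local Notation al i := (xray xi i 1).

Section Markov.
Variables (wd : 'I_#|star_odd ray| -> K).
Variable z : 'I_#|star_even ray| -> 'I_#|star_odd ray| -> 'I_#|star_even ray| ->
  'I_#|star_odd ray| -> 'I_2 -> K.
Hypothesis wd_gt0 : forall s, 0 < wd s.
Let wb := weight_pull (star_h ray) wd.
Let wc := weight_pull (star_g ray) wd.
Let wa := weight_pull (star_g ray) wb.
Hypothesis Hz : connection (star_g ray) (star_k ray) (star_h ray) (star_g ray) wa wb wc wd z.

Let wb_gt0 q : 0 < wb q.
Proof. by apply: weight_pull_gt0 => //; apply: star_h_row. Qed.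
Let wc_gt0 q : 0 < wc q.
Proof. by apply: weight_pull_gt0 => //; apply: star_g_row. Qed.

Let up (f : 'I_#|star_even ray| -> K) s := \sum_r (star_g ray r s)%:R * f r.

(** The sum of |z|^2 over all cells with given q and s, computed once by regrouping for
    (q, r) and once by regrouping for (p, s). *)
Lemma markov_link q s : (0 < star_h ray q s)%N -> up wa q / wb q = up wc s / wd s.
Proof.
move=> hqs.
have dual := conn_dual_row (star_g_le1 (ray := ray)) (star_k_le2 ray_gt0)
  (star_h_le1 ray_gt0) (star_g_le1 (ray := ray)) (conn_supp Hz)
  (fun q => lt0r_neq0 (wb_gt0 q)) (fun r => lt0r_neq0 (wc_gt0 r))
  (star_paths_dual ray_gt0) (conn_dual Hz).
have g_pos p u : (0 < star_g ray p u)%N%:R = (star_g ray p u)%:R :> K.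
  by rewrite mxE; case: (adj _ _).
have E1 : \sum_r \sum_p \sum_t z p q r s t * (z p q r s t)^* = wb q * up wc s.
  rewrite mulr_sumr; apply: eq_bigr => r _.
  by rewrite dual eqxx hqs /= g_pos mulrCA.
have E2 : \sum_r \sum_p \sum_t z p q r s t * (z p q r s t)^* = up wa q * wd s.
  rewrite exchange_big mulr_suml; apply: eq_bigr => p _ /=.
  by rewrite (conn_row Hz) eqxx hqs andbT /= g_pos mulrA.
have wb0 := lt0r_neq0 (wb_gt0 q); have wd0 := lt0r_neq0 (wd_gt0 s).
apply: (mulIf wd0); rewrite mulrAC -E2 E1 mulrAC mulfV ?mul1r ?divfK ?mulr1 //.
Qed.

Let ga s := up wc s / wd s.

(** Along a ray the links join a vertex to itself, except at the end, and to the next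
    odd vertex. The first vertices of two rays are linked through the first vertex of
    the third one. *)
Lemma markov_const : exists mu, forall s, up wc s = mu * wd s.
Proof.
have link v w : odd (star_dist v) -> odd (star_dist w) -> (0 < two v w)%N ->
    up wa (io v) / wb (io v) = ga (io w).
  by move=> ov ow vw; apply: markov_link; rewrite mxE !ioK.
have odd1 i : odd (star_dist (pt i 1)) by rewrite pt_dist ?ray_gt0.
have ray_const i n : odd n -> (n <= ray i)%N -> ga (io (pt i n)) = ga (io (pt i 1)).
  elim/ltn_ind: n => -[|[|[|n]]] // IH on ln.
  rewrite /= negbK in on.
  have ln1 : (n.+1 <= ray i)%N by lia.
  rewrite -(IH n.+1) // -(link (pt i n.+1) (pt i n.+1))
    -1?(link (pt i n.+1) (pt i n.+3)) ?pt_dist //=.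
  - by rewrite negbK.
  - by rewrite (star_two_pt ray_gt0) // eqxx /=; case: ifP; lia.
  - by rewrite (star_two_pt ray_gt0) // !eqxx /=; lia.
have across i j : i != j -> ga (io (pt i 1)) = ga (io (pt j 1)).
  move=> ne; have [l /andP[li lj]] : exists l : 'I_3, (l != i) && (l != j).
    suff /card_gt0P[l] : (0 < #|[predC [:: i; j]]|)%N by rewrite !inE negb_or; exists l.
    rewrite -(ltn_add2l #|[:: i; j]|) addn0 cardC card_ord (leq_ltn_trans (card_size _)) //.
  have far u : l != u -> (0 < two (pt l 1) (pt u 1))%N.
    by move=> lu; rewrite (star_two_pt ray_gt0) // (negPf lu).
  by rewrite -(link (pt l 1) (pt i 1)) ?far // (link (pt l 1) (pt j 1)) ?far.
exists (ga (io (pt ord0 1))) => s.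
suff -> : ga (io (pt ord0 1)) = ga s by rewrite /ga divfK ?gt_eqF.
rewrite -[s in RHS]odK; have := od_odd s; have [i [n [ln ->]]] := ptP (od s).
rewrite pt_dist // => on; rewrite (ray_const i n) //.
by case: (eqVneq ord0 i) => [<-|/across].
Qed.

(** The weights form an eigenvector of G^T *m G. Pairing it with xi shows that the
    eigenvalue is lam ^+ 2, so it extends to an eigenvector of the adjacency matrix for
    the eigenvalue lam. *)
Lemma markov_weights : exists2 c, 0 < c & forall s, wd s = c * xi (od s).
Proof.
have [mu Hmu] := markov_const.
have lam0 : lam != 0 by rewrite gt_eqF ?(lam_gt0 ray_gt0 xi_gt0 xi_eigen).
have gT f r : weight_pull (star_g ray) f r = \sum_(v | adj (ev r) v) f (io v).
  rewrite /weight_pull (sum_od_adj (w := ev r)) ?ev_even // => [|q].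
    by apply: eq_bigr => v rv; rewrite mxE ioK ?rv ?mul1r // (adj_parity rv) ev_even.
  by rewrite mxE => /negPf->; rewrite mul0r.
have gU f s : up f s = \sum_(v | adj (od s) v) f (ie v).
  rewrite /up (sum_ev_adj (w := od s)) ?od_odd // => [|q].
    by apply: eq_bigr => v sv; rewrite mxE ieK 1?star_adj_sym ?sv ?mul1r // (adj_parity sv) od_odd.
  by rewrite mxE star_adj_sym => /negPf->; rewrite mul0r.
have mu_lam : mu = lam ^+ 2.
  have S0 : 0 < \sum_s xi (od s) * wd s.
    rewrite (bigD1 (io (pt ord0 1))) //= ltr_wpDr ?mulr_gt0 //.
    by rewrite sumr_ge0 // => s _; rewrite mulr_ge0 // ltW.
  apply: (mulIf (lt0r_neq0 S0)); rewrite !mulr_sumr.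
  transitivity (\sum_s xi (od s) * up wc s).
    by apply: eq_bigr => s _; rewrite Hmu mulrCA.
  transitivity (\sum_r wc r * (lam * xi (ev r))).
    transitivity (\sum_r wc r * weight_pull (star_g ray) (fun q => 1 * xi (od q)) r).
      rewrite /up /weight_pull; under eq_bigr => s _ do rewrite mulr_sumr.
      rewrite exchange_big; apply: eq_bigr => r _; rewrite mulr_sumr.
      by apply: eq_bigr => s _; rewrite mul1r mulrCA mulrA mulrC mulrCA mulrC.
    by apply: eq_bigr => r _; rewrite (pull_g xi_eigen) mul1r.
  transitivity (\sum_s lam * (wd s * up (fun r => xi (ev r)) s)).
    rewrite /up /wc /weight_pull; under eq_bigr => r _ do rewrite mulr_suml.
    rewrite exchange_big; apply: eq_bigr => s _; rewrite !mulr_sumr.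
    by apply: eq_bigr => r _; ring.
  apply: eq_bigr => s _; rewrite gU.
  rewrite (_ : \sum_(v | _) _ = lam * xi (od s)); first by ring.
  by rewrite -xi_eigen; apply: eq_bigr => v sv; rewrite ieK // (adj_parity sv) od_odd.
pose w v := if odd (star_dist v) then wd (io v) else (\sum_(u | adj v u) wd (io u)) / lam.
have wE v : \sum_(u | adj v u) w u = lam * w v.
  rewrite {2}/w; case: ifP => [ov|/negbT ov].
    have := Hmu (io v); rewrite gU ioK // mu_lam expr2 -mulrA => E.
    apply: (mulfI lam0); rewrite -E mulr_sumr; apply: eq_bigr => u vu.
    have ou : ~~ odd (star_dist u) by rewrite (adj_parity vu) ov.
    by rewrite /w (negPf ou) mulrC divfK // /wc gT ieK.
  rewrite mulrC divfK //; apply: eq_bigr => u vu.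
  by rewrite /w (adj_parity vu) ov.
have wxi := eigen_proportional xi_gt0 xi_eigen wE xi_center.
have wdE s : wd s = w None * xi (od s) by rewrite -wxi /w od_odd odK.
exists (w None) => //.
have := wd_gt0 (io (pt ord0 1)); rewrite wdE pmulr_lgt0 //.
Qed.

End Markov.

(** The coordinates of e i j are the entries of the connection on the two edges joining
    the centre to itself, with q and s the first vertices of the rays i and j. The
    block of (p, s) has at most one more entry in the same row; for i != j this entry
    is alone in its dual block, which gives its modulus and hence the norm of e i j.
    The norm of e i i is then found by taking traces. *)
Theorem star_vectors_of_square :
  admits_commuting_square K G (G *m G^T - 1%:M) (G^T *m G - 1%:M) G ->
  exists e : 'I_3 -> 'I_3 -> 'I_2 -> K,
  [/\ forall i, \sum_t e i i t * (e i i t)^* = (lam - al i) * (lam * al i - 1),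
      forall i j, i != j -> \sum_t e i j t * (e i j t)^* = al i + al j - lam * al i * al j,
      forall i t t', \sum_j e i j t * (e i j t')^* = (t == t')%:R * al i
    & forall j t t', \sum_i e i j t * (e i j t')^* = (t == t')%:R * al j].
Proof.
rewrite (star_kE ray_gt0) (star_hE ray_gt0) star_GE.
case/(connection_of_commuting_square (star_g_le1 (ray := ray)) (star_k_le2 ray_gt0)
  (star_h_le1 ray_gt0) (star_g_le1 (ray := ray)) (star_g_row ray_gt0) (star_h_row ray_gt0)).
move=> wd [z [wd0 Hz]].
have [c c0 wdE] := markov_weights wd0 Hz.
have {}wdE : wd = fun s => c * xi (od s) by apply/funext.
have wbE : weight_pull (star_h ray) wd = fun q => c * (lam ^+ 2 - 1) * xi (od q).
  by apply/funext => q; rewrite wdE (pull_h ray_gt0 xi_eigen) mulrA.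
have wcE : weight_pull (star_g ray) wd = fun r => c * lam * xi (ev r).
  by apply/funext => q; rewrite wdE (pull_g xi_eigen) mulrA.
have waE : weight_pull (star_g ray) (weight_pull (star_h ray) wd) =
    fun p => c * (lam ^+ 2 - 1) * lam * xi (ev p).
  by apply/funext => p; rewrite wbE (pull_g xi_eigen) !mulrA.
rewrite {}waE {}wbE {}wcE {}wdE in Hz.
pose kp := c ^+ 2 * (lam * (lam ^+ 2 - 1)).
have kp0 : 0 < kp.
  rewrite mulr_gt0 ?exprn_gt0 // mulr_gt0 ?(lam_gt0 ray_gt0 xi_gt0 xi_eigen xi_center) //.
  exact: (lam2_gt1 ray_gt0 xi_gt0 xi_eigen xi_center).
have sk : (sqrtC kp)^* = sqrtC kp by rewrite geC0_conj // sqrtC_ge0 ltW.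
pose y p q r s t := z p q r s t / sqrtC kp.
have yy p q r s t p' q' r' s' t' : y p q r s t * (y p' q' r' s' t')^* =
    z p q r s t * (z p' q' r' s' t')^* / kp.
  by rewrite /y rmorphM fmorphV /= sk mulrACA -invfM -expr2 sqrtCK.
have kpE (b : bool) u v : b%:R * (c * (lam ^+ 2 - 1) * lam * u * (c * v)) / kp =
    b%:R * (u * v) :> K.
  have -> : b%:R * (c * (lam ^+ 2 - 1) * lam * u * (c * v)) = b%:R * (u * v) * kp :> K.
    by rewrite /kp; ring.
  by rewrite mulfK // gt_eqF.
have kpE' (b : bool) u v : b%:R * (c * (lam ^+ 2 - 1) * u * (c * lam * v)) / kp =
    b%:R * (u * v) :> K.
  have -> : b%:R * (c * (lam ^+ 2 - 1) * u * (c * lam * v)) = b%:R * (u * v) * kp :> K.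
    by rewrite /kp; ring.
  by rewrite mulfK // gt_eqF.
have ysupp p q r s (t : 'I_2) : ~~ [&& adj (ev p) (od q), (t < two (ev p) (ev r))%N,
    (0 < two (od q) (od s))%N & adj (ev r) (od s)] -> y p q r s t = 0.
  move=> nv; rewrite /y (conn_supp Hz) ?mul0r //; apply: contra nv.
  by rewrite !mxE !lt0b.
pose a i := io (pt i 1); pose o := ie None.
have odd1 i : odd (star_dist (pt i 1)) by rewrite pt_dist ?ray_gt0.
have aE i : od (a i) = pt i 1 by rewrite ioK.
have oE : ev o = None by rewrite ieK.
have adj_o i : adj None (pt i 1) by rewrite -(pt0 ray i) pt_adj ?eqxx.
have two_o : two None None = 2%N by rewrite -(pt0 ray ord0) (star_two_pt ray_gt0).
have sum_a (F : 'I_#|star_odd ray| -> K) :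
    (forall q, ~~ adj None (od q) -> F q = 0) -> \sum_q F q = \sum_i F (a i).
  by move=> F0; rewrite (sum_od_adj (w := None)) // (sum_adj_center ray_gt0).
pose e i j t := y o (a i) o (a j) t.
have e_col j t t' : \sum_i e i j t * (e i j t')^* = (t == t')%:R * al j.
  rewrite -(sum_a (fun q => y o q o (a j) t * (y o q o (a j) t')^*)) => [|q]; last first.
    by move=> nq; rewrite ysupp ?mul0r // oE (negPf nq).
  under eq_bigr => q _ do rewrite yy.
  rewrite -mulr_suml (conn_col Hz) kpE !mxE lt0b oE aE adj_o two_o ltn_ord eqxx !andbT.
  by rewrite xi_center mul1r xrayE.
have e_row i t t' : \sum_j e i j t * (e i j t')^* = (t == t')%:R * al i.
  rewrite -(sum_a (fun s => y o (a i) o s t * (y o (a i) o s t')^*)) => [|q]; last first.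
    by move=> nq; rewrite ysupp ?mul0r // oE (negPf nq) !andbF.
  under eq_bigr => q _ do rewrite yy.
  rewrite -mulr_suml (conn_dual Hz) kpE' !mxE lt0b oE aE adj_o two_o ltn_ord eqxx !andbT.
  by rewrite xi_center mulr1 xrayE.
have x2E i : x i 2 = lam * al i - 1 by apply: xray2.
have e_off i j : i != j -> \sum_t e i j t * (e i j t)^* = al i + al j - lam * al i * al j.
  move=> ne.
  have row : \sum_r \sum_t y o (a i) r (a j) t * (y o (a i) r (a j) t)^* = al j.
    under eq_bigr => r _ do [under eq_bigr => t _ do rewrite yy; rewrite -mulr_suml].
    rewrite -mulr_suml (conn_row Hz) kpE !mxE lt0b oE !aE adj_o eqxx.
    rewrite (star_two_pt ray_gt0) // (negPf ne) /= xi_center !mul1r.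
    by rewrite xrayE.
  move: row; rewrite (sum_ev_adj (w := pt j 1)) //; last first.
    move=> r nr; rewrite big1 // => t _; rewrite ysupp ?mul0r // !aE (star_adj_sym (ev r)).
    by rewrite (negPf nr) !andbF.
  (* If the ray j has length one, then e i j is the whole row. *)
  rewrite (sum_adj_ray ray_gt0) ?ray_gt0 //= -/o; case: ifP => lj; last first.
    rewrite addr0 => ->; have : x j 2 = 0 by rewrite /xray lj.
    by rewrite x2E => xj; have -> : lam * al i * al j = al i * (lam * al j - 1) + al i;
      [ring|rewrite xj; ring].
  have ev2 : ~~ odd (star_dist (pt j 2)) by rewrite pt_dist.
  have dual : \sum_s y o (a i) (ie (pt j 2)) s 0 * (y o (a i) (ie (pt j 2)) s 0)^* = al i * x j 2.
    under eq_bigr => s _ do rewrite yy.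
    rewrite -mulr_suml (conn_dual Hz) kpE' !mxE lt0b oE aE ieK // adj_o !eqxx.
    rewrite -(pt0 ray j) (star_two_pt ray_gt0) // eqxx /= mul1r.
    by rewrite !xrayE.
  move: dual; rewrite (sum_od_adj (w := pt j 2)) //; last first.
    by move=> s ns; rewrite ysupp ?mul0r // ieK // (negPf ns) !andbF.
  rewrite (sum_adj_ray ray_gt0) //= -/(a j) (_ : (if _ then _ else 0) = 0); last first.
    case: ifP => lj3 //; rewrite ysupp ?mul0r // ioK ?pt_dist // aE.
    by rewrite (star_two_pt ray_gt0) // (negPf ne) /= !andbF.
  rewrite addr0 => dual.
  have y1 : y o (a i) (ie (pt j 2)) (a j) 1 = 0.
    rewrite ysupp // oE ieK // -(pt0 ray j) (star_two_pt ray_gt0) // eqxx /=.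
    by rewrite !andbF.
  have -> : \sum_t y o (a i) (ie (pt j 2)) (a j) t * (y o (a i) (ie (pt j 2)) (a j) t)^* =
      al i * x j 2.
    rewrite big_ord_recl big_ord1 (_ : lift _ _ = 1); last exact: val_inj.
    by rewrite y1 mul0r addr0.
  move=> E; rewrite -[LHS](addrK (al i * x j 2)) E x2E; ring.
exists e; split=> // i.
have tot : \sum_j \sum_t e i j t * (e i j t)^* = al i *+ 2.
  rewrite exchange_big /= (eq_bigr (fun=> al i)) => [|t _]; last by rewrite e_row eqxx mul1r.
  by rewrite sumr_const card_ord.
move: tot; rewrite (bigD1 i) //=.
have -> : \sum_(j | j != i) \sum_t e i j t * (e i j t)^* =
    al i *+ 2 + (lam - al i) * (1 - lam * al i).
  rewrite (eq_bigr (fun j => al i + (1 - lam * al i) * al j)) => [|j nj]; last first.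
    by rewrite e_off 1?eq_sym //; ring.
  rewrite big_split /= sumr_const -mulr_sumr (_ : #|_| = 2%N); last first.
    by have := cardC1 i; rewrite card_ord.
  have := xray_sum ray_gt0 xi_eigen xi_center; rewrite (bigD1 i) //= => S.
  by rewrite -[X in _ + _ * X](addKr (al i)) S; ring.
move=> E; apply: (addIr (al i *+ 2 + (lam - al i) * (1 - lam * al i))).
by rewrite E; ring.
Qed.

End StarVectors.

(** * Real eigenvectors and complex vectors *)

Local Open Scope complex_scope.

Lemma perron_frobenius_star (R : realType) (ray : 'I_3 -> nat)
    (xi : star_vertex ray -> R) (lam : R) :
  perron_frobenius (map_mx intr (star_mx ray)) lam (\col_p xi (star_enum p)) ->
  (forall v, 0 < xi v) /\
  (forall v, \sum_(u | star_adj v u) xi u = lam * xi v).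
Proof.
case=> pos eig _; have [f fK Kf] := star_enum_bij ray; split=> v.
  by have := pos (f v); rewrite mxE Kf.
have := congr1 (fun A : 'cV_(_) => A (f v) 0) eig; rewrite !mxE Kf => <-.
rewrite big_mkcond (reindex (@star_enum ray)) /=; last by exists f => ? _; rewrite ?fK ?Kf.
apply: eq_bigr => p _; rewrite !mxE Kf.
by case: (star_adj _ _); rewrite /= ?mul1r ?mul0r.
Qed.

Lemma sum_tensE (K : numClosedFieldType) I (r : seq I) (F : I -> 'cV[K]_2) t t' :
  (\sum_(i <- r) tens (F i) (F i)) t t' = \sum_(i <- r) F i t 0 * (F i t' 0)^*.
Proof. by rewrite summxE; apply: eq_bigr => i _; rewrite mxE big_ord1 !mxE. Qed.

Theorem theorem5p1 (R : realType) (k l m : nat)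
    (hk : (0 < k)%N) (hl : (0 < l)%N) (hm : (0 < m)%N)
    (xi : star_vertex (ray3 k l m) -> R) :
  let ray := ray3 k l m in
  let G := star_G ray in
  let alpha : 'I_3 -> R := fun i => xi (star_first (ray3_gt0 hk hl hm) i) in
  let lambda : R := \sum_(i < 3) alpha i in
  perron_frobenius (map_mx intr (star_mx ray)) lambda
    (\col_p xi (star_enum p)) ->
  xi (star_center ray) = 1 ->
  admits_commuting_square R[i] G (G *m G^T - 1%:M) (G^T *m G - 1%:M) G
  <->
  exists e : 'I_3 -> 'I_3 -> 'cV[R[i]]_2,
    [/\ forall i, dotc (e i i) (e i i) =
          ((lambda - alpha i) * (lambda * alpha i - 1))%:C,
        forall i j, i != j -> dotc (e i j) (e i j) =
          (alpha i + alpha j - lambda * alpha i * alpha j)%:C,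
        forall i, \sum_(j < 3) tens (e i j) (e i j) = (alpha i)%:C%:M
      & forall j, \sum_(i < 3) tens (e i j) (e i j) = (alpha j)%:C%:M].
Proof.
move=> ray G alpha lambda /perron_frobenius_star [xi0 xiE] xiN.
have ray_gt0 := ray3_gt0 hk hl hm.
pose xiC v : R[i] := (xi v)%:C.
have xiC0 v : 0 < xiC v by rewrite ltcR.
have xiCE v : \sum_(u | star_adj v u) xiC u = lambda%:C * xiC v.
  by rewrite -rmorphM -xiE rmorph_sum.
have xiCN : xiC None = 1 by rewrite /xiC xiN rmorph1.
have alE i : xray xiC i 1 = (alpha i)%:C by rewrite xrayE // (pt_first (ray3_gt0 hk hl hm)).
have diagE i : ((lambda - alpha i) * (lambda * alpha i - 1))%:C =
    (lambda%:C - (alpha i)%:C) * (lambda%:C * (alpha i)%:C - 1).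
  by rewrite rmorphM !rmorphB rmorphM rmorph1.
have offE i j : (alpha i + alpha j - lambda * alpha i * alpha j)%:C =
    (alpha i)%:C + (alpha j)%:C - lambda%:C * (alpha i)%:C * (alpha j)%:C.
  by rewrite rmorphB rmorphD !rmorphM.
split=> [/(star_vectors_of_square ray_gt0 xiC0 xiCE xiCN) [e [ed eo er ec]]|[e [ed eo er ec]]].
  exists (fun i j => \col_t e i j t); split=> [i|i j ne|i|j].
  - rewrite diagE -alE -ed; apply: eq_bigr => t _; by rewrite !mxE.
  - rewrite offE -!alE -eo //; apply: eq_bigr => t _; by rewrite !mxE.
  - apply/matrixP => t t'; rewrite sum_tensE mxE -mulr_natl -alE -er.
    by apply: eq_bigr => j _; rewrite !mxE.
  - apply/matrixP => t t'; rewrite sum_tensE mxE -mulr_natl -alE -ec.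
    by apply: eq_bigr => i _; rewrite !mxE.
apply: (star_square_of_vectors ray_gt0 xiC0 xiCE xiCN (e := fun i j t => e i j t 0)).
- by move=> i; rewrite alE -diagE -ed.
- by move=> i j ne; rewrite !alE -offE -eo.
- by move=> i t t'; rewrite -sum_tensE er mxE alE mulr_natl.
- by move=> j t t'; rewrite -sum_tensE ec mxE alE mulr_natl.
Qed.
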